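(* Let $\mathcal M$ be a (weakly o-minimal) non-valuational structure. Then $\mathcal M^*_\emptyset$ and $\mathcal M^*$ have the same definable sets (definable with parameters). Moreover, if $\mathcal M\equiv\mathcal N$ then $\mathcal M^*_\emptyset\equiv\mathcal N^*_\emptyset$.
   Context: A non-valuational structure is an expansion $\mathcal M$ of an ordered group which is weakly o-minimal (every definable subset of $M$ is a finite union of convex sets) and has no definable non-trivial convex subgroup (i.e. other than $\{0\}$ and $M$). ''Definable'' means definable with parameters unless stated otherwise. A structure elementarily equivalent to a non-valuational structure is again non-valuational. The definable Dedekind completion $\overline M$ is the set of definable cuts in $\mathcal M$, i.e. of nonempty $\mathcal M$-definable open subsets of $M$ that are bounded above and downward closed, ordered by inclusion. $M$ is viewed as a (dense) subset of $\overline M$ via $a\mapsto(-\infty,a)$. $\overline M$ has the order topology and $\overline M^n$ the product topology; $\mathrm{cl}_{\overline M}$ denotes closure in $\overline M^n$. For $A\subseteq M$, $\mathcal M^*_A$ is the expansion of $\langle\overline M,<\rangle$ by a predicate $\hat X$, interpreted as $\mathrm{cl}_{\overline M}(X)\subseteq\overline M^n$, for every $n$ and every $X\subseteq M^n$ definable in $\mathcal M$ over $A$. We write $\mathcal M^*=\mathcal M^*_M$ for the structure obtained with $A=M$. When $\mathcal M\equiv\mathcal N$, the structures $\mathcal M^*_\emptyset$ and $\mathcal N^*_\emptyset$ are structures in the same language: if $\phi$ is a formula without parameters, the predicate associated to $\phi$ is interpreted as $\mathrm{cl}_{\overline M}(\phi(\mathcal M))$ and $\mathrm{cl}_{\overline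 N}(\phi(\mathcal N))$, respectively. *)

(* Defs.v *)
(* MathComp / MathComp-Analysis development. *)
From HB Require Import structures.
From mathcomp Require Import all_boot all_classical topology.

Set Implicit Arguments.
Unset Strict Implicit.
Unset Printing Implicit Defensive.

Local Open Scope classical_set_scope.

Record language := Language {
  fsym : Type;
  farity : fsym -> nat;
  rsym : Type;
  rarity : rsym -> nat }.

Inductive term (L : language) (V : Type) : Type :=
| TVar of V
| TApp (f : fsym L) of ('I_(farity f) -> term L V).

(* [formula L V]: first-order formulas with free variables in [V]. A quantifier
   binds the variable [None] of [option V]. The other connectives are obtained
   classically from [FFalse], [FImp] and [FAll]. *)
Inductive formula (L : language) (V : Type) : Type :=
| FFalse
| FEq of term L V & term L V
| FRel (r : rsym L) of ('I_(rarity r) -> term L V)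
| FImp of formula L V & formula L V
| FAll of formula L (option V).

Record structure (L : language) := Structure {
  carrier :> Type;
  finterp : forall f : fsym L, ('I_(farity f) -> carrier) -> carrier;
  rinterp : forall r : rsym L, ('I_(rarity r) -> carrier) -> Prop }.

Fixpoint eval L (M : structure L) (V : Type) (v : V -> M) (t : term L V) : M :=
  match t with
  | TVar x => v x
  | TApp f a => finterp (fun i => eval v (a i))
  end.

Definition extend (T V : Type) (v : V -> T) (x : T) (y : option V) : T :=
  if y is Some z then v z else x.

Fixpoint sat L (M : structure L) (V : Type) (phi : formula L V) :
    (V -> M) -> Prop :=
  match phi with
  | FFalse => fun=> False
  | FEq s t => fun v => eval v s = eval v t
  | FRel r a => fun v => rinterp (fun i => eval v (a i))
  | FImp f g => fun v => sat f v -> sat g v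
  | FAll f => fun v => forall x : M, sat f (extend v x)
  end.

Definition sentence (L : language) := formula L void.

Definition elementarily_equivalent L (M N : structure L) : Prop :=
  forall phi : sentence L, sat phi (@of_void M) <-> sat phi (@of_void N).

Definition join_val (T U V : Type) (x : U -> T) (c : V -> T) (y : U + V) : T :=
  match y with inl u => x u | inr p => c p end.

(* The parameters [P] of [phi] are read in [M] through [c]; parameters from a
   subset A of M are the case where [c] has range A. *)
Definition solutions L (M : structure L) (P : Type) (c : P -> M) n
    (phi : formula L ('I_n + P)) : set ('I_n -> M) :=
  [set x | sat phi (join_val x c)].

Definition definable L (M : structure L) n (X : set ('I_n -> M)) : Prop :=
  exists phi : formula L ('I_n + M), X = solutions id phi.

Definition definable1 L (M : structure L) (X : set M) : Prop :=
  definable [set x : 'I_1 -> M | X (x ord0)].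

Definition pair2 (T : Type) (x y : T) (i : 'I_2) : T :=
  if val i == 0 then x else y.

Definition open_rays (T : Type) (lt : T -> T -> Prop) : set (set T) :=
  [set U | exists a, U = [set x | lt x a] \/ U = [set x | lt a x]].

(* [otop lt] is [T] with the order topology of [lt]. The library's
   [orderTopologicalType] is not used because it presupposes a total order,
   whereas structures in the language of ordered groups are arbitrary here. *)
Definition otop (T : Type) (lt : T -> T -> Prop) : Type := T.

Section OrderTopology.
Variables (T : Type) (lt : T -> T -> Prop).
HB.instance Definition _ := gen_eqMixin (otop lt).
HB.instance Definition _ := gen_choiceMixin (otop lt).
HB.instance Definition _ :=
  @isSubBaseTopological.Build (otop lt) (set (otop lt)) (open_rays lt) id.
End OrderTopology.

Definition convex_set (T : Type) (lt : T -> T -> Prop) (C : set T) : Prop :=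
  forall x y z, C x -> C y -> lt x z -> lt z y -> C z.

(* [og_lang L]: the language of ordered groups {<, +} together with the symbols
   of [L]. The structures for [og_lang L] satisfying [is_ordered_group] are
   thus the expansions of ordered groups. *)
Variant og_fsym (L : language) := OgAdd | OgFun of fsym L.
Variant og_rsym (L : language) := OgLt | OgRel of rsym L.

Definition og_farity L (f : og_fsym L) : nat :=
  match f with OgAdd => 2 | OgFun g => farity g end.
Definition og_rarity L (r : og_rsym L) : nat :=
  match r with OgLt => 2 | OgRel s => rarity s end.

Definition og_lang (L : language) : language :=
  Language (@og_farity L) (@og_rarity L).

Section OrderedGroupExpansions.
Variables (L : language) (M : structure (og_lang L)).

Definition slt (x y : M) : Prop := @rinterp _ M (OgLt L) (pair2 x y).
Definition sadd (x y : M) : M := @finterp _ M (OgAdd L) (pair2 x y).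

Definition is_zero (e : M) : Prop := forall x, sadd e x = x /\ sadd x e = x.

Record is_ordered_group : Prop := IsOrderedGroup {
  og_irr : forall x, ~ slt x x;
  og_trans : forall x y z, slt x y -> slt y z -> slt x z;
  og_total : forall x y, [\/ slt x y, x = y | slt y x];
  og_addA : forall x y z, sadd x (sadd y z) = sadd (sadd x y) z;
  og_zero : exists e, is_zero e;
  og_opp : forall x, exists y, is_zero (sadd x y) /\ is_zero (sadd y x);
  og_lt_addl : forall x y z, slt x y -> slt (sadd z x) (sadd z y);
  og_lt_addr : forall x y z, slt x y -> slt (sadd x z) (sadd y z) }.

Definition weakly_o_minimal : Prop :=
  forall X : set M, definable1 X ->
  exists k (C : 'I_k -> set M),
    (forall i, convex_set slt (C i)) /\ X = \bigcup_i C i.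

Definition is_subgroup (H : set M) : Prop :=
  [/\ forall e, is_zero e -> H e,
      forall x y, H x -> H y -> H (sadd x y)
    & forall x y, H x -> is_zero (sadd x y) -> H y].

Definition non_valuational : Prop :=
  [/\ is_ordered_group, weakly_o_minimal
    & forall H : set M, definable1 H -> convex_set slt H -> is_subgroup H ->
      H = is_zero \/ H = setT].

Definition is_definable_cut (C : set M) : Prop :=
  [/\ definable1 C,
      open (C : set (otop slt)),
      C !=set0,
      exists b, forall x, C x -> slt x b \/ x = b
    & forall x y, C x -> slt y x -> C y].

Definition completion : Type := {C : set M | is_definable_cut C}.

Definition cut_lt (C D : completion) : Prop := proj1_sig C `<` proj1_sig D.

(* Image of [X] under a |-> (-oo, a). It is phrased without the embedding as a
   function since (-oo, a) is only a definable cut for suitable [M]. *)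
Definition completion_image n (X : set ('I_n -> M)) :
    set ('I_n -> completion) :=
  [set c | exists2 x, X x & forall i, proj1_sig (c i) = [set y | slt y (x i)]].

Definition cl_completion n (X : set ('I_n -> M)) : set ('I_n -> completion) :=
  closure (completion_image X : set {ptws 'I_n -> otop cut_lt}).

End OrderedGroupExpansions.

(* Besides <, the language has an n-ary predicate for every formula of
   [og_lang L] in n variables with parameters from [P]. *)
Variant star_rsym (L : language) (P : Type) :=
| StarLt
| StarCl n of formula (og_lang L) ('I_n + P).

Definition star_rarity L (P : Type) (r : star_rsym L P) : nat :=
  match r with StarLt => 2 | StarCl n _ => n end.

Definition star_lang (L : language) (P : Type) : language :=
  @Language void (@of_void nat) _ (@star_rarity L P).

Definition star_rinterp L (M : structure (og_lang L)) (P : Type) (c : P -> M)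
    (r : star_rsym L P) : ('I_(star_rarity r) -> completion M) -> Prop :=
  match r return ('I_(star_rarity r) -> completion M) -> Prop with
  | StarLt => fun x => cut_lt (x ord0) (x ord_max)
  | StarCl n phi => cl_completion (solutions c phi)
  end.

(* The structure M^*_A, where A is the range of [c]. *)
Definition star L (M : structure (og_lang L)) (P : Type) (c : P -> M) :
    structure (star_lang L P) :=
  @Structure (star_lang L P) (completion M)
    (fun f : void => match f with end) (star_rinterp c).

(* M^*_emptyset; its language does not depend on M. *)
Definition star_empty L (M : structure (og_lang L)) :
  structure (star_lang L void) := star (@of_void M).

(* M^* = M^*_M. *)
Definition star_full L (M : structure (og_lang L)) :
  structure (star_lang L M) := star (fun a : M => a).

(* Main.v *)
Require Import Defs.
From mathcomp Require Import all_boot finmap all_classical topology.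

(* A closed subset of a power of the completion is coded if the boxes with corners
   in M that avoid it form a definable family. By a compactness argument, coded
   sets are stable under finite unions and intersections, closures of definable
   unions and projections along bounded intervals. Weak o-minimality provides a
   dimension, which drops in two situations:
   - from a definable subset X of a power of M to cl X minus X, taken inside M;
   - from a coded set F to the set of points near which F is neither contained in
     a member of a given definable increasing family of coded sets nor disjoint
     from all of them.
   By the first drop, X is the trace on M of a finite Boolean combination of
   closures of sets defined without further parameters. Applied to the family of
   the boxes that meet X_a, this defines cl X_a from closures of sets defined
   without parameters. By the second drop, the projection of a difference of two
   coded sets is again a finite union of such differences. Every formula of the
   language of M^* without parameters is thus equivalent to such a union, in the
   same way in M and in any structure elementarily equivalent to M, and for a
   sentence this is a first-order property of M. *)

Set Implicit Arguments.
Unset Strict Implicit.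
Unset Printing Implicit Defensive.
Local Open Scope classical_set_scope.
Local Notation eval := Defs.eval.

(** Every definable cut is pinched between points of M at distance less than any given positive e
    ([tame_nv]). This turns coverings by definable boxes into Lebesgue numbers in M, and statements
    about all points of the completion into first-order statements about M. The obstacle is the
    points of the completion outside M: a closed set may have no point in M, and a definable family
    of such sets, like the translates of one irrational cut, may still meet every interval. For
    chains of coded sets this cannot happen on every small box ([hidden_avoidP]). Hence the families
    to be united are increasing, with two parameters: the interval of projection and the distance to
    the subtracted set. Formulas are handled for a whole family of structures at once; the index
    type [bool] yields the pair M, N. Dimensions are computed in M alone, and only one of their
    consequences is carried over to N, the emptiness of a last stratum, which is a sentence. *)

(** * Renaming of variables in formulas *)

Fixpoint tren L (V W : Type) (f : V -> W) (t : term L V) : term L W :=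
  match t with
  | TVar x => TVar L (f x)
  | TApp g a => TApp (fun i => tren f (a i))
  end.

Fixpoint fren L (V : Type) (phi : formula L V) : forall W, (V -> W) -> formula L W :=
  match phi with
  | FFalse => fun W _ => FFalse L W
  | FEq s t => fun W f => FEq (tren f s) (tren f t)
  | FRel r a => fun W f => FRel (fun i => tren f (a i))
  | FImp p q => fun W f => FImp (fren p f) (fren q f)
  | FAll p => fun W f => FAll (fren p (omap f))
  end.

Lemma eval_tren L (M : structure L) (V W : Type) (f : V -> W) (t : term L V)
  (v : W -> M) : eval v (tren f t) = eval (v \o f) t.
Proof. by elim: t => //= g a IH; congr (finterp _); apply: funext => i. Qed.

Lemma extend_omap (T V W : Type) (f : V -> W) (v : W -> T) x :
  extend v x \o omap f = extend (v \o f) x.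
Proof. by apply: funext => -[]. Qed.

Lemma extendK (T V : Type) (w : option V -> T) :
  extend (fun i => w (Some i)) (w None) = w.
Proof. by apply: funext => -[]. Qed.

Lemma sat_fren L (M : structure L) (V W : Type) (f : V -> W)
  (phi : formula L V) (v : W -> M) : sat (fren phi f) v <-> sat phi (v \o f).
Proof.
elim: phi W f v => {V} /= [V|V s t|V r a|V p IHp q IHq|V p IH] W f v //.
- by rewrite !eval_tren.
- suff -> : (fun i => eval v (tren f (a i))) = (fun i => eval (v \o f) (a i)) by [].
  by apply: funext => i; rewrite eval_tren.
- by rewrite IHp IHq.
- split=> H x; first by rewrite -extend_omap -IH.
  by rewrite IH extend_omap.
Qed.

(** * Uniformly definable sets *)

(* [X] is given, simultaneously in all the structures [St k], by one formula
   whose parameters from [P] are read through [c k]. *)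
Definition UD L (K : Type) (St : K -> structure L) (P : Type)
    (c : forall k, P -> St k) (V : Type) (X : forall k, (V -> St k) -> Prop) :=
  exists phi : formula L (V + P), forall k v, X k v <-> sat phi (join_val v (c k)).

Definition UT L (K : Type) (St : K -> structure L) (P : Type)
    (c : forall k, P -> St k) (V : Type) (t : forall k, (V -> St k) -> St k) :=
  exists s : term L (V + P), forall k v, t k v = eval (join_val v (c k)) s.

Section UD.
Context {L : language} {K : Type} {St : K -> structure L} {P : Type}.
Context {c : forall k, P -> St k}.
Notation UD := (UD c).
Notation UT := (UT c).

Lemma UD_ext V (X Y : forall k, (V -> St k) -> Prop) :
  (forall k v, X k v <-> Y k v) -> UD X -> UD Y.
Proof. by move=> XY [phi H]; exists phi => k v; rewrite -XY. Qed.

Lemma UD_const V (Q : Prop) : UD (fun k (_ : V -> St k) => Q).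
Proof.
have [q|q] := pselect Q; last by exists (FFalse L _) => k v; split.

by exists (FImp (FFalse L _) (FFalse L _)) => k v; split=> /=.
Qed.

Lemma UD_imp V (X Y : forall k, (V -> St k) -> Prop) :
  UD X -> UD Y -> UD (fun k v => X k v -> Y k v).
Proof. by move=> [p Hp] [q Hq]; exists (FImp p q) => k v /=; rewrite Hp Hq. Qed.

Lemma UD_not V (X : forall k, (V -> St k) -> Prop) :
  UD X -> UD (fun k v => ~ X k v).
Proof. by move=> HX; apply: UD_imp => //; apply: UD_const. Qed.

Lemma UD_and V (X Y : forall k, (V -> St k) -> Prop) :
  UD X -> UD Y -> UD (fun k v => X k v /\ Y k v).
Proof.
move=> HX HY; have := UD_not (UD_imp HX (UD_not HY)).
apply: UD_ext => k v; split; last by move=> [x y]; apply.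
by move=> H; split; apply: contrapT => h; apply: H => // ?.
Qed.

Lemma UD_or V (X Y : forall k, (V -> St k) -> Prop) :
  UD X -> UD Y -> UD (fun k v => X k v \/ Y k v).
Proof.
move=> HX HY; have := UD_imp (UD_not HX) HY.
apply: UD_ext => k v; split=> [H|[x|y]//].
by have [x|x] := pselect (X k v); [left|right; apply: H].
Qed.

Lemma UD_iff V (X Y : forall k, (V -> St k) -> Prop) :
  UD X -> UD Y -> UD (fun k v => X k v <-> Y k v).
Proof. by move=> HX HY; apply: UD_and; apply: UD_imp. Qed.

Lemma UD_all V (X : forall k, (V -> St k) -> St k -> Prop) :
  UD (V := option V) (fun k w => X k (fun i => w (Some i)) (w None)) ->
  UD (fun k v => forall x : St k, X k v x).
Proof.
move=> [phi H].
pose f (i : option V + P) : option (V + P) :=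
  match i with inl None => None | inl (Some j) => Some (inl j)
             | inr p => Some (inr p) end.
have E k (v : V -> St k) x : extend (join_val v (c k)) x \o f
    = join_val (extend v x) (c k) by apply: funext => -[[]|].
exists (FAll (fren phi f)) => k v /=; split=> h x.
  by rewrite sat_fren E -H; apply: h.
by have := h x; rewrite sat_fren E -H.
Qed.

Lemma UD_ex V (X : forall k, (V -> St k) -> St k -> Prop) :
  UD (V := option V) (fun k w => X k (fun i => w (Some i)) (w None)) ->
  UD (fun k v => exists x : St k, X k v x).
Proof.
move=> HX.
have := UD_not (@UD_all V (fun k v x => ~ X k v x) (UD_not HX)).
apply: UD_ext => k v; split; last by move=> [x hx] /(_ x).
by move=> h; apply: contrapT => h'; apply: h => x hx; apply: h'; exists x.
Qed.

Lemma UT_var V (j : V) : UT (fun k v => v j).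
Proof. by exists (TVar L (inl j)). Qed.

Lemma UD_eq V t1 t2 : UT (V := V) t1 -> UT t2 -> UD (fun k v => t1 k v = t2 k v).
Proof. by move=> [s1 H1] [s2 H2]; exists (FEq s1 s2) => k v; rewrite H1 H2. Qed.

Lemma UD_rel V (r : rsym L) (t : forall k, 'I_(rarity r) -> (V -> St k) -> St k) :
  (forall i, UT (fun k => t k i)) ->
  UD (fun k v => rinterp (fun i => t k i v)).
Proof.
move=> /choice[s H]; exists (FRel s) => k v /=.
by suff -> : (fun i => t k i v) = (fun i => eval (join_val v (c k)) (s i)) by [];
  apply: funext => i; rewrite H.
Qed.

Lemma UT_app V (g : Defs.fsym L) (t : forall k, 'I_(farity g) -> (V -> St k) -> St k) :
  (forall i, UT (fun k => t k i)) ->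
  UT (fun k v => finterp (fun i => t k i v)).
Proof.
move=> /choice[s H]; exists (TApp s) => k v /=.
by suff -> : (fun i => t k i v) = (fun i => eval (join_val v (c k)) (s i)) by [];
  apply: funext => i; rewrite H.
Qed.

Lemma UD_ren V W (f : V -> W) (X : forall k, (V -> St k) -> Prop) :
  UD X -> UD (fun k w => X k (fun i => w (f i))).
Proof.
move=> [phi H].
pose g (i : V + P) : W + P := match i with inl j => inl (f j) | inr p => inr p end.
exists (fren phi g) => k v; rewrite sat_fren H.
have -> // : join_val v (c k) \o g = join_val (fun i => v (f i)) (c k).
by apply: funext => -[].
Qed.

Lemma UD_conj_seq V (I : eqType) (s : seq I) (X : I -> forall k, (V -> St k) -> Prop) :
  (forall i, UD (X i)) -> UD (fun k v => forall i, i \in s -> X i k v).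
Proof.
move=> HX; elim: s => [|j s IH].
  by apply: UD_ext (UD_const _ True) => k v; split.
apply: UD_ext (UD_and (HX j) IH) => k v; split.
  by move=> [h1 h2] i; rewrite inE => /orP[/eqP->|/h2].
move=> h; split; first by apply: h; rewrite mem_head.
by move=> i i_s; apply: h; rewrite inE i_s orbT.
Qed.

Lemma UD_conj V (I : finType) (X : forall k, (V -> St k) -> I -> Prop) :
  (forall i, UD (fun k v => X k v i)) -> UD (fun k v => forall i, X k v i).
Proof.
move=> /(@UD_conj_seq V I (enum I) (fun i k v => X k v i)).
by apply: UD_ext => k v; split=> h i; [apply: h; rewrite mem_enum|move=> _].
Qed.

Lemma UD_disj V (I : finType) (X : forall k, (V -> St k) -> I -> Prop) :
  (forall i, UD (fun k v => X k v i)) -> UD (fun k v => exists i, X k v i).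
Proof.
move=> HX; have := UD_not (@UD_conj V I (fun k v i => ~ X k v i)
  (fun i => UD_not (HX i))).
apply: UD_ext => k v; split; last by move=> [x hx] /(_ x).
by move=> h; apply: contrapT => h'; apply: h => x hx; apply: h'; exists x.
Qed.

(** A block of quantifiers is built one coordinate at a time: the coordinates not yet in [s] are
    still free and are read from the right summand of the context. *)
Lemma UD_allV_seq V (W : eqType) (s : seq W) (X : forall k, (V -> St k) -> (W -> St k) -> Prop) :
  UD (V := V + W) (fun k w => X k (fun i => w (inl i)) (fun i => w (inr i))) ->
  UD (V := V + W) (fun k w => forall x : W -> St k,
    (forall j, j \notin s -> x j = w (inr j)) -> X k (fun i => w (inl i)) x).
Proof.
move=> HX; elim: s => [|j s IH].
  apply: UD_ext HX => k w; split=> [h x hx|]; last by apply.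
  by have -> : x = (fun i => w (inr i)) by apply: funext => i; apply: hx.
pose g (i : V + W) : option (V + W) :=
  match i with inr l => if l == j then None else Some (inr l) | inl l => Some (inl l) end.
have := UD_ren g IH => IH'.
have := @UD_all (V + W) (fun k v z => forall x : W -> St k,
    (forall j', j' \notin s -> x j' = if j' == j then z else v (inr j')) ->
    X k (fun i => v (inl i)) x).
have E : UD (V := option (V + W)) (fun k w => forall x : W -> St k,
    (forall j', j' \notin s -> x j' = if j' == j then w None else w (Some (inr j'))) ->
    X k (fun i => w (Some (inl i))) x).
  apply: UD_ext IH' => k w; split=> h x hx; apply: h => j' /hx; rewrite /g;
  by case: eqP.
move=> /(_ E); apply: UD_ext => k w; split=> [h x hx|h z x hx].
  apply: (h (x j)) => j' j's; case: eqP => [->//|/eqP nj].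
  by apply: hx; rewrite inE negb_or nj.
apply: h => j'; rewrite inE negb_or => /andP[/negPf nj /hx].
by rewrite nj.
Qed.

Lemma UD_allV V (W : finType) (X : forall k, (V -> St k) -> (W -> St k) -> Prop) :
  (forall k, inhabited (St k)) ->
  UD (V := V + W) (fun k w => X k (fun i => w (inl i)) (fun i => w (inr i))) ->
  UD (fun k v => forall x : W -> St k, X k v x).
Proof.
move=> ne /(@UD_allV_seq V W (enum W) X) H.
have {}H : UD (V := V + W)
    (fun k w => forall x : W -> St k, X k (fun i => w (inl i)) x).
  apply: UD_ext H => k w; split=> h x; last by move=> _.
  by apply: h => j; rewrite mem_enum.
(* The free variables from [W] have become dummies. One quantifier feeds a single value to all of
   them; [w0] provides such a value, and for empty [W] there is nothing to feed. *)
have [[w0]|W0] := pselect (inhabited W); last first.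
  pose f (i : V + W) : V :=
    match i with inl j => j | inr j => False_rect _ (W0 (inhabits j)) end.
  apply: UD_ext (UD_ren f H) => k v; split=> h x; exact: h.
have := @UD_all V (fun k v z => forall x : W -> St k, X k v x).
have E : UD (V := option V) (fun k w => forall x : W -> St k,
    X k (fun i => w (Some i)) x).
  pose f (i : V + W) : option V := match i with inl j => Some j | inr j => None end.
  by apply: UD_ext (UD_ren f H) => k v.
move=> /(_ E); apply: UD_ext => k v; split=> [h x|h _ //].
exact: (h (x w0)).
Qed.

Lemma UD_exV V (W : finType) (X : forall k, (V -> St k) -> (W -> St k) -> Prop) :
  (forall k, inhabited (St k)) ->
  UD (V := V + W) (fun k w => X k (fun i => w (inl i)) (fun i => w (inr i))) ->
  UD (fun k v => exists x : W -> St k, X k v x).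
Proof.
move=> ne HX.
have := UD_not (@UD_allV V W (fun k v x => ~ X k v x) ne (UD_not HX)).
apply: UD_ext => k v; split; last by move=> [x hx] /(_ x).
by move=> h; apply: contrapT => h'; apply: h => x hx; apply: h'; exists x.
Qed.

(** Substitution of terms is expressed by quantifying over a tuple equal to them, in place of a
    substitution operation on formulas. *)
Lemma UD_sub V (W : finType) (X : forall k, (W -> St k) -> Prop)
    (t : forall k, (V -> St k) -> W -> St k) :
  (forall k, inhabited (St k)) ->
  UD X -> (forall i, UT (fun k v => t k v i)) -> UD (fun k v => X k (t k v)).
Proof.
move=> ne HX Ht.
have := @UD_exV V W (fun k v z => (forall i, z i = t k v i) /\ X k z) ne.
have E : UD (V := V + W) (fun k w => (forall i, w (inr i) = t k (fun i => w (inl i)) i)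
    /\ X k (fun i => w (inr i))).
  apply: UD_and; last exact: (UD_ren (fun i => inr i) HX).
  apply: UD_conj => i; apply: UD_eq; first exact: UT_var.
  have [s Hs] := Ht i.
  exists (tren (fun i => match i with inl j => inl (inl j) | inr p => inr p end) s).
  move=> k v; rewrite eval_tren Hs; congr eval.
  by apply: funext => -[].
move=> /(_ E); apply: UD_ext => k v; split.
  by move=> [z [zt]]; have -> : z = t k v by apply: funext.
by move=> h; exists (t k v).
Qed.

End UD.

(** * Finite supports of terms and formulas *)

Lemma dchoice (X : Type) (Y : X -> Type) (P : forall x, Y x -> Prop) :
  (forall x, exists y, P x y) -> exists f : forall x, Y x, forall x, P x (f x).
Proof.
move=> H; exists (fun x => projT1 (cid (H x))) => x.
exact: projT2 (cid (H x)).
Qed.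

Lemma term_support L (V : Type) (t : term L V) :
  exists (W : finType) (f : W -> V) (s : term L W),
  forall (M : structure L) (v : V -> M), eval v t = eval (v \o f) s.
Proof.
elim: t => [x|g a IH].
  by exists unit, (fun=> x), (TVar L tt).
have [W /dchoice[f /dchoice[s H]]] := dchoice IH.
exists {i : 'I_(farity g) & W i}, (fun w => f _ (tagged w)),
  (TApp (fun i => tren (fun w => Tagged W w) (s i))).
move=> M v /=; congr (finterp _); apply: funext => i.
by rewrite eval_tren H.
Qed.

(** Arities are finite, so only finitely many elements of [V] occur even if [V] is infinite. *)
Lemma formula_support L (V : Type) (phi : formula L V) :
  exists (W : finType) (f : W -> V) (psi : formula L W),
  forall (M : structure L) (v : V -> M), sat phi v <-> sat psi (v \o f).
Proof.
elim: phi => {V} [V|V s t|V r a|V p [W [f [p' Hp]]] q [W' [f' [q' Hq]]]|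
    V p [W [f [p' Hp]]]].
- by exists void, (@of_void V), (FFalse L _).
- have [W [f [s' Hs]]] := term_support s.
  have [W' [f' [t' Ht]]] := term_support t.
  exists (W + W')%type, (fun w => match w with inl i => f i | inr j => f' j end),
    (FEq (tren inl s') (tren inr t')).
  by move=> M v /=; rewrite Hs Ht !eval_tren.
- have [W /dchoice[f /dchoice[s H]]] := dchoice (fun i => term_support (a i)).
  exists {i : 'I_(rarity r) & W i}, (fun w => f _ (tagged w)),
    (FRel (fun i => tren (fun w => Tagged W w) (s i))).
  move=> M v /=.
  suff -> : (fun i => eval v (a i)) = (fun i => eval
     (v \o (fun w => f _ (tagged w))) (tren (fun w => Tagged W w) (s i))) by [].
  by apply: funext => i; rewrite eval_tren H.
- exists (W + W')%type, (fun w => match w with inl i => f i | inr j => f' j end),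
    (FImp (fren p' inl) (fren q' inr)).
  by move=> M v /=; rewrite Hp Hq !sat_fren.
(* [v0] is a default value for the indices of the bound variable; if [V] is empty, every occurrence
   is bound. *)
- have [[v0]|V0] := pselect (inhabited V).
    exists W, (fun w => odflt v0 (f w)),
      (FAll (fren p' (fun w => if f w is Some _ then Some w else None))).
    move=> M v /=; have E x : extend v x \o f = extend (v \o (fun w => odflt v0 (f w))) x \o
       (fun w => if f w is Some _ then Some w else None).
      by apply: funext => w /=; case E: (f w) => [i|] //=; rewrite E.
    by split=> h x; have := h x; rewrite sat_fren Hp E.
  exists void, (@of_void V), (FAll (fren p' (fun=> None))).
  move=> M v /=; have E x : extend v x \o f = extend (v \o @of_void V) x \o (fun=> None).
    by apply: funext => w /=; case E: (f w) => [i|] //=; case: V0; exists.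
  by split=> h x; have := h x; rewrite sat_fren Hp E.
Qed.

(** [W] and [psi] are chosen before the structure: parameters become a finite tuple [y] of
    variables, over which one can then quantify. *)
Lemma param_support L (V P : Type) (phi : formula L (V + P)) :
  exists (W : finType) (psi : formula L (V + W)),
  forall (M : structure L) (c : P -> M), inhabited M ->
  exists y : W -> M, forall v, sat phi (join_val v c) <-> sat psi (join_val v y).
Proof.
have [W [f [psi H]]] := formula_support phi.
exists W, (fren psi (fun w => if f w is inl i then inl i else inr w)).
(* [m] is a default value for the indices that come from variables. *)
move=> M c [m]; exists (fun w => if f w is inr p then c p else m) => v.
rewrite sat_fren H; suff -> : join_val v c \o f = (join_val v
    (fun w => if f w is inr p then c p else m) \o
    (fun w => if f w is inl i then inl i else inr w)) by [].
by apply: funext => w /=; case E: (f w) => [i|p] //=; rewrite E.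
Qed.

(** * Ordered groups *)

Notation "x ≺ y" := (slt x y) (at level 70, no associativity).

Definition pdef L (M : structure L) V (X : (V -> M) -> Prop) :=
  UD (K := unit) (St := fun=> M) (P := M) (fun=> id) (fun _ v => X v).

(* What is used of non-valuational structures besides weak o-minimality. This is
   a first-order scheme, whence it passes to elementarily equivalent structures. *)
Record tame L (M : structure (og_lang L)) : Prop := Tame {
  tame_og : is_ordered_group M;
  tame_ex : exists x y : M, x ≺ y;
  tame_dense : forall x y : M, x ≺ y -> exists2 z, x ≺ z & z ≺ y;
  tame_nv : forall C : set M, definable1 C -> (exists x, C x) -> (exists x, ~ C x) ->
    (forall x y, C x -> y ≺ x -> C y) ->
    forall z e, is_zero z -> z ≺ e -> exists x y, [/\ C x, ~ C y & y ≺ sadd x e] }.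
Existing Class tame.

Class total_order (T : Type) (lt : T -> T -> Prop) : Prop := TotalOrder {
  lt_irr : forall x, ~ lt x x;
  lt_tr : forall x y z, lt x y -> lt y z -> lt x z;
  lt_tot : forall x y, [\/ lt x y, x = y | lt y x] }.

Section TotalOrder.
Context {T : Type} {lt : T -> T -> Prop} {O : total_order lt}.

Lemma lt_le_tr x y z : lt x y -> ~ lt z y -> lt x z.
Proof. by move=> xy yz; have [/(lt_tr xy)//|<-//|/yz] := lt_tot y z. Qed.

Lemma le_lt_tr x y z : ~ lt y x -> lt y z -> lt x z.
Proof. by move=> xy yz; have [h|->//|/xy//] := lt_tot x y; apply: lt_tr yz. Qed.

Lemma le_le_tr x y z : ~ lt y x -> ~ lt z y -> ~ lt z x.
Proof. by move=> xy yz zx; apply: xy; apply: le_lt_tr zx. Qed.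

Lemma le_anti x y : ~ lt y x -> ~ lt x y -> x = y.
Proof. by move=> yx xy; have [/xy|//|/yx] := lt_tot x y. Qed.
End TotalOrder.

Ltac nohyp P := lazymatch goal with _ : P |- _ => fail | _ => idtac end.

(* Decides goals of the theory of total orders by saturating the context. *)
Ltac ordstep :=
  match goal with
  | H : ?R ?a ?a |- _ => by case: (@lt_irr _ R _ a H)
  | H : ?R ?a ?b, H' : ~ ?R ?a ?b |- _ => by case: (H' H)
  | H : ?R ?a ?b, H' : ?R ?b ?c |- _ =>
      nohyp (R a c); pose proof (@lt_tr _ R _ a b c H H')
  | H : ?R ?a ?b, H' : ~ ?R ?c ?b |- _ =>
      nohyp (R a c); pose proof (@lt_le_tr _ R _ a b c H H')
  | H : ~ ?R ?b ?a, H' : ?R ?b ?c |- _ =>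
      nohyp (R a c); pose proof (@le_lt_tr _ R _ a b c H H')
  | H : ~ ?R ?b ?a, H' : ~ ?R ?c ?b |- _ =>
      nohyp (~ R c a); pose proof (@le_le_tr _ R _ a b c H H')
  end.

Ltac ordsat := solve [repeat ordstep].

Ltac ord :=
  subst;
  lazymatch goal with
  | |- False => ordsat
  | |- ~ _ => intro; ordsat
  | |- _ = _ => exfalso; ordsat
  | |- _ => apply: contrapT; intro; ordsat
  end.

Existing Class is_ordered_group.

Section Group.
Context {L : language} {M : structure (og_lang L)} {G : is_ordered_group M}.

Global Instance slt_order : total_order (@slt L M).
Proof. by have [? ? ? *] := G; split. Qed.

Definition ozero : M := projT1 (cid (og_zero (G))).
Lemma ozeroP : is_zero ozero. Proof. exact: projT2 (cid (og_zero (G))). Qed.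
Lemma add0 x : sadd ozero x = x. Proof. by case: (ozeroP x). Qed.
Lemma addr0 x : sadd x ozero = x. Proof. by case: (ozeroP x). Qed.
Lemma addA (x y z : M) : sadd x (sadd y z) = sadd (sadd x y) z.
Proof. exact: og_addA (G) x y z. Qed.

Lemma is_zeroE (e : M) : is_zero e -> e = ozero.
Proof. by move=> /(_ ozero)[]; rewrite addr0. Qed.

Lemma addl_lt (z x y : M) : x ≺ y -> sadd z x ≺ sadd z y.
Proof. exact: og_lt_addl (G) x y z. Qed.

Lemma addr_lt (z x y : M) : x ≺ y -> sadd x z ≺ sadd y z.
Proof. exact: og_lt_addr (G) x y z. Qed.

Lemma addl_ltE (z x y : M) : sadd z x ≺ sadd z y <-> x ≺ y.
Proof.
split; last exact: addl_lt.
by move=> h; have [//|e|/(addl_lt z) h'] := lt_tot x y; ord.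
Qed.

Lemma addr_ltE (z x y : M) : sadd x z ≺ sadd y z <-> x ≺ y.
Proof.
split; last exact: addr_lt.
by move=> h; have [//|e|/(addr_lt z) h'] := lt_tot x y; ord.
Qed.

Lemma add_inj (z x y : M) : sadd z x = sadd z y -> x = y.
Proof.
by move=> e; have [/(addl_lt z)|//|/(addl_lt z)] := lt_tot x y; rewrite e => ?; ord.
Qed.

Lemma solve_right (x y : M) : exists z, sadd x z = y.
Proof.
have [x' [/is_zeroE h _]] := og_opp (G) x.
by exists (sadd x' y); rewrite addA h add0.
Qed.

Lemma solve_left (x y : M) : exists z, sadd z x = y.
Proof.
have [x' [_ /is_zeroE h]] := og_opp (G) x.
by exists (sadd y x'); rewrite -addA h addr0.
Qed.

Lemma lt_add (x e : M) : ozero ≺ e <-> x ≺ sadd x e.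
Proof. by rewrite -[X in X ≺ sadd _ _](addr0 x) addl_ltE. Qed.

End Group.

Global Instance tame_group L (M : structure (og_lang L)) (T : tame M) :
  is_ordered_group M := tame_og T.

Section Basic.
Context {L : language} {M : structure (og_lang L)} {T : tame M}.

Lemma exists_pos : exists e : M, ozero ≺ e.
Proof.
have [x [y xy]] := tame_ex T; have [z xz] := solve_right x y.
by exists z; rewrite (lt_add x) xz.
Qed.

Lemma exists_gt (x : M) : exists y, x ≺ y.
Proof. by have [e e0] := exists_pos; exists (sadd x e); rewrite -lt_add. Qed.

Lemma exists_lt (x : M) : exists y, y ≺ x.
Proof.
have [e e0] := exists_pos; have [y <-] := solve_left e x.
by exists y; rewrite -lt_add.
Qed.

Lemma exists_between (x y : M) : x ≺ y -> exists z, x ≺ z /\ z ≺ y.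
Proof. by move=> /(tame_dense T)[z]; exists z. Qed.

Lemma finite_upper (I : finType) (f : I -> M) (C : M -> Prop) :
  (forall x y, C x -> y ≺ x -> C y) -> (exists x, C x) -> (forall i, C (f i)) ->
  exists2 y, C y & forall i, ~ y ≺ f i.
Proof.
move=> Cd [x0 Cx0] Cf.
suff [y Cy h] : exists2 y, C y & forall i, i \in enum I -> ~ y ≺ f i.
  by exists y => // i; apply: h; rewrite mem_enum.
elim: (enum I) => [|i s [y Cy h]]; first by exists x0.
have [yi|yi] := pselect (y ≺ f i).
  exists (f i) => // j; rewrite inE => /orP[/eqP->|/h]; last by move=> ?; ord.
  exact: lt_irr.
by exists y => // j; rewrite inE => /orP[/eqP->|/h].
Qed.

Lemma finite_lower (I : finType) (f : I -> M) (C : M -> Prop) :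
  (forall x y, C x -> x ≺ y -> C y) -> (exists x, C x) -> (forall i, C (f i)) ->
  exists2 y, C y & forall i, ~ f i ≺ y.
Proof.
move=> Cd [x0 Cx0] Cf.
suff [y Cy h] : exists2 y, C y & forall i, i \in enum I -> ~ f i ≺ y.
  by exists y => // i; apply: h; rewrite mem_enum.
elim: (enum I) => [|i s [y Cy h]]; first by exists x0.
have [yi|yi] := pselect (f i ≺ y).
  exists (f i) => // j; rewrite inE => /orP[/eqP->|/h]; last by move=> ?; ord.
  exact: lt_irr.
by exists y => // j; rewrite inE => /orP[/eqP->|/h].
Qed.

Lemma exists_min (x y : M) : exists z, [/\ ~ x ≺ z, ~ y ≺ z & z = x \/ z = y].
Proof.
have [xy|xy] := pselect (x ≺ y); [exists x|exists y]; split; try by [left|right].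
all: try exact: lt_irr.
- by ord.
- by [].
Qed.

Lemma exists_max (x y : M) : exists z, [/\ ~ z ≺ x, ~ z ≺ y & z = x \/ z = y].
Proof.
have [xy|xy] := pselect (x ≺ y); [exists y|exists x]; split; try by [left|right].
all: try exact: lt_irr.
- by ord.
- by [].
Qed.
End Basic.

(** * Definable cuts *)

Section OrderTopology.
Context {T : Type} {lt : T -> T -> Prop} {O : total_order lt}.
Hypotheses (no_min : forall x, exists y, lt y x) (no_max : forall x, exists y, lt x y).

Definition itv_filter (x : T) : set_system T :=
  [set A | exists a b, [/\ lt a x, lt x b & forall y, lt a y -> lt y b -> A y]].

Lemma itv_filter_filter x : Filter (itv_filter x).
Proof.
split.
- by have [a ax] := no_min x; have [b xb] := no_max x; exists a, b.
- move=> A B [a [b [ax xb AB]]] [a' [b' [ax' xb' AB']]].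
  have [a1 [a1x h1 h2]] : exists a1, [/\ lt a1 x, ~ lt a1 a & ~ lt a1 a'].
    have [h|h] := pselect (lt a a'); [exists a'|exists a]; split=> //; ord.
  have [b1 [b1x h3 h4]] : exists b1, [/\ lt x b1, ~ lt b b1 & ~ lt b' b1].
    have [h|h] := pselect (lt b b'); [exists b|exists b']; split=> //; ord.
  exists a1, b1; split=> // y ay yb; split; [apply: AB|apply: AB']; ord.
- by move=> A B AB [a [b [? ? h]]]; exists a, b; split=> // y ? ?; apply/AB/h.
Qed.

(** A finite intersection of rays around [x] contains an interval around [x], the missing end of a
    ray being supplied by [no_min] or [no_max]. *)
Lemma nbhs_otop (x : otop lt) (A : set (otop lt)) : nbhs x A <-> itv_filter x A.
Proof.
split.
  rewrite nbhsE => -[B [[D sD <-] [C DC Cx]] sBA].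
  have := @itv_filter_filter x => FF.
  apply: (@filterS _ _ FF C).
    by move=> y Cy; apply: sBA; exists C.
  have [E sE IEC] := sD _ DC; rewrite -IEC; apply: filter_bigI => i iE.
  have : i x by move: Cx; rewrite -IEC; apply.
  have := sE _ iE; rewrite inE => -[a [->|->]] /= h.
    by have [a' a'x] := no_min x; exists a', a; split.
  by have [a' xa'] := no_max x; exists a, a'; split.
move=> [a [b [ax xb h]]].
have ray U : open_rays lt U -> open (U : set (otop lt)).
  move=> rU; exists [set U]; last first.
    by rewrite predeqE => ?; split=> [[_ ->]|] //; exists U.
  move=> _ ->; exists [fset U]%fset.
    by move=> ?; rewrite inE inE => /eqP->.
  by rewrite predeqE=> ?; split=> [|??]; [apply|]; rewrite /= inE // =>/eqP->.
have : nbhs x ([set y : otop lt | lt y b] `&` [set y | lt a y]).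
  by apply: filterI; apply: open_nbhs_nbhs; split=> //; apply: ray;
    [exists b; left|exists a; right].
by apply: filterS => y [? ?]; apply: h.
Qed.

Hypothesis dense : forall x y, lt x y -> exists2 z, lt x z & lt z y.

Lemma open_otop_down (C : set (otop lt)) : (forall x y, C x -> lt y x -> C y) ->
  open C <-> (forall x, C x -> exists2 y, C y & lt x y).
Proof.
move=> Cd; split=> [|h].
  move=> oC x Cx; have : nbhs (x : otop lt) C by apply: open_nbhs_nbhs.
  move=> /nbhs_otop [a [b [ax xb h]]]; have [z xz zb] := dense xb.
  by exists z => //; apply: h => //; ord.
rewrite openE => x Cx; rewrite /interior; apply/nbhs_otop.
have [a ax] := no_min x; have [y Cy xy] := h _ Cx.
by exists a, y; split=> // z _ zy; apply: Cd zy.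
Qed.
End OrderTopology.

Definition vbox L (M : structure (og_lang L)) V (a b x : V -> M) :=
  forall i, a i ≺ x i /\ x i ≺ b i.

Section Completion.
Context {L : language} {M : structure (og_lang L)} {T : tame M}.
Notation cM := (completion M).
Notation "c ≪ d" := (cut_lt c d) (at level 70, no associativity).

Lemma open_cutE (C : set M) : (forall x y, C x -> y ≺ x -> C y) ->
  open (C : set (otop (@slt L M))) <-> (forall x, C x -> exists2 y, C y & x ≺ y).
Proof. exact: open_otop_down exists_lt exists_gt (tame_dense T) _. Qed.

Lemma definable1E (X : set M) : definable1 X <-> pdef (fun v : unit -> M => X (v tt)).
Proof.
split=> [[phi H]|[phi H]].
  pose f (i : 'I_1 + M) : unit + M := match i with inl _ => inl tt | inr p => inr p end.
  exists (fren phi f) => _ v; rewrite sat_fren.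
  have := f_equal (fun Y : set ('I_1 -> M) => Y (fun=> v tt)) H.
  rewrite /= /solutions /= => ->.
  suff -> : join_val v id \o f = join_val (fun=> v tt) id by [].
  by apply: funext => -[].
pose f (i : unit + M) : 'I_1 + M := match i with inl _ => inl ord0 | inr p => inr p end.
have E (v : 'I_1 -> M) : join_val v id \o f = join_val (fun=> v ord0) id.
  by apply: funext => -[].
exists (fren phi f); apply/seteqP; split=> v /=; rewrite /solutions /= sat_fren E;
  by rewrite -(H tt (fun=> v ord0)).
Qed.

Lemma cutP (c : cM) : [/\ definable1 (proj1_sig c),
  forall x, proj1_sig c x -> exists2 y, proj1_sig c y & x ≺ y,
  exists x, proj1_sig c x, exists b, forall x, proj1_sig c x -> x ≺ b
  & forall x y, proj1_sig c x -> y ≺ x -> proj1_sig c y].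
Proof.
case: c => C [] /= dC oC [x Cx] [b hb] Cd.
have h : forall x, C x -> exists2 y, C y & x ≺ y by apply/open_cutE.
split=> //; first by exists x.
exists b => z /h[y /hb[yb zy|->]] //; ord.
Qed.

Lemma cut_eq (c d : cM) : (forall x, proj1_sig c x <-> proj1_sig d x) -> c = d.
Proof.
case: c d => C hC [D hD] /= h; have e : C = D by apply/seteqP; split=> x /h.
by rewrite -e in hD *; congr exist; apply: Prop_irrelevance.
Qed.

Global Instance cut_order : total_order (@cut_lt L M).
Proof.
split.
- by move=> c [_]; apply.
- move=> c d e [cd dc] [de ed]; split; first exact: subset_trans de.
  by move=> ec; apply: dc; apply: subset_trans ec.
- move=> c d; have [_ _ _ _ cd] := cutP c; have [_ _ _ _ dd] := cutP d.
  have [h|h] := pselect (proj1_sig c `<=` proj1_sig d).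
    have [h'|h'] := pselect (proj1_sig d `<=` proj1_sig c); last by constructor 1.
    by constructor 2; apply: cut_eq => x; split=> [/h|/h'].
  constructor 3; have [x cx dx] : exists2 x, proj1_sig c x & ~ proj1_sig d x.
    by apply: contrapT => h'; apply: h => x cx; apply: contrapT => dx; apply: h'; exists x.
  split=> // y dy; have [yx|->//|xy] := lt_tot y x; first exact: cd yx.
  by case: dx; apply: dd xy.
Qed.

Lemma is_cut_ray (a : M) : is_definable_cut [set y | y ≺ a].
Proof.
split.
- exists (FRel (L := og_lang L) (r := OgLt L)
    (pair2 (TVar (og_lang L) (inl ord0)) (TVar (og_lang L) (inr a)))).
  apply/seteqP; split=> v /=; rewrite /solutions /= /slt.
    by congr rinterp; apply: funext => -[[|[|[]]]].
  by congr rinterp; apply: funext => -[[|[|[]]]].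
- apply/open_cutE => [x y /= xa yx|x /= /(tame_dense T)[y xy ya]]; first by ord.
  by exists y.
- by have [x xa] := exists_lt a; exists x.
- by exists a => x; left.
- by move=> x y /= ? ?; ord.
Qed.

Definition pt (a : M) : cM := exist _ _ (is_cut_ray a).

Lemma pt_ltE (a : M) (c : cM) : pt a ≪ c <-> proj1_sig c a.
Proof.
have [_ cO _ _ cd] := cutP c; split.
  move=> [_ h]; have [y cy ya] : exists2 y, proj1_sig c y & ~ y ≺ a.
    by apply: contrapT => h'; apply: h => y cy /=; apply: contrapT => ya; apply: h'; exists y.
  by have [//|<-//|ay] := lt_tot y a; apply: cd ay.
move=> ca; have [y cy ay] := cO _ ca; split=> [x /=|/(_ _ cy) /= ?]; last by ord.
exact: cd.
Qed.

Lemma pt_lt (a b : M) : pt a ≪ pt b <-> a ≺ b.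
Proof. exact: pt_ltE. Qed.

Lemma pt_inj : injective pt.
Proof.
move=> a b e; have [/pt_lt h|//|/pt_lt h] := lt_tot a b; move: h; rewrite e => ?; ord.
Qed.

Lemma cut_dense (c d : cM) : c ≪ d -> exists a, c ≪ pt a /\ pt a ≪ d.
Proof.
have [_ dO _ _ _] := cutP d; have [_ _ _ _ cd] := cutP c.
move=> [_ h]; have [x dx cx] : exists2 x, proj1_sig d x & ~ proj1_sig c x.
  by apply: contrapT => h'; apply: h => y cy /=; apply: contrapT => ya; apply: h'; exists y.
have [y dy xy] := dO _ dx; exists y; split; last exact/pt_ltE.
have : ~ pt x ≪ c by move/pt_ltE.
have : pt x ≪ pt y by rewrite pt_lt.
by move=> *; ord.
Qed.

Lemma cut_lower (c : cM) : exists a, pt a ≪ c.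
Proof. by have [_ _ [x cx] _ _] := cutP c; exists x; rewrite pt_ltE. Qed.

Lemma cut_upper (c : cM) : exists a, c ≪ pt a.
Proof.
have [_ _ _ [b hb] _] := cutP c; have [b' bb'] := exists_gt b; exists b'.
have : ~ pt b ≪ c by rewrite pt_ltE => /hb; apply: lt_irr.
by have : pt b ≪ pt b' by [apply/pt_lt]; move=> *; ord.
Qed.

(** [tame_nv] gives points on both sides of the cut at distance less than [e]. The upper one may be
    the cut itself, so it is moved up slightly by density. *)
Lemma cut_small (c : cM) (e : M) : ozero ≺ e ->
  exists x y, [/\ pt x ≪ c, c ≪ pt y & y ≺ sadd x e].
Proof.
move=> e0; have [dc _ ex [b hb] cd] := cutP c.
have nb : exists x, ~ sval c x by exists b => /hb; apply: lt_irr.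
have [x [y [cx cy yx]]] := tame_nv T dc ex nb cd ozeroP e0.
have [z [yz zx]] := exists_between yx; exists x, z; split; [exact/pt_ltE| |by []].
have : ~ pt y ≪ c by move/pt_ltE.
by have : pt y ≪ pt z by [apply/pt_lt]; move=> *; ord.
Qed.

(** Bounded definable sets acquire suprema in the completion. The downward closure is strict, so it
    has no maximum and is open. *)
Lemma cut_sup (D : set M) : pdef (fun v : unit -> M => D (v tt)) ->
  (exists x, D x) -> (exists b, forall x, D x -> x ≺ b) ->
  exists s : cM, forall x, pt x ≪ s <-> exists2 y, D y & x ≺ y.
Proof.
move=> dD [x0 Dx0] [b hb].
suff h : is_definable_cut [set x | exists y, D y /\ x ≺ y].
  exists (exist _ _ h) => x; rewrite pt_ltE /=.
  by split=> [[y [? ?]]|[y ? ?]]; exists y.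
split.
- apply/definable1E; apply: UD_ex; apply: UD_and.
    exact: (@UD_ren _ _ _ _ _ _ _ (fun=> None) _ dD).
  have := @UD_rel _ _ (fun _ : unit => M) _ (fun=> id) (option unit) (OgLt L)
    (fun _ i w => pair2 (w (Some tt)) (w None) i).
  by apply => i; rewrite /pair2; case: (val i == 0); apply: UT_var.
- apply/open_cutE => [x y /= [z [Dz xz]] yx|x [z [Dz xz]]]; first by exists z; split=> //; ord.
  by have [y xy yz] := tame_dense T xz; exists y => //; exists z.
- by have [x xx0] := exists_lt x0; exists x, x0.
- by exists b => x [y [/hb ? ?]]; left; ord.
- by move=> x y [z [Dz xz]] yx; exists z; split=> //; ord.
Qed.

End Completion.

Notation "c ≪ d" := (cut_lt c d) (at level 70, no associativity).

Lemma tame_inh L (M : structure (og_lang L)) {T : tame M} : inhabited M.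
Proof. exact: (inhabits ozero). Qed.

(** * Compactness of boxes *)

Section UDog.
Context {L : language} {K : Type} {St : K -> structure (og_lang L)} {P : Type}.
Context {c : forall k, P -> St k} {T : forall k, tame (St k)}.
Notation UD := (UD c).
Notation UT := (UT c).

Lemma UD_lt V t1 t2 : UT (V := V) t1 -> UT t2 ->
  UD (fun k v => t1 k v ≺ t2 k v).
Proof.
move=> h1 h2.
apply: (@UD_rel _ _ St _ c V (OgLt L) (fun k i v => pair2 (t1 k v) (t2 k v) i)).
by move=> i; rewrite /pair2; case: (val i == 0).
Qed.

Lemma UT_add V t1 t2 : UT (V := V) t1 -> UT t2 ->
  UT (fun k v => sadd (t1 k v) (t2 k v)).
Proof.
move=> h1 h2.
apply: (@UT_app _ _ St _ c V (OgAdd L) (fun k i v => pair2 (t1 k v) (t2 k v) i)).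
by move=> i; rewrite /pair2; case: (val i == 0).
Qed.

(** [ozero] is not a term; positivity of [t] is written as [t ≺ sadd t t]. *)
Lemma UD_pos V t : UT (V := V) t -> UD (fun k v => ozero ≺ t k v).
Proof.
move=> h; apply: UD_ext (UD_lt h (UT_add h h)) => k v.
by rewrite (lt_add (t k v)).
Qed.

Lemma UD_sub2 V (W1 W2 : finType)
  (X : forall k, (W1 -> St k) -> (W2 -> St k) -> Prop) t1 t2 :
  UD (V := W1 + W2) (fun k w => X k (fun i => w (inl i)) (fun i => w (inr i))) ->
  (forall i, UT (fun k v => t1 k v i)) -> (forall i, UT (fun k v => t2 k v i)) ->
  UD (V := V) (fun k v => X k (t1 k v) (t2 k v)).
Proof.
move=> HX h1 h2.
apply: (@UD_sub _ _ St _ c V (W1 + W2)%type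
  (fun k w => X k (fun i => w (inl i)) (fun i => w (inr i)))
  (fun k v i => match i with inl j => t1 k v j | inr j => t2 k v j end)) => //.
  by move=> k; apply: tame_inh.
by case.
Qed.

Lemma UD_subo V (W : finType) (X : forall k, (W -> St k) -> St k -> Prop) t1 t2 :
  UD (V := option W) (fun k w => X k (fun i => w (Some i)) (w None)) ->
  (forall i, UT (fun k v => t1 k v i)) -> UT t2 ->
  UD (V := V) (fun k v => X k (t1 k v) (t2 k v)).
Proof.
move=> HX h1 h2.
apply: (@UD_sub _ _ St _ c V (option W)
  (fun k w => X k (fun i => w (Some i)) (w None))
  (fun k v i => match i with Some j => t1 k v j | None => t2 k v end)) => //.
  by move=> k; apply: tame_inh.
by case.
Qed.

Lemma UD_sub3 V (W1 W2 W3 : finType)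
  (X : forall k, (W1 -> St k) -> (W2 -> St k) -> (W3 -> St k) -> Prop) t1 t2 t3 :
  UD (V := W1 + (W2 + W3)) (fun k w => X k (fun i => w (inl i))
     (fun i => w (inr (inl i))) (fun i => w (inr (inr i)))) ->
  (forall i, UT (fun k v => t1 k v i)) -> (forall i, UT (fun k v => t2 k v i)) ->
  (forall i, UT (fun k v => t3 k v i)) ->
  UD (V := V) (fun k v => X k (t1 k v) (t2 k v) (t3 k v)).
Proof.
move=> HX h1 h2 h3.
apply: (@UD_sub _ _ St _ c V (W1 + (W2 + W3))%type
  (fun k w => X k (fun i => w (inl i)) (fun i => w (inr (inl i))) (fun i => w (inr (inr i))))
  (fun k v i => match i with inl j => t1 k v j | inr (inl j) => t2 k v j
     | inr (inr j) => t3 k v j end)) => //.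
  by move=> k; apply: tame_inh.
by move=> [|[]].
Qed.

Lemma UD_pdef V (X : forall k, (V -> St k) -> Prop) k : UD X -> pdef (X k).
Proof.
move=> [phi H].
pose f (i : V + P) : V + St k := match i with inl j => inl j | inr p => inr (c k p) end.
exists (fren phi f) => _ v; rewrite sat_fren H.
suff -> : join_val v id \o f = join_val v (c k) by [].
by apply: funext => -[].
Qed.
End UDog.

Lemma UT_paramM L (M : structure L) V (a : M) :
  UT (K := unit) (St := fun=> M) (P := M) (fun=> id) (V := V) (fun _ v => a).
Proof. by exists (TVar L (inr a)). Qed.

(** Syntax-directed proofs of uniform definability. [udef] leaves the atomic predicates it does not
    know; [udef_hook] is where further ones are added. *)
Ltac udef_hook := fail.
Ltac udef_step :=
  match goal with
  | |- _ => udef_hook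
  | |- UD _ (fun k v => ?Q) => apply: UD_const
  | |- UD _ (fun k v => _ /\ _) => apply: UD_and
  | |- UD _ (fun k v => _ \/ _) => apply: UD_or
  | |- UD _ (fun k v => _ <-> _) => apply: UD_iff
  | |- UD _ (fun k v => ~ _) => apply: UD_not
  | |- UD _ (fun k v => ozero ≺ _) => apply: UD_pos
  | |- UD _ (fun k v => _ ≺ _) => apply: UD_lt
  | |- UD _ (fun k v => _ = _) => apply: UD_eq
  | |- UD _ (fun k v => exists x, _) => first
      [ apply: UD_ex
      | apply: UD_exV; first by move=> ?; apply: tame_inh
      | apply: UD_disj; intro ]
  | |- UD _ (fun k v => _ -> _) => apply: UD_imp
  | |- UD _ (fun k v => forall x, _) => first
      [ apply: UD_all
      | apply: UD_allV; first by move=> ?; apply: tame_inh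
      | apply: UD_conj; intro ]
  | |- UT _ _ => first [ apply: UT_var | apply: UT_add | apply: UT_paramM ]
  end.
Ltac udef := repeat (cbv beta; udef_step).

Definition inbox L (M : structure (og_lang L)) {T : tame M} V (u v : V -> M)
  (x : V -> completion M) := forall i, pt (u i) ≪ x i /\ x i ≪ pt (v i).

(** The outer box [p], [q] comes first, and common end points are allowed. *)
Definition bsub L (M : structure (og_lang L)) V (p q u v : V -> M) :=
  forall i, ~ u i ≺ p i /\ ~ q i ≺ v i.

(** [e] is a Lebesgue number. It replaces a finite subcover, whose size is not bounded in
    advance. *)
Definition lebesgue L (M : structure (og_lang L)) {T : tame M} V
    (G : (V -> M) -> (V -> M) -> Prop) (p q : V -> M) :=
  exists e, ozero ≺ e /\ forall u v, bsub p q u v ->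
    (forall i, v i ≺ sadd (u i) e) -> G u v.

Section UDbox.
Context {L : language} {K : Type} {St : K -> structure (og_lang L)} {P : Type}.
Context {c : forall k, P -> St k} {T : forall k, tame (St k)}.

Lemma UD_bsub V (W : finType) p q u v :
  (forall i : W, UT c (V := V) (fun k w => p k w i)) ->
  (forall i : W, UT c (V := V) (fun k w => q k w i)) ->
  (forall i : W, UT c (V := V) (fun k w => u k w i)) ->
  (forall i : W, UT c (V := V) (fun k w => v k w i)) ->
  UD c (fun k w => bsub (p k w) (q k w) (u k w) (v k w)).
Proof. by move=> hp hq hu hv; apply: UD_conj => i; udef. Qed.

Ltac udef_hook ::= refine (UD_bsub _ _ _ _); intro.

Lemma UD_lebesgue (W V : finType)
    (G : forall k, (W -> St k) -> (V -> St k) -> (V -> St k) -> Prop) :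
  UD c (V := W + (V + V)) (fun k w => G k (fun i => w (inl i))
     (fun i => w (inr (inl i))) (fun i => w (inr (inr i)))) ->
  UD c (V := W + (V + V)) (fun k w => lebesgue (G k (fun i => w (inl i)))
     (fun i => w (inr (inl i))) (fun i => w (inr (inr i)))).
Proof.
move=> dG; rewrite /lebesgue; udef.
by apply: (UD_sub3 (X := G) dG) => i; udef.
Qed.
End UDbox.

Ltac udef_hook ::= refine (UD_bsub _ _ _ _); intro.

Section Compactness.
Context {L : language} {M : structure (og_lang L)} {T : tame M}.
Notation cM := (completion M).
Notation pUD := (UD (K := unit) (St := fun=> M) (P := M) (fun=> id)).
Notation pUT := (UT (K := unit) (St := fun=> M) (P := M) (fun=> id)).

Lemma UD_cut_r V (x : cM) t : pUT (V := V) t ->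
  pUD (fun k (v : V -> M) => pt (t k v) ≪ x).
Proof.
move=> ht; have [dx _ _ _ _] := cutP x; move/definable1E: dx => dx.
have := @UD_sub _ _ (fun _ : unit => M) _ (fun=> id) V unit
  (fun _ w => proj1_sig x (w tt)) (fun k v _ => t k v) (fun=> tame_inh (T := T)) dx (fun=> ht).
by apply: UD_ext => k v; rewrite pt_ltE.
Qed.

Lemma lt_cutE (x : cM) a : x ≪ pt a <-> exists b, b ≺ a /\ ~ pt b ≪ x.
Proof.
split=> [/cut_dense[b [xb /pt_lt ba]]|[b [/pt_lt ba bx]]]; last by ord.
by exists b; split=> //; ord.
Qed.

Lemma UD_cut_l V (x : cM) t : pUT (V := V) t ->
  pUD (fun k (v : V -> M) => x ≪ pt (t k v)).
Proof.
move=> ht.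
have : pUD (V := unit)
    (fun k (w : unit -> M) => exists b, b ≺ w tt /\ ~ pt b ≪ x).
  by udef; apply: UD_cut_r; udef.
move=> h; have := @UD_sub _ _ (fun _ : unit => M) _ (fun=> id) V unit _
  (fun k v _ => t k v) (fun=> tame_inh (T := T)) h (fun=> ht).
by apply: UD_ext => k v; rewrite lt_cutE.
Qed.

Lemma small_box (V : finType) (x : V -> cM) p q e : inbox p q x -> ozero ≺ e ->
  exists u v, [/\ inbox u v x, bsub p q u v & forall i, v i ≺ sadd (u i) e].
Proof.
move=> xpq e0.
have /choice[f hf] : forall i, exists w : M * M,
    [/\ pt w.1 ≪ x i, x i ≪ pt w.2, ~ w.1 ≺ p i, ~ q i ≺ w.2 & w.2 ≺ sadd w.1 e].
  move=> i; have [pi qi] := xpq i.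
  have [u [v [ux xv uv]]] := cut_small (x i) e0.
  have [u' [uu' pu' eu]] := exists_max u (p i).
  have [v' [vv' qv' ev]] := exists_min v (q i).
  exists (u', v'); split=> //=; first by case: eu => ->.
    by case: ev => ->.
  have h : ~ sadd u' e ≺ sadd u e by rewrite addr_ltE.
  by ord.
by exists (fun i => (f i).1), (fun i => (f i).2); split=> i; have [] := hf i.
Qed.

(** Heine-Borel argument, by induction on the coordinates in [s]. In direction [j], the set [D] of
    the points up to which the segment from [u j] admits a Lebesgue number is definable, hence has a
    supremum in the completion; the box that the induction hypothesis gives around this supremum
    extends [D] beyond it. *)
Lemma compactness (V : finType) (G : (V -> M) -> (V -> M) -> Prop) u v :
  pdef (V := V + V) (fun w => G (fun i => w (inl i)) (fun i => w (inr i))) ->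
  (forall p q p' q', bsub p q p' q' -> G p q -> G p' q') ->
  forall (s : seq V) (x : V -> cM), (forall j, j \in s -> ~ v j ≺ u j) ->
  (forall y, (forall j, j \in s -> ~ y j ≪ pt (u j) /\ ~ pt (v j) ≪ y j) ->
     (forall j, j \notin s -> y j = x j) -> exists p q, inbox p q y /\ G p q) ->
  exists p q, [/\ forall j, j \in s -> p j ≺ u j /\ v j ≺ q j,
    forall j, j \notin s -> pt (p j) ≪ x j /\ x j ≪ pt (q j) & lebesgue G p q].
Proof.
move=> dG mono; elim=> [|j s IH] x uv cov.
  have [||p [q [xpq Gpq]]] := cov x; [by []|by []|exists p, q; split=> //].
  have [e e0] := exists_pos (M := M); exists e; split=> // u' v' h _.
  exact: mono Gpq.
have [js|js] := boolP (j \in s).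
  have E i : (i \in j :: s) = (i \in s) by rewrite inE; case: eqP => // ->.
  have [||p [q [h1 h2 h3]]] := IH x.
  - by move=> i; rewrite -E; apply: uv.
  - by move=> y h1 h2; apply: cov => i; rewrite E; [apply: h1|apply: h2].
  by exists p, q; split=> // i; rewrite E; [apply: h1|apply: h2].
pose (D := fun y : M => exists p q, [/\ forall i, (i \in s -> p i ≺ u i /\ v i ≺ q i) /\
    (i \notin s -> i != j -> pt (p i) ≪ x i /\ x i ≪ pt (q i)),
   p j ≺ u j, y ≺ q j & lebesgue G p q]).
have dD : pdef (fun w : unit -> M => D (w tt)).
  have : pdef (fun w : unit -> M => exists p q, (forall i, (i \in s -> p i ≺ u i /\ v i ≺ q i) /\
    (i \notin s -> i != j -> pt (p i) ≪ x i /\ x i ≪ pt (q i))) /\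
   p j ≺ u j /\ w tt ≺ q j /\ lebesgue G p q).
    rewrite /pdef; udef.
    - by apply: UD_cut_r; udef.
    - by apply: UD_cut_l; udef.
    - rewrite /lebesgue; udef.
      by refine (UD_sub2 (X := fun _ => G) dG _ _) => l; udef.
  apply: UD_ext => k w; split=> [[p [q [? [? [? ?]]]]]|[p [q [? ? ? ?]]]]; by exists p, q.
have uvj := uv j (mem_head _ _).
(* The induction hypothesis, with coordinate [j] frozen at a point [z] of the completion. *)
have loc z : ~ z ≪ pt (u j) -> ~ pt (v j) ≪ z -> exists p q,
   [/\ forall i, (i \in s -> p i ≺ u i /\ v i ≺ q i) /\
    (i \notin s -> i != j -> pt (p i) ≪ x i /\ x i ≪ pt (q i)),
    pt (p j) ≪ z, z ≪ pt (q j) & lebesgue G p q].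
  move=> uz zv.
  have [||p [q [h1 h2 h3]]] := IH (fun i => if i == j then z else x i).
  - by move=> i i_s; apply: uv; rewrite inE i_s orbT.
  - move=> y h1 h2; apply: cov => i; rewrite inE.
      move=> /orP[/eqP->|/h1//]; by rewrite h2 // eqxx.
    by rewrite negb_or => /andP[/negPf ij /h2]; rewrite ij.
  exists p, q; split=> //; first by move=> i; split=> [/h1//|/h2 h ij]; move: h; rewrite (negPf ij).
    by have [] := h2 j js; rewrite eqxx.
  by have [] := h2 j js; rewrite eqxx.
have Du : D (u j).
  have [||p [q [h1 h2 h3 h4]]] := loc (pt (u j)); first exact: lt_irr.
    by move/pt_lt.
  by exists p, q; split=> //; apply/pt_lt.
have [[p [q [h1 h2 h3 h4]]]|nD] := pselect (D (v j)).
  exists p, q; split=> // i; rewrite inE.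
    by move=> /orP[/eqP->|/(proj1 (h1 i))].
  by rewrite negb_or => /andP[ij i_s]; apply: (proj2 (h1 i)).
exfalso.
have Dlt y : D y -> ~ v j ≺ y.
  move=> [p [q [h1 h2 h3 h4]]] vy; apply: nD; exists p, q; split=> //; ord.
have [b vb] := exists_gt (v j).
have [||sp hsp] := @cut_sup _ _ T D dD.
- by exists (u j).
- by exists b => y /Dlt ?; ord.
have le1 : ~ sp ≪ pt (u j).
  move=> /cut_dense[a [spa /pt_lt au]].
  have : pt a ≪ sp by apply/hsp; exists (u j).
  by move=> ?; ord.
have le2 : ~ pt (v j) ≪ sp by move=> /hsp[y /Dlt ? ?]; ord.
have [p2 [q2 [k1 k2 k3 [e2 [e20 k4]]]]] := loc _ le1 le2.
move/hsp: k2 => [y [p1 [q1 [h1 h2 h3 [e1 [e10 h4]]]]] p2y].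
(* The box reaching up to [q1 j] and the one around the supremum overlap in direction [j]. The
   length [e3] of the overlap, together with [e1] and [e2], bounds the new Lebesgue number. *)
have pq : p2 j ≺ q1 j by ord.
have [e3 he3] := solve_right (p2 j) (q1 j).
have e30 : ozero ≺ e3 by rewrite (lt_add (p2 j)) he3.
have [e12 [le_1 le_2 e12E]] := exists_min e1 e2.
have [e [le_12 le_3 eE]] := exists_min e12 e3.
have e0 : ozero ≺ e by case: eE => ->//; case: e12E => ->.
have /choice[p hp] : forall i, exists a, [/\ i != j -> ~ a ≺ p1 i /\ ~ a ≺ p2 i,
    i != j -> a = p1 i \/ a = p2 i & i = j -> a = p1 i].
  move=> i; have [->|ij] := eqVneq i j; first by exists (p1 j); split.
  by have [a []] := exists_max (p1 i) (p2 i); exists a; split=> // ii; rewrite ii eqxx in ij.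
have /choice[q hq] : forall i, exists a, [/\ i != j -> ~ q1 i ≺ a /\ ~ q2 i ≺ a,
    i != j -> a = q1 i \/ a = q2 i & i = j -> a = q2 i].
  move=> i; have [->|ij] := eqVneq i j; first by exists (q2 j); split.
  by have [a []] := exists_min (q1 i) (q2 i); exists a; split=> // ii; rewrite ii eqxx in ij.
have Dq y' : y' ≺ q2 j -> D y'.
  move=> y'q; exists p, q; split.
  - move=> i; have [[s1 n1] [s2 n2]] := (h1 i, k1 i).
    have [_ pE _] := hp i; have [_ qE _] := hq i; split=> [i_s|i_s ij].
      have ij : i != j by apply: contraNneq js => <-.
      have [[? ?] [? ?]] := (s1 i_s, s2 i_s).
      by case: (pE ij) => ->; case: (qE ij) => ->.
    have [[? ?] [? ?]] := (n1 i_s ij, n2 i_s ij).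
    by case: (pE ij) => ->; case: (qE ij) => ->.
  - by have [_ _ ->] := hp j.
  - by have [_ _ ->] := hq j.
  exists e; split=> // a b' sab small.
  have lt3 i : b' i ≺ sadd (a i) e1 /\ b' i ≺ sadd (a i) e2 /\ b' i ≺ sadd (a i) e3.
    have := small i => ?.
    have ? : ~ sadd (a i) e1 ≺ sadd (a i) e12 by rewrite addl_ltE.
    have ? : ~ sadd (a i) e2 ≺ sadd (a i) e12 by rewrite addl_ltE.
    have ? : ~ sadd (a i) e12 ≺ sadd (a i) e by rewrite addl_ltE.
    have ? : ~ sadd (a i) e3 ≺ sadd (a i) e by rewrite addl_ltE.
    by split; [ord|split; ord].
  (* A box shorter than the overlap that sticks out above [q1 j] starts no lower than [p2 j], so it
     lies in the second box; otherwise it lies in the first. *)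
  have [bq|bq] := pselect (q1 j ≺ b' j).
    apply: k4 => i; last by have [_ []] := lt3 i.
    have [ha hb] := sab i; have [pi _ pi'] := hp i; have [qi _ qi'] := hq i.
    have [ij|ij] := eqVneq i j; last first.
      have [[? ?] [? ?]] := (pi ij, qi ij); split; ord.
    subst i; rewrite (qi' erefl) in hb *; split=> // hn.
    have : sadd (a j) e3 ≺ q1 j by rewrite -he3 addr_ltE.
    have [_ [_ ?]] := lt3 j.
    by move=> ?; ord.
  apply: h4 => i; last by have [] := lt3 i.
  have [ha hb] := sab i; have [pi _ pi'] := hp i; have [qi _ qi'] := hq i.
  have [ij|ij] := eqVneq i j; last first.
    have [[? ?] [? ?]] := (pi ij, qi ij); split; ord.
  by subst i; rewrite (pi' erefl) in ha *; split.
have [y1 [spy1 /pt_lt y1q]] := cut_dense k3.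
have [y2 [spy2 /pt_lt y2y1]] := cut_dense spy1.
have : pt y2 ≪ sp by apply/hsp; exists y1 => //; apply: Dq.
by move=> ?; ord.
Qed.
End Compactness.

(** * Coded closed sets *)

Definition avoid L (M : structure (og_lang L)) {T : tame M} V
    (F : (V -> completion M) -> Prop) (u v : V -> M) :=
  forall x, inbox u v x -> ~ F x.

(** The box is closed here and open in [avoid], so the two are not negations of each other. *)
Definition hit L (M : structure (og_lang L)) {T : tame M} V
    (F : (V -> completion M) -> Prop) (u v : V -> M) :=
  exists2 x, F x & forall i, ~ x i ≪ pt (u i) /\ ~ pt (v i) ≪ x i.

Section Single.
Context {L : language} {M : structure (og_lang L)} {T : tame M}.
Notation cM := (completion M).

Lemma inbox_bsub V (p q u v : V -> M) x : bsub p q u v -> inbox u v x -> inbox p q x.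
Proof.
move=> h hx i; have [a b] := h i; have [c d] := hx i.
have ? : ~ pt (u i) ≪ pt (p i) by move/pt_lt.
have ? : ~ pt (q i) ≪ pt (v i) by move/pt_lt.
by split; ord.
Qed.

Lemma bsub_trans V (a b p q u v : V -> M) : bsub a b p q -> bsub p q u v -> bsub a b u v.
Proof. move=> h h' i; have [? ?] := h i; have [? ?] := h' i; split; ord. Qed.

Lemma avoid_bsub V (F : (V -> cM) -> Prop) (p q u v : V -> M) :
  bsub p q u v -> avoid F p q -> avoid F u v.
Proof. by move=> h a x /(inbox_bsub h)/a. Qed.

Lemma inbox_shrink V (u v : V -> M) x : inbox u v x -> exists u' v',
  inbox u' v' x /\ forall i, u i ≺ u' i /\ v' i ≺ v i.
Proof.
move=> hx; have [u' hu'] := choice (fun i => cut_dense (proj1 (hx i))).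
have [v' hv'] := choice (fun i => cut_dense (proj2 (hx i))).
exists u', v'; split=> i; have [/pt_lt ? ?] := hu' i; have [? /pt_lt ?] := hv' i; by split.
Qed.

Lemma exists_inbox V (x : V -> cM) : exists u v, inbox u v x.
Proof.
have [u hu] := choice (fun i => cut_lower (x i)).
have [v hv] := choice (fun i => cut_upper (x i)).
by exists u, v => i; split.
Qed.

Lemma inbox_lt V (u v : V -> M) x : inbox u v x -> forall i, u i ≺ v i.
Proof. by move=> h i; have [? ?] := h i; apply/pt_lt; ord. Qed.

Lemma inboxI V (u v u' v' : V -> M) x : inbox u v x -> inbox u' v' x ->
  exists a b, [/\ inbox a b x, bsub u v a b & bsub u' v' a b].
Proof.
move=> h h'.
have [a ha] := choice (fun i => exists_max (u i) (u' i)).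
have [b hb] := choice (fun i => exists_min (v i) (v' i)).
exists a, b; split=> i; have [? ? ea] := ha i; have [? ? eb] := hb i; split=> //.
  by have [? _] := h i; have [? _] := h' i; case: ea => ->.
by have [_ ?] := h i; have [_ ?] := h' i; case: eb => ->.
Qed.

Definition down (V : Type) (G : (V -> M) -> (V -> M) -> Prop) (u v : V -> M) :=
  exists p q, bsub p q u v /\ G p q.

(** The closed boxes strictly inside are covered by members of [G], and by [compactness] this
    amounts to a Lebesgue number on a slightly larger open box. The right-hand side quantifies over
    [M] only. *)
Lemma avoid_code (V : finType) (G : (V -> M) -> (V -> M) -> Prop) u v :
  pdef (V := V + V) (fun w => G (fun i => w (inl i)) (fun i => w (inr i))) ->
  avoid (fun x => forall u v, inbox u v x -> ~ G u v) u v <->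
  forall u' v', (forall i, u i ≺ u' i /\ (~ v' i ≺ u' i /\ v' i ≺ v i)) ->
  exists p q, (forall i, p i ≺ u' i /\ v' i ≺ q i) /\ lebesgue (down G) p q.
Proof.
move=> dG; split=> [av u' v' huv|h x /inbox_shrink[u' [v' [hx huv]]]].
  have dD : pdef (V := V + V) (fun w => down G (fun i => w (inl i)) (fun i => w (inr i))).
    rewrite /pdef /down; udef.
    by refine (UD_sub2 (X := fun _ => G) dG _ _) => l; udef.
  have mono p q p' q' : bsub p q p' q' -> down G p q -> down G p' q'.
    by move=> s1 [p0 [q0 [s0 G0]]]; exists p0, q0; split=> //; apply: bsub_trans s0 s1.
  have [|y hy _|p [q [h1 _ h3]]] := compactness dD mono (u := u') (v := v') (s := enum V)
      (x := fun i => pt (u' i)).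
  - by move=> i _; have [_ []] := huv i.
  - have yuv : inbox u v y.
      move=> i; have [/pt_lt a [_ /pt_lt b]] := huv i.
      by have [|c d] := hy i; [rewrite mem_enum|split; ord].
    have /av : inbox u v y by [].
    move=> /existsNP[p /existsNP[q]] /not_implyP[ypq] /contrapT Gpq.
    exists p, q; split=> //; exists p, q; split=> // i; split; exact: lt_irr.
  by exists p, q; split=> // i; apply: h1; rewrite mem_enum.
have [|p [q [hpq [e [e0 hL]]]]] := h u' v'.
  by move=> i; have [? ?] := huv i; have /(_ i) ? := inbox_lt hx; split=> //; split=> //; ord.
have xpq : inbox p q x.
  move=> i; have [/pt_lt ? /pt_lt ?] := hpq i; have [? ?] := hx i; split; ord.
have [a [b [hab sab sm]]] := small_box xpq e0.
have [p' [q' [s' G']]] := hL _ _ sab sm.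
by move=> /(_ p' q' (inbox_bsub s' hab)).
Qed.

(** Tube lemma: a point of the open box given by [compactness] has a neighbourhood shorter than the
    Lebesgue number, and this neighbourhood avoids [F]. *)
Lemma closed_box_hit (V : finType) (F : (V -> cM) -> Prop) u v :
  pdef (V := V + V) (fun w => avoid F (fun i => w (inl i)) (fun i => w (inr i))) ->
  (forall x, ~ F x -> exists u v, inbox u v x /\ avoid F u v) ->
  forall (J : {pred V}) (x : V -> cM), (forall i, i \in J -> ~ v i ≺ u i) ->
  (forall y, (forall i, i \in J -> ~ y i ≪ pt (u i) /\ ~ pt (v i) ≪ y i) ->
     (forall i, i \notin J -> y i = x i) -> ~ F y) ->
  exists p q, [/\ forall i, i \in J -> p i ≺ u i /\ v i ≺ q i,
    forall i, i \notin J -> pt (p i) ≪ x i /\ x i ≪ pt (q i) & avoid F p q].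
Proof.
move=> dF cF J x uv hF.
have mono p q p' q' : bsub p q p' q' -> avoid F p q -> avoid F p' q'.
  exact: avoid_bsub.
have [||p [q [h1 h2 [e [e0 h3]]]]] := compactness dF mono (u := u) (v := v) (s := enum J) (x := x).
- by move=> i; rewrite mem_enum; apply: uv.
- move=> y hy hyx; apply: cF; apply: hF => i iJ; [apply: hy|apply: hyx]; by rewrite mem_enum.
exists p, q; split=> [i iJ|i iJ|y ypq].
- by apply: h1; rewrite mem_enum.
- by apply: h2; rewrite mem_enum.
have [a [b [hab sab sm]]] := small_box ypq e0.
exact: h3 sab sm _ hab.
Qed.

End Single.

Section Coded.
Context {L : language} {K : Type} {St : K -> structure (og_lang L)} {P : Type}.
Context {c : forall k, P -> St k} {T : forall k, tame (St k)}.
Notation UD := (UD c).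
Notation UT := (UT c).

Definition fam (W V : Type) :=
  forall k, (W -> St k) -> (V -> completion (St k)) -> Prop.

(* Closed sets of the completion that are described inside the structure, by the
   boxes with corners in it that they avoid. *)
Record coded (W V : finType) (F : fam W V) : Prop := Coded {
  coded_avoid : UD (V := W + (V + V)) (fun k w => avoid (F k (fun i => w (inl i)))
    (fun i => w (inr (inl i))) (fun i => w (inr (inr i))));
  coded_closed : forall k t x, ~ F k t x ->
    exists u v, inbox u v x /\ avoid (F k t) u v }.

Lemma pdef_freeze (W V : finType) (G : forall k, (W -> St k) -> (V -> St k) -> (V -> St k) -> Prop) k t :
  UD (V := W + (V + V)) (fun k w => G k (fun i => w (inl i))
    (fun i => w (inr (inl i))) (fun i => w (inr (inr i)))) ->
  pdef (V := V + V) (fun w => G k t (fun i => w (inl i)) (fun i => w (inr i))).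
Proof.
move=> /(UD_pdef k) h.
by refine (UD_sub3 (X := fun _ => G k) (t1 := fun _ _ => t) h _ _ _) => i; udef.
Qed.

Lemma coded_pdef (W V : finType) (F : fam W V) k t : coded F ->
  pdef (V := V + V) (fun w => avoid (F k t) (fun i => w (inl i)) (fun i => w (inr i))).
Proof. by move=> [dF _]; apply: (pdef_freeze (G := fun k t => avoid (F k t))). Qed.

Lemma coded_ext (W V : finType) (F F' : fam W V) :
  (forall k t x, F k t x <-> F' k t x) -> coded F -> coded F'.
Proof.
move=> E cF; suff -> : F' = F by [].
by apply: functional_extensionality_dep => k; apply: funext => t; apply: funext => x;
  apply: propext; rewrite E.
Qed.

(** Any definable family of boxes with union the complement will do; [avoid_code] recovers from it
    all the boxes that avoid the set. Most closure properties of coded sets are proved by exhibiting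
    such a family. *)
Lemma coded_code (W V : finType) (G : forall k, (W -> St k) -> (V -> St k) -> (V -> St k) -> Prop) :
  UD (V := W + (V + V)) (fun k w => G k (fun i => w (inl i))
    (fun i => w (inr (inl i))) (fun i => w (inr (inr i)))) ->
  coded (fun k t x => forall u v, inbox u v x -> ~ G k t u v).
Proof.
move=> dG; split; last first.
  move=> k t x /existsNP[u /existsNP[v]] /not_implyP[xuv] /contrapT Guv.
  by exists u, v; split=> // y yuv /(_ _ _ yuv).
have dD : UD (V := W + (V + V)) (fun k w => down (G k (fun i => w (inl i)))
    (fun i => w (inr (inl i))) (fun i => w (inr (inr i)))).
  by rewrite /down; udef; refine (UD_sub3 (X := G) dG _ _ _) => i; udef.
have dL := UD_lebesgue (T := T) (G := fun k t => down (G k t)) dD.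
have dX : UD (V := W + (V + V)) (fun k w => forall u' v' : V -> St k,
   (forall i, w (inr (inl i)) ≺ u' i /\ (~ v' i ≺ u' i /\ v' i ≺ w (inr (inr i)))) ->
  exists p q, (forall i, p i ≺ u' i /\ v' i ≺ q i) /\
    lebesgue (down (G k (fun i => w (inl i)))) p q).
  udef; refine (UD_sub3 (X := fun k t => lebesgue (down (G k t))) dL _ _ _) => i; udef.
apply: UD_ext dX => k w; rewrite avoid_code //.
exact: (pdef_freeze (G := G)).
Qed.

End Coded.

Section CodedOps.
Context {L : language} {K : Type} {St : K -> structure (og_lang L)} {P : Type}.
Context {c : forall k, P -> St k} {T : forall k, tame (St k)}.
Notation UD := (UD c).
Notation UT := (UT c).
Notation coded := (coded (c := c)).
Notation fam := (fam (St := St)).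

Lemma UD_avoid (W V : finType) (F : fam W V) V0 t u v :
  coded F -> (forall i, UT (V := V0) (fun k z => t k z i)) ->
  (forall i, UT (V := V0) (fun k z => u k z i)) ->
  (forall i, UT (V := V0) (fun k z => v k z i)) ->
  UD (fun k z => avoid (F k (t k z)) (u k z) (v k z)).
Proof. by move=> [dF _]; apply: (UD_sub3 (X := fun k t => avoid (F k t))). Qed.

Lemma coded_and (W V : finType) (F F' : fam W V) : coded F -> coded F' ->
  coded (fun k t x => F k t x /\ F' k t x).
Proof.
move=> cF cF'.
apply: coded_ext (coded_code (c := c) (G := fun k t u v => avoid (F k t) u v \/ avoid (F' k t) u v) _).
  move=> k t x; split=> [h|[Fx Fx'] u v huv [/(_ x huv)|/(_ x huv)]//].
  split; apply: contrapT.
    by move=> /(coded_closed cF)[u [v [xuv av]]]; apply: (h u v xuv); left.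
  by move=> /(coded_closed cF')[u [v [xuv av]]]; apply: (h u v xuv); right.
by apply: UD_or; [refine (UD_avoid cF _ _ _)|refine (UD_avoid cF' _ _ _)] => i; udef.
Qed.

Lemma coded_or (W V : finType) (F F' : fam W V) : coded F -> coded F' ->
  coded (fun k t x => F k t x \/ F' k t x).
Proof.
move=> cF cF'.
apply: coded_ext (coded_code (c := c) (G := fun k t u v => avoid (F k t) u v /\ avoid (F' k t) u v) _).
  move=> k t x; split=> [h|[Fx|Fx] u v huv [h h']]; last by case: (h' x huv).
    apply: contrapT => /not_orP[/(coded_closed cF)[u [v [h1 a1]]]].
    move=> /(coded_closed cF')[u' [v' [h2 a2]]].
    have [a [b [hab s1 s2]]] := inboxI h1 h2.
    by apply: (h a b hab); split; [apply: avoid_bsub a1|apply: avoid_bsub a2].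
  by case: (h x huv).
by apply: UD_and; [refine (UD_avoid cF _ _ _)|refine (UD_avoid cF' _ _ _)] => i; udef.
Qed.

Lemma coded_cond (W V : finType) (Q : forall k, (W -> St k) -> Prop) : UD Q ->
  coded (fun k t (_ : V -> completion (St k)) => Q k t).
Proof.
move=> dQ; apply: coded_ext (coded_code (c := c) (G := fun k t u v => ~ Q k t) _); last first.
  by apply: UD_not; apply: (UD_ren (fun i => inl i) dQ).
move=> k t x; split=> [h|q u v _ /(_ q)//]; apply: contrapT => nq.
by have [u [v huv]] := exists_inbox x; apply: (h u v huv).
Qed.

Lemma coded_param (W W' V : finType) (F : fam W V) (t : forall k, (W' -> St k) -> W -> St k) :
  coded F -> (forall i, UT (V := W') (fun k z => t k z i)) ->
  coded (fun k z => F k (t k z)).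
Proof.
move=> cF ht; split; last by move=> k z x; apply: (coded_closed cF).
refine (UD_avoid (t := fun k w => t k (fun i => w (inl i))) cF _ _ _) => i; udef.
have [s Hs] := ht i.
exists (tren (fun i => match i with inl j => inl (inl j) | inr p => inr p end) s).
move=> k w; rewrite eval_tren Hs; congr Defs.eval.
by apply: funext => -[].
Qed.

(** By the tube lemma a nonempty closed box misses [F] exactly when some larger open box avoids
    [F]. *)
Lemma UD_hit (W V : finType) (F : fam W V) V0 t u v :
  coded F -> (forall i, UT (V := V0) (fun k z => t k z i)) ->
  (forall i, UT (V := V0) (fun k z => u k z i)) ->
  (forall i, UT (V := V0) (fun k z => v k z i)) ->
  UD (fun k z => hit (F k (t k z)) (u k z) (v k z)).
Proof.
move=> cF; apply: (UD_sub3 (X := fun k t => hit (F k t))).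
have dX : UD (V := W + (V + V)) (fun k w => (forall i, ~ w (inr (inr i)) ≺ w (inr (inl i))) /\
   forall p q, (forall i, p i ≺ w (inr (inl i)) /\ w (inr (inr i)) ≺ q i) ->
     ~ avoid (F k (fun i => w (inl i))) p q).
  by udef; refine (UD_avoid cF _ _ _) => i; udef.
apply: UD_ext dX => k w; split=> [[uv h]|[x Fx hx]].
  apply: contrapT => nh.
  have [||p [q [h1 _ h3]]] := closed_box_hit (coded_pdef (fun i => w (inl i)) cF)
    (coded_closed cF (k := k) (t := fun i => w (inl i)))
    (u := fun i => w (inr (inl i))) (v := fun i => w (inr (inr i))) (J := predT)
    (x := fun i => pt (w (inr (inl i)))).
  - by move=> i _; apply: uv.
  - by move=> y hy _ Fy; apply: nh; exists y => // i; apply: hy.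
  by apply: (h p q) => // i; apply: h1.
split=> [i /pt_lt|p q hpq av]; first by have [? ?] := hx i => ?; ord.
apply: (av x) => // i; have [/pt_lt ? /pt_lt ?] := hpq i; have [? ?] := hx i.
by split; ord.
Qed.

(** Projection of [F] along the coordinates in [J], between bounds carried by the added parameters.
    The result is kept as a cylinder over [J], so that the coordinate type does not change. *)
Definition cyl (W V : finType) (J : {pred V}) (F : fam W V) : fam (W + (V + V)) V :=
  fun k w x => exists y, [/\ F k (fun i => w (inl i)) y,
    forall i, i \in J -> ~ y i ≪ pt (w (inr (inl i))) /\ ~ pt (w (inr (inr i))) ≪ y i
    & forall i, i \notin J -> y i = x i].

Arguments cyl [W V] J F k w x.

(** Around a point outside the projection, the tube lemma gives a box avoiding [F] that extends
    beyond the bounds in the directions of [J]. *)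
Lemma coded_cyl (W V : finType) (J : {pred V}) (F : fam W V) :
  coded F -> coded (cyl J F).
Proof.
move=> cF.
apply: coded_ext (coded_code (c := c) (G := fun k w p q =>
  (exists i, i \in J /\ w (inr (inr i)) ≺ w (inr (inl i))) \/
  exists p' q', avoid (F k (fun i => w (inl i))) p' q' /\
    forall i, (i \in J -> p' i ≺ w (inr (inl i)) /\ w (inr (inr i)) ≺ q' i) /\
      (i \notin J -> ~ p i ≺ p' i /\ ~ q' i ≺ q i)) _); last first.
  by udef; refine (UD_avoid cF _ _ _) => l; udef.
move=> k w x; split=> [h|[y [Fy hJ hnJ]] p q hpq [[i [iJ /pt_lt ?]]|[p' [q' [av h]]]]]; last 2 first.
- by have [? ?] := hJ i iJ; ord.
- apply: (av y) => // i; have [h1 h2] := h i; have [iJ|iJ] := boolP (i \in J).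
    have [/pt_lt ? /pt_lt ?] := h1 iJ; have [? ?] := hJ i iJ; split; ord.
  have [a b] := h2 iJ; rewrite (hnJ _ iJ); have [? ?] := hpq i.
  have ? : ~ pt (p i) ≪ pt (p' i) by move/pt_lt.
  have ? : ~ pt (q' i) ≪ pt (q i) by move/pt_lt.
  by split; ord.
apply: contrapT => nh.
have [a [b hab]] := exists_inbox x.
have uv i : i \in J -> ~ w (inr (inr i)) ≺ w (inr (inl i)).
  by move=> iJ ?; apply: (h a b hab); left; exists i.
have [|p [q [h1 h2 h3]]] := closed_box_hit (coded_pdef (fun i => w (inl i)) cF)
    (coded_closed cF (k := k) (t := fun i => w (inl i))) uv (x := x).
  by move=> y y1 y2 Fy; apply: nh; exists y.
apply: (h (fun i => if i \in J then a i else p i) (fun i => if i \in J then b i else q i)).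
  by move=> i; have [iJ|iJ] := boolP (i \in J); [apply: hab|apply: h2].
right; exists p, q; split=> // i; split=> [/h1//|/negPf->].
by split; apply: lt_irr.
Qed.

(** One operation for renaming, identifying and adding coordinates, and for slicing at points of the
    structure given by parameters. *)
Definition cyl_subst (W V V' : finType) (f : V -> V' + W) (F : fam W V) : fam W V' :=
  fun k t x => F k t (fun i => match f i with inl j => x j | inr w => pt (t w) end).

Arguments cyl_subst [W V V'] f F k t x.

Lemma coded_subst (W V V' : finType) (f : V -> V' + W) (F : fam W V) :
  coded F -> coded (cyl_subst f F).
Proof.
move=> cF.
apply: coded_ext (coded_code (c := c) (G := fun k t p q =>
  exists p' q', avoid (F k t) p' q' /\
    forall i, (forall j, f i = inl j -> ~ p j ≺ p' i /\ ~ q' i ≺ q j) /\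
      (forall w, f i = inr w -> p' i ≺ t w /\ t w ≺ q' i)) _); last first.
  by udef; refine (UD_avoid cF _ _ _) => l; udef.
move=> k t x; rewrite /cyl_subst; set y := fun i => _.
split=> [h|Fy p q hpq [p' [q' [av h]]]]; last first.
  apply: (av y) => // i; rewrite /y; have [h1 h2] := h i.
  case E: (f i) => [j|w].
    have [? ?] := h1 j E; have [? ?] := hpq j.
    have ? : ~ pt (p j) ≪ pt (p' i) by move/pt_lt.
    have ? : ~ pt (q' i) ≪ pt (q j) by move/pt_lt.
    by split; ord.
  by have [/pt_lt ? /pt_lt ?] := h2 w E.
apply: contrapT => /(coded_closed cF)[p' [q' [hy av]]].
have [a [b hab]] := exists_inbox x.
(* Several coordinates may be sent to the same [j]: a bound for all their lower ends is taken, with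
   [a j] as default for the coordinates sent elsewhere. *)
have hp j : exists2 z, pt z ≪ x j & forall i, f i = inl j -> ~ z ≺ p' i.
  have [|||z h1 h2] := @finite_upper _ _ _ V (fun i => if f i is inl j' then
     (if j' == j then p' i else a j) else a j) (fun z => pt z ≪ x j).
  - by move=> u v ? /pt_lt ?; ord.
  - by exists (a j); have [] := hab j.
  - move=> i; have := hy i; rewrite /y; case: (f i) => [j'|w]; last by have [] := hab j.
    by case: eqP => [->|_] [? _] //; have [] := hab j.
  by exists z => // i E; have := h2 i; rewrite E eqxx.
have hq j : exists2 z, x j ≪ pt z & forall i, f i = inl j -> ~ q' i ≺ z.
  have [|||z h1 h2] := @finite_lower _ _ _ V (fun i => if f i is inl j' then
     (if j' == j then q' i else b j) else b j) (fun z => x j ≪ pt z).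
  - by move=> u v ? /pt_lt ?; ord.
  - by exists (b j); have [] := hab j.
  - move=> i; have := hy i; rewrite /y; case: (f i) => [j'|w]; last by have [] := hab j.
    by case: eqP => [->|_] [_ ?] //; have [] := hab j.
  by exists z => // i E; have := h2 i; rewrite E eqxx.
have [p hp1] := dchoice (fun j => let: ex_intro2 z h1 h2 := hp j in
  ex_intro (fun z => pt z ≪ x j /\ forall i, f i = inl j -> ~ z ≺ p' i) z (conj h1 h2)).
have [q hq1] := dchoice (fun j => let: ex_intro2 z h1 h2 := hq j in
  ex_intro (fun z => x j ≪ pt z /\ forall i, f i = inl j -> ~ q' i ≺ z) z (conj h1 h2)).
apply: (h p q) => [j|]; first by have [] := hp1 j; have [] := hq1 j.
exists p', q'; split=> // i; split=> [j E|w E].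
  by have [_ h1] := hp1 j; have [_ h2] := hq1 j; split; [apply: h1|apply: h2].
by have := hy i; rewrite /y E => -[/pt_lt ? /pt_lt ?].
Qed.

(* An exhaustion of the complement of [F], increasing as the parameter [None]
   decreases to 0. *)
Definition shrink (W V : finType) (F : fam W V) : fam (option W) V :=
  fun k t x => ozero ≺ t None /\ forall u v, inbox u v x ->
    ~ ((forall i, v i ≺ sadd (u i) (t None)) /\ ~ avoid (F k (fun i => t (Some i))) u v).

Arguments shrink [W V] F k t x.

Lemma coded_shrink (W V : finType) (F : fam W V) : coded F -> coded (shrink F).
Proof.
move=> cF; apply: coded_and; first by apply: coded_cond; udef.
by apply: coded_code; udef; refine (UD_avoid cF _ _ _) => l; udef.
Qed.

Lemma shrink_disj (W V : finType) (F : fam W V) k t x :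
  shrink F k t x -> ~ F k (fun i => t (Some i)) x.
Proof.
move=> [e0 h] Fx; have [a [b hab]] := exists_inbox x.
have [u [v [huv _ sm]]] := small_box hab e0.
by apply: (h u v huv); split=> // /(_ x huv).
Qed.

(** If a box around [x] avoids [F], a smaller box around [x] leaves a margin on each side, and every
    box around [x] shorter than the margins stays inside the first one. *)
Lemma shrink_cover (W V : finType) (F : fam W V) k t x : coded F ->
  ~ F k t x -> exists e, shrink F k (extend t e) x.
Proof.
move=> cF /(coded_closed cF)[u [v [huv av]]].
have [u' [v' [huv' h]]] := inbox_shrink huv.
have /choice[f hf] : forall i, exists e : St k, ozero ≺ e /\ (~ u' i ≺ sadd (u i) e
    /\ ~ v i ≺ sadd (v' i) e).
  move=> i; have [h1 h2] := h i.
  have [e1 E1] := solve_right (u i) (u' i); have [e2 E2] := solve_right (v' i) (v i).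
  have [e [le1 le2 eE]] := exists_min e1 e2; exists e; split.
    by case: eE => ->; [rewrite (lt_add (u i)) E1|rewrite (lt_add (v' i)) E2].
  by rewrite -E1 -E2 !addl_ltE.
have [|||e e0 he] := @finite_lower _ _ _ V f (fun e => ozero ≺ e).
- by move=> ? ? ? ?; ord.
- by have [e ?] := exists_pos (M := St k) (T := T k); exists e.
- by move=> i; have [] := hf i.
exists e; split=> // a b hab [sm]; apply; apply: avoid_bsub av => i.
have := sm i; rewrite /= => smi; have [_ [f1 f2]] := hf i.
have ? := he i; have [? ?] := hab i; have [? ?] := huv' i; split.
- move=> au; have ? : sadd (a i) e ≺ sadd (u i) e by rewrite addr_ltE.
  have ? : ~ sadd (u i) (f i) ≺ sadd (u i) e by rewrite addl_ltE.
  have /pt_lt ? : b i ≺ u' i by ord.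
  by ord.
- move=> vb; have /pt_lt ? : a i ≺ v' i.
    by apply/pt_lt; ord.
  have ? : sadd (a i) e ≺ sadd (v' i) e by rewrite addr_ltE; apply/pt_lt.
  have ? : ~ sadd (v' i) (f i) ≺ sadd (v' i) e by rewrite addl_ltE.
  by ord.
Qed.

Lemma shrink_mono (W V : finType) (F : fam W V) k t e e' x : ~ e ≺ e' -> ozero ≺ e' ->
  shrink F k (extend t e) x -> shrink F k (extend t e') x.
Proof.
move=> ee e0' [e0 h]; split=> // u v huv [sm nav]; apply: (h u v huv); split=> // i.
have ? := sm i; have ? : ~ sadd (u i) e ≺ sadd (u i) e' by rewrite addl_ltE.
by rewrite /= in sm *; ord.
Qed.

Definition union_closure (W W' V : finType) (F : fam (W + W') V) : fam W V :=
  fun k t x => forall u v, inbox u v x -> ~ forall t', avoid (F k (join_val t t')) u v.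

Arguments union_closure [W W' V] F k t x.

Lemma coded_union_closure (W W' V : finType) (F : fam (W + W') V) :
  coded F -> coded (union_closure F).
Proof.
move=> cF; apply: coded_code; udef.
by refine (UD_avoid (t := fun k w => join_val (fun i => w (inl (inl i)))
  (fun i => w (inr i))) cF _ _ _) => [[i|i]|i|i] /=; udef.
Qed.

Lemma avoid_union_closure (W W' V : finType) (F : fam (W + W') V) k t u v :
  avoid (union_closure F k t) u v <-> forall t', avoid (F k (join_val t t')) u v.
Proof.
split=> [h t' x hx Fx|h x hx]; last by move/(_ u v hx).
by apply: (h x hx) => u' v' hx' /(_ t' x hx').
Qed.
End CodedOps.
Arguments cyl {L K St T} [W V] J F k w x.
Arguments cyl_subst {L K St T} [W V V'] f F k t x.
Arguments shrink {L K St T} [W V] F k t x.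
Arguments union_closure {L K St T} [W W' V] F k t x.

(** * Consequences of weak o-minimality *)

Section Germ.
Context {T : Type} {lt : T -> T -> Prop} {O : total_order lt}.

(** A convex set cofinal in [S] contains a final segment of [S]; the finitely many sets are treated
    one after another. [S] is arbitrary, so it may be the set of points below a cut. *)
Lemma convex_germ k (C : 'I_k -> set T) (S : T -> Prop) :
  (forall i, convex_set lt (C i)) -> (exists x, S x) ->
  exists2 q, S q & (forall x, S x -> ~ lt x q -> (\bigcup_i C i) x) \/
    (forall x, S x -> ~ lt x q -> ~ (\bigcup_i C i) x).
Proof.
move=> cC [x0 Sx0].
have [q Sq hq] : exists2 q, S q & forall i, i \in enum 'I_k ->
    (forall x, S x -> ~ lt x q -> C i x) \/ (forall x, S x -> ~ lt x q -> ~ C i x).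
  elim: (enum 'I_k) => [|i s [q Sq IH]]; first by exists x0.
  have mono q' j : ~ lt q' q -> j \in s ->
      (forall x, S x -> ~ lt x q' -> C j x) \/ (forall x, S x -> ~ lt x q' -> ~ C j x).
    by move=> qq /IH[h|h]; [left|right] => x Sx xq; apply: h => //; ord.
  have [[q' [Sq' qq' h]]|h] := pselect (exists q', [/\ S q', ~ lt q' q &
      forall x, S x -> ~ lt x q' -> ~ C i x]).
    exists q' => // j; rewrite inE => /orP[/eqP->|]; first by right.
    exact: mono.
  have cof q' : S q' -> ~ lt q' q -> exists x, [/\ S x, ~ lt x q' & C i x].
    move=> Sq' qq'; apply: contrapT => h'; apply: h; exists q'; split=> // x Sx xq' Cx.
    by apply: h'; exists x.
  have [q' [Sq' qq' Cq']] := cof q Sq (@lt_irr _ _ O q).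
  exists q' => // j; rewrite inE => /orP[/eqP->|]; last exact: mono.
  left=> x Sx xq'; have [|y [Sy yx Cy]] := cof x Sx; first by ord.
  have [q'x|<-//|?] := lt_tot q' x; last by ord.
  have [xy|->//|?] := lt_tot x y; last by ord.
  exact: (cC i _ _ _ Cq' Cy).
exists q => //; have [[i hi]|h] := pselect (exists i, forall x, S x -> ~ lt x q -> C i x).
  by left=> x Sx xq; exists i => //; apply: hi.
right=> x Sx xq [i _ Cx]; have [|h'|h'] := hq i; first by rewrite mem_enum.
  by apply: h; exists i.
exact: h' Cx.
Qed.
End Germ.

Lemma flip_order T (lt : T -> T -> Prop) (O : total_order lt) :
  total_order (fun x y => lt y x).
Proof.
split=> [x|x y z xy yz|x y]; first exact: lt_irr.
  by ord.
by have [?|?|?] := lt_tot x y; [constructor 3|constructor 2|constructor 1].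
Qed.

(** * Definable subgroups and small steps across cuts *)

Section WeaklyOMinimal.
Context {L : language} {M : structure (og_lang L)} {G : is_ordered_group M}.
Hypothesis wom : weakly_o_minimal M.

Lemma germ_up (D S : M -> Prop) : pdef (fun v : unit -> M => D (v tt)) ->
  (exists x, S x) -> exists2 q, S q & (forall x, S x -> ~ x ≺ q -> D x) \/
    (forall x, S x -> ~ x ≺ q -> ~ D x).
Proof.
move=> /definable1E/wom[k [C [cC E]]] Sx.
have [q Sq hq] := convex_germ cC Sx; exists q => //.
by change D with (D : set M); rewrite E.
Qed.

Lemma germ_down (D S : M -> Prop) : pdef (fun v : unit -> M => D (v tt)) ->
  (exists x, S x) -> exists2 q, S q & (forall x, S x -> ~ q ≺ x -> D x) \/
    (forall x, S x -> ~ q ≺ x -> ~ D x).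
Proof.
move=> /definable1E/wom[k [C [cC E]]] Sx.
have cC' i : convex_set (fun x y : M => y ≺ x) (C i).
  by move=> x y z Cx Cy zx yz; apply: (cC i y x).
have [q Sq hq] := @convex_germ _ _ (flip_order slt_order) _ _ _ cC' Sx; exists q => //.
by change D with (D : set M); rewrite E.
Qed.

Hypothesis nv : forall H : set M, definable1 H -> convex_set (@slt L M) H -> is_subgroup H ->
  H = @is_zero L M \/ H = setT.

(** Weak o-minimality makes [H] convex: towards its upper end [H] contains everything between its
    elements, and translation by elements of [H] carries this anywhere. *)
Lemma definable_subgroup (H : set M) (a : M) :
  pdef (fun v : unit -> M => H (v tt)) -> H ozero ->
  (forall x y, H x -> H y -> H (sadd x y)) ->
  (forall x y, H x -> sadd x y = ozero -> H y) ->
  H a -> a <> ozero -> forall x, H x.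
Proof.
move=> dH H0 HD HN Ha a0.
have sH : is_subgroup H.
  by split=> // [e /is_zeroE->//|x y Hx /is_zeroE]; apply: HN.
have cH : convex_set (@slt L M) H.
  (* The germ is taken at the upper end of the downward closure of [H]. [H] is cofinal in it, so the
     germ is not that of the complement. *)
  have [|q [h0 Hh0 qh0] hq] := germ_up (S := fun x => exists2 h, H h & ~ h ≺ x) dH.
    by exists ozero, ozero => //; apply: lt_irr.
  have {}hq x h : H h -> ~ h ≺ x -> ~ x ≺ q -> H x.
    move=> Hh hx xq; case: hq => hq; first by apply: hq => //; exists h.
    by case: (hq h0) => //; exists h0 => //; apply: lt_irr.
  move=> x y z Hx Hy xz zy.
  have [w E] := solve_right x z; have [y' E'] := solve_right x y.
  have [x' Ex] := solve_right x ozero.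
  have w0 : ozero ≺ w by rewrite (lt_add x) E.
  have wy : w ≺ y' by rewrite -(addl_ltE x) E E'.
  have Hy' : H y'.
    have Hx' := HN _ _ Hx Ex.
    have [x'' Ex''] := solve_right x' ozero; have : x'' = x.
      by rewrite -[LHS]add0 -Ex -addA Ex'' addr0.
    move=> xx; have -> : y' = sadd x' y.
      by rewrite -E' addA -[sadd x' x](_ : ozero = _) ?add0 // -{1}Ex'' xx.
    exact: HD.
  have Hhw : H (sadd h0 w).
    apply: (hq _ (sadd h0 y')); first exact: HD.
      by rewrite addl_ltE => ?; ord.
    by move: w0; rewrite (lt_add h0) => *; ord.
  have [h' Eh'] := solve_left h0 ozero.
  have Hh' : H h'.
    have [h2 E2] := solve_right h0 ozero; have Hh2 := HN _ _ Hh0 E2.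
    by rewrite -[h'](addr0) -E2 addA Eh' add0.
  have -> : z = sadd x (sadd h' (sadd h0 w)) by rewrite -E (addA h') Eh' add0.
  by apply: (HD) => //; apply: HD.
have := nv (proj2 (definable1E H) dH) cH sH => -[E|->//].
by move: Ha; rewrite E => /is_zeroE.
Qed.

(** The centralizer of [x] is a definable subgroup containing [x]. *)
Lemma addC (x y : M) : sadd x y = sadd y x.
Proof.
have [->|x0] := pselect (x = ozero); first by rewrite add0 addr0.
apply: (@definable_subgroup (fun y => sadd x y = sadd y x) x _ _ _ _ _ x0) => //.
- by rewrite /pdef; udef.
- by rewrite add0 addr0.
- by move=> a b Ea Eb; rewrite addA Ea -addA Eb addA.
- move=> a b Ea Eab; have [b' Eb'] : exists b', sadd b' a = ozero by exact: solve_left.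
  have Eb : b = b' by rewrite -[b]add0 -Eb' -addA Eab addr0.
  rewrite Eb -[LHS](add0) -{1}Eb' -addA (addA a) -Ea -(addA x) -Eb Eab addr0.
  by rewrite Eb.
Qed.

(** By commutativity the doubles form a definable subgroup. *)
Lemma halving (x : M) : exists y, x = sadd y y.
Proof.
have [->|x0] := pselect (x = ozero); first by exists ozero; rewrite add0.
apply: (@definable_subgroup (fun x => exists y, x = sadd y y) (sadd x x)) => //.
- by rewrite /pdef; udef.
- by exists ozero; rewrite add0.
- move=> _ _ [a ->] [b ->]; exists (sadd a b).
  by rewrite -!addA (addA b) (addC b a) !addA.
- move=> _ z [a ->] E; have [b Eb] := solve_right a ozero; exists b.
  by apply: (@add_inj _ _ _ (sadd a a)); rewrite E -addA (addA a b) Eb add0 Eb.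
- by exists x.
- by move=> e; have [h|//|h] := lt_tot x ozero; move: (h) => /(addl_lt x); rewrite addr0 e => ?; ord.
Qed.

Lemma half_between (e : M) : ozero ≺ e -> exists2 d, ozero ≺ d & d ≺ e.
Proof.
move=> e0; have [d Ed] := halving e.
have d0 : ozero ≺ d.
  have [d0|d0|//] := lt_tot d ozero; last by move: e0; rewrite Ed d0 add0 => ?; ord.
  by move: (d0) => /(addl_lt d); rewrite addr0 -Ed => ?; ord.
by exists d => //; rewrite Ed -lt_add.
Qed.

End WeaklyOMinimal.

(** Density comes from halving. For [tame_nv], a cut that is never crossed by a step [d] is
    invariant under translation by [d]; its stabilizer is a definable subgroup, hence everything,
    and the cut would be trivial. *)
Lemma non_valuational_tame L (M : structure (og_lang L)) :
  non_valuational M -> (exists x y : M, x ≺ y) -> tame M.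
Proof.
move=> [og wom nv] ex; have half := @half_between _ _ og wom nv; split=> //.
- move=> x y xy; have [e E] := solve_right x y.
  have [|d d0 de] := half e; first by rewrite (lt_add x) E.
  by exists (sadd x d); [rewrite -lt_add|rewrite -E addl_ltE].
- move=> C dC [x0 Cx0] [y0 Cy0] Cd z e /is_zeroE-> /half[d d0 de].
  apply: contrapT => h; apply: Cy0.
  have Ce x : C (sadd x d) <-> C x.
    split=> [hC|Cx]; first by apply: Cd hC _; rewrite -lt_add.
    apply: contrapT => nC; apply: h; exists x, (sadd x d); split=> //.
    by rewrite addl_ltE.
  have [g Eg] := solve_right x0 y0; rewrite -Eg.
  suff : forall g x, C (sadd x g) <-> C x by move=> ->.
  apply: (@definable_subgroup _ _ _ wom nv (fun g => forall x, C (sadd x g) <-> C x) d) => //.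
  + rewrite /pdef; udef; move/definable1E: dC => dC.
    1: refine (UD_sub (X := fun _ w => C (w tt)) (t := fun k v _ => sadd (v None) (v (Some tt))) _ dC _) => *; udef.
    2: refine (UD_sub (X := fun _ w => C (w tt)) (t := fun k v _ => v None) _ dC _) => *; udef.
    1,2: by move=> *; exact: (inhabits x0).
  + by move=> x; rewrite addr0.
  + by move=> x y hx hy a; rewrite addA hy hx.
  + move=> x y hx E a; have [a' <-] := solve_left x a.
    by rewrite -addA E addr0 hx.
  + by move=> d0'; move: d0; rewrite d0' => ?; ord.
Qed.

(** Induction on the number of coordinates, up to bijection of the index type. *)
Lemma finType_ind (Pr : finType -> Prop) :
  Pr void -> (forall V : finType, Pr V -> Pr (option V)) ->
  (forall (V V' : finType) (f : V -> V') (g : V' -> V),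
    cancel f g -> cancel g f -> Pr V -> Pr V') -> forall V, Pr V.
Proof.
move=> P0 PS Pt V; apply: (Pt 'I_#|V| V enum_val enum_rank enum_valK enum_rankK).
elim: #|V| => [|n IH].
  pose g (i : 'I_0) : void := False_rect _ (notF (ltn_ord i)).
  have c1 : cancel (@of_void 'I_0) g by case.
  have c2 : cancel g (@of_void 'I_0) by case.
  exact: Pt c1 c2 P0.
have c1 : cancel (oapp (lift ord0) (@ord0 n)) (unlift ord0).
  by move=> [i|] /=; [rewrite liftK|rewrite unlift_none].
have c2 : cancel (unlift ord0) (oapp (lift ord0) (@ord0 n)).
  by move=> i; case: (unliftP ord0 i) => [j|] ->.
exact: Pt c1 c2 (PS _ IH).
Qed.

(** * Definable sets and definable chains on boxes *)

Definition isbox L (M : structure (og_lang L)) V (a b : V -> M) := forall i, a i ≺ b i.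

Definition chain (W V : Type) (Z : W -> V -> Prop) :=
  forall t t', (forall x, Z t x -> Z t' x) \/ (forall x, Z t' x -> Z t x).

Section Generic.
Context {L : language} {M : structure (og_lang L)} {T : tame M}.
Notation pUD := (UD (K := unit) (St := fun=> M) (P := M) (fun=> id)).
Notation pUT := (UT (K := unit) (St := fun=> M) (P := M) (fun=> id)).
Hypothesis wom : weakly_o_minimal M.

Lemma box_inh V (a b : V -> M) : isbox a b -> exists x, vbox a b x.
Proof.
by move=> h; have [x hx] := choice (fun i => exists_between (h i)); exists x.
Qed.

Lemma bsub_refl V (a b : V -> M) : bsub a b a b.
Proof. by move=> i; split; apply: lt_irr. Qed.

Lemma vbox_bsub V (a b a' b' x : V -> M) : bsub a b a' b' -> vbox a' b' x -> vbox a b x.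
Proof. move=> h hx i; have [? ?] := h i; have [? ?] := hx i; split; ord. Qed.

Lemma germ_right (p b : M) (D : M -> Prop) : pdef (fun v : unit -> M => D (v tt)) -> p ≺ b ->
  exists q, [/\ p ≺ q, ~ b ≺ q & (forall x, p ≺ x -> x ≺ q -> D x) \/
    (forall x, p ≺ x -> x ≺ q -> ~ D x)].
Proof.
move=> dD pb; have [q pq hq] := germ_down wom dD (ex_intro (fun x => p ≺ x) b pb).
have [q' [h1 h2 qE]] := exists_min q b; exists q'; split; [by case: qE => ->|by []|].
by case: hq => hq; [left|right] => x px xq; apply: hq => //; ord.
Qed.

Definition interval_in (D : M -> Prop) := exists y1 y2, y1 ≺ y2 /\
  forall y, y1 ≺ y -> y ≺ y2 -> D y.

Lemma pdef_at (W : finType) (Z : (W -> M) -> M -> Prop) t :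
  pdef (V := option W) (fun w => Z (fun i => w (Some i)) (w None)) ->
  pdef (fun v : unit -> M => Z t (v tt)).
Proof.
by move=> dZ; refine (UD_subo (X := fun _ => Z) (t1 := fun _ _ => t) dZ _ _) => *; udef.
Qed.

(** [R] is the set of the points that are the first one, after [p], of some member. If no member
    contained an interval, both possible germs of [R] to the right of [p] would be contradictory. *)
Lemma chain_cover1 (W : finType) (Z : (W -> M) -> M -> Prop) p b :
  pdef (V := option W) (fun w => Z (fun i => w (Some i)) (w None)) ->
  chain Z -> p ≺ b -> (forall y, p ≺ y -> y ≺ b -> exists t, Z t y) ->
  exists t, interval_in (fun y => (p ≺ y /\ y ≺ b) /\ Z t y).
Proof.
move=> dZ cZ pb cov; apply: contrapT => nI.
have noint t y1 y2 : ~ y1 ≺ p -> ~ b ≺ y2 -> y1 ≺ y2 ->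
    ~ (forall y, y1 ≺ y -> y ≺ y2 -> Z t y).
  move=> py1 y2b y12 h; apply: nI; exists t, y1, y2; split=> // y ? ?.
  by split; [split; ord|apply: h].
pose R y := exists t, Z t y /\ forall z, p ≺ z -> z ≺ y -> ~ Z t z.
have dR : pdef (fun v : unit -> M => R (v tt)).
  rewrite /pdef /R; udef.
  1,2: by refine (UD_subo (X := fun _ => Z) dZ _ _) => *; udef.
(* If [R] holds near [p], let [r1] be first in the member [t1]. For [r] above [r1], the member in
   which [r] is first omits [r1], so it is contained in that of [t1], which therefore contains all
   these [r]. *)
have [q [pq qb [hR|hR]]] := germ_right dR pb.
  have [r1 [pr1 r1q]] := exists_between pq.
  have [t1 [Z1 _]] := hR r1 pr1 r1q.
  apply: (noint t1 r1 q) => //; first by ord.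
  move=> r r1r rq; have [|t [Zr hr]] := hR r _ rq; first by ord.
  by have [/(_ r1 Z1)|] := cZ t1 t; [move/(hr r1 pr1 r1r)|apply].
have [y [py yq]] := exists_between pq.
have [t Zy] : exists t, Z t y by apply: cov => //; ord.
(* If [R] fails near [p], the member through [y] has no first point, and weak o-minimality at the
   lower end of its upward closure [S] puts an interval into it. *)
pose S x := (p ≺ x /\ x ≺ q) /\ exists z, [/\ p ≺ z, ~ x ≺ z & Z t z].
have Sz z : p ≺ z -> z ≺ q -> Z t z -> S z.
  by move=> pz zq Zz; split=> //; exists z; split=> //; apply: lt_irr.
have Sy : S y by apply: Sz.
have [q0 [[pq0 q0q] [z0 [pz0 zq0 Zz0]]] h0] := germ_down wom (pdef_at t dZ) (ex_intro S _ Sy).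
have z0q : z0 ≺ q by ord.
case: h0 => h0; last exact: (h0 z0 (Sz _ pz0 z0q Zz0)).
have [[x [[[px xq] [z [pz zx Zz]]] xq0]]|nm] := pselect (exists x, S x /\ x ≺ q0).
  apply: (noint t x q0) => //; [by ord|by ord|move=> r xr rq0].
  apply: h0; last by ord.
  split; first by split; ord.
  by exists z; split=> //; ord.
have min z : p ≺ z -> z ≺ q0 -> ~ Z t z.
  by move=> pz zq Zz; apply: nm; exists z; split=> //; apply: Sz => //; ord.
have z0E : z0 = q0 by apply: le_anti => // ?; apply: (min z0).
by apply: (hR q0 pq0 q0q); exists t; rewrite -{1}z0E.
Qed.

Definition sub_constant V := forall X : (V -> M) -> Prop, pdef X ->
  forall a b, isbox a b -> exists a' b', [/\ isbox a' b', bsub a b a' b' &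
    (forall x, vbox a' b' x -> X x) \/ (forall x, vbox a' b' x -> ~ X x)].

(** A Baire category property, restricted to definable chains. *)
Definition chain_cover V := forall (W : finType) (Z : (W -> M) -> (V -> M) -> Prop),
  pdef (V := W + V) (fun w => Z (fun i => w (inl i)) (fun i => w (inr i))) ->
  chain Z -> forall a b, isbox a b -> (forall x, vbox a b x -> exists t, Z t x) ->
  exists t a' b', [/\ isbox a' b', bsub a b a' b' & forall x, vbox a' b' x -> Z t x].

Definition fiber_interval V := forall F : (V -> M) -> M -> Prop,
  pdef (V := option V) (fun w => F (fun i => w (Some i)) (w None)) ->
  forall a b, isbox a b -> (forall x, vbox a b x -> interval_in (F x)) ->
  exists a' b' y1 y2, [/\ isbox a' b', bsub a b a' b', y1 ≺ y2 &
    forall x, vbox a' b' x -> forall y, y1 ≺ y -> y ≺ y2 -> F x y].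

(** [chain_cover] makes uniform over a subbox the length [e] of an interval in the fibre, then a
    lower and an upper bound for its left end. A cut among the possible upper bounds, crossed in
    less than [e], then locates the left ends well enough for a common subinterval. *)
Lemma fiber_intervalP (V : finType) :
  sub_constant V -> chain_cover V -> fiber_interval V.
Proof.
move=> hP hQ F dF a b ab cov.
pose I x y e := forall z, ~ z ≺ y -> ~ sadd y e ≺ z -> F x z.
have dI V0 t1 t2 t3 : (forall i, pUT (V := V0) (fun k v => t1 k v i)) ->
    pUT (V := V0) t2 ->
    pUT (V := V0) t3 ->
    pUD (fun k v => I (t1 k v) (t2 k v) (t3 k v)).
  move=> h1 h2 h3.
  have dI' : UD (K := unit) (St := fun=> M) (fun=> id) (V := V + bool) (fun k w =>
      I (fun i => w (inl i)) (w (inr true)) (w (inr false))).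
    by rewrite /I; udef; refine (UD_subo (X := fun _ => F) dF _ _) => *; udef.
  refine (UD_sub2 (X := fun _ x (w : bool -> M) => I x (w true) (w false))
    (t2 := fun k v i => if i then t2 k v else t3 k v) dI' h1 _).
  by case.
have [] := hQ unit (fun t x => ozero ≺ t tt /\ exists y, I x y (t tt)) _ _ _ _ ab.
- by rewrite /pdef; udef; apply: dI => *; udef.
- have le_chain t t' : ~ t' tt ≺ t tt -> forall x, ozero ≺ t' tt /\ (exists y, I x y (t' tt)) ->
      ozero ≺ t tt -> ozero ≺ t tt /\ exists y, I x y (t tt).
    move=> tt' x [t0' [y hy]] t0; split=> //; exists y => z zy yz; apply: hy => //.
    have ? : ~ sadd y (t' tt) ≺ sadd y (t tt) by rewrite addl_ltE.
    by ord.
  move=> t t'; have [t0|t0] := pselect (ozero ≺ t tt); last by left=> x [].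
  have [t0'|t0'] := pselect (ozero ≺ t' tt); last by right=> x [].
  have [h|h] := pselect (t' tt ≺ t tt); [left|right] => x hx; apply: le_chain hx _ => //.
  by ord.
- move=> x /cov[y1 [y2 [y12 hy]]].
  have [z1 [yz1 z1y]] := exists_between y12; have [z2 [z12 z2y]] := exists_between z1y.
  have [e E] := solve_right z1 z2; exists (fun=> e); split; first by rewrite (lt_add z1) E.
  by exists z1 => z; rewrite E => ? ?; apply: hy; ord.
move=> te [a1 [b1 [ab1 s1 h1]]]; set e := te tt in h1.
have e0 : ozero ≺ e by have [x /h1[]] := box_inh ab1.
have [] := hQ unit (fun t x => exists y, ~ y ≺ t tt /\ I x y e) _ _ _ _ ab1.
- by rewrite /pdef; udef; apply: dI => *; udef.
- move=> t t'; have [h|h] := pselect (t' tt ≺ t tt); [left|right] => x [y [? ?]];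
    by exists y; split=> //; ord.
- by move=> x /h1[_ [y hy]]; exists (fun=> y), y; split=> //; apply: lt_irr.
move=> tl [a2 [b2 [ab2 s2 h2]]]; set l := tl tt in h2.
pose Z u x := exists y, ~ y ≺ l /\ (~ u ≺ y /\ I x y e).
have dZ V0 t1 t2 : (forall i, pUT (V := V0) (fun k v => t1 k v i)) ->
    pUT (V := V0) t2 ->
    pUD (fun k v => Z (t2 k v) (t1 k v)).
  move=> g1 g2; refine (UD_subo (X := fun _ x u => Z u x) _ g1 g2).
  by rewrite /Z; udef; apply: dI => *; udef.
have Zle u u' x : ~ u' ≺ u -> Z u x -> Z u' x.
  by move=> h [y [? [? ?]]]; exists y; split=> //; split=> //; ord.
have [] := hQ unit (fun t x => Z (t tt) x) _ _ _ _ ab2.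
- by apply: dZ => *; udef.
- move=> t t'; have [h|h] := pselect (t' tt ≺ t tt); [right|left] => x; apply: Zle => //; ord.
- by move=> x /h2[y [ly hy]]; exists (fun=> y), y; split=> //; split=> //; apply: lt_irr.
move=> tu [a3 [b3 [ab3 s3 h3]]].
(* [C] consists of the [u] that bound the left ends on no subbox. For [u1] in [C] and [u2] outside,
   [sub_constant] gives a subbox on which left ends lie above [u1] and not above [u2], so the fibres
   contain the interval from [u2] to [sadd u1 e]. *)
pose C := fun u => forall a' b', isbox a' b' -> bsub a3 b3 a' b' ->
  ~ forall x, vbox a' b' x -> Z u x.
have dC : pdef (fun v : unit -> M => C (v tt)).
  by rewrite /pdef /C /isbox /vbox; udef; apply: dZ => *; udef.
have [l' l'l] := exists_lt l.
have [|||u1 [u2 [Cu1 nC u21]]] :=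
  tame_nv T (C := C) (proj2 (definable1E _) dC) _ _ _ ozeroP e0.
- exists l' => a' b' ab' _ h; have [x /h[y [? [? _]]]] := box_inh ab'; ord.
- by exists (tu tt) => /(_ a3 b3 ab3 (bsub_refl _ _)); apply.
- by move=> u u' Cu u'u a' b' ab' sb h; apply: (Cu a' b' ab' sb) => x /h; apply: Zle; ord.
move: nC => /existsNP[a4] /existsNP[b4] /not_implyP[ab4] /not_implyP[s4] /contrapT h4.
have [] := hP (Z u1) _ a4 b4 ab4; first by apply: dZ => *; udef.
move=> a5 [b5 [ab5 s5 [h5|h5]]].
  by case: (Cu1 a5 b5 ab5 (bsub_trans s4 s5)).
exists a5, b5, u2, (sadd u1 e); split=> //.
  exact: bsub_trans s1 (bsub_trans s2 (bsub_trans s3 (bsub_trans s4 s5))).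
move=> x hx y uy yu; have [y0 [ly0 [uy0 hy0]]] := h4 x (vbox_bsub s5 hx).
have u1y0 : u1 ≺ y0.
  by apply: contrapT => h; apply: (h5 x hx); exists y0.
have ? : sadd u1 e ≺ sadd y0 e by rewrite addr_ltE.
by apply: hy0; ord.
Qed.

Definition fiber_box (V W : finType) := forall F : (V -> M) -> (W -> M) -> Prop,
  pdef (V := V + W) (fun w => F (fun i => w (inl i)) (fun i => w (inr i))) ->
  forall a b, isbox a b ->
  (forall x, vbox a b x -> exists u v, isbox u v /\ forall y, vbox u v y -> F x y) ->
  exists a' b' u v, [/\ isbox a' b', bsub a b a' b', isbox u v &
    forall x, vbox a' b' x -> forall y, vbox u v y -> F x y].

Lemma vbox_extend V (a b x : option V -> M) :
  vbox a b x <-> vbox (fun i => a (Some i)) (fun i => b (Some i)) (fun i => x (Some i)) /\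
    (a None ≺ x None /\ x None ≺ b None).
Proof.
split=> [h|[h h'] [i|]]; [|exact: h|exact: h'].
by split; [move=> i|]; apply: h.
Qed.

(** The germ to the right of [a None] decides each fibre near that end, and [fiber_interval] makes
    an interval common to fibres of one kind. *)
Lemma sub_constant_option (V : finType) :
  sub_constant V -> chain_cover V -> sub_constant (option V).
Proof.
move=> hP hQ X dX a b ab; have hS := fiber_intervalP hP hQ.
pose X1 (Q : Prop) x y := (a None ≺ y /\ y ≺ b None) /\ (X (extend x y) <-> Q).
have dX1 Q : pdef (V := option V) (fun w => X1 Q (fun i => w (Some i)) (w None)).
  rewrite /pdef /X1; udef.
  by apply: UD_ext dX => _ w; rewrite extendK.
have a1b1 : isbox (fun i => a (Some i)) (fun i => b (Some i)) by move=> i; apply: ab.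
have fin (Q : Prop) a' b' : isbox a' b' -> bsub (fun i => a (Some i)) (fun i => b (Some i)) a' b' ->
   (forall x, vbox a' b' x -> interval_in (X1 Q x)) ->
   exists a' b', [/\ isbox a' b', bsub a b a' b' & forall x, vbox a' b' x -> X x <-> Q].
  move=> ab' s' /(hS _ (dX1 Q) _ _ ab')[a2 [b2 [y1 [y2 [ab2 s2 y12 h]]]]].
  have [x hx] := box_inh ab2.
  have [z1 [yz1 z1y]] := exists_between y12; have [z2 [z12 z2y]] := exists_between z1y.
  have [[z1a _] _] := h x hx z1 yz1 z1y.
  have [|[_ z2b] _] := h x hx z2 _ z2y; first by ord.
  exists (extend a2 z1), (extend b2 z2); split.
  - by move=> [i|] //=; apply: ab2.
  - move=> [i|] /=; first exact: (bsub_trans s' s2).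
    by split; ord.
  - move=> w /vbox_extend[/= hw [? ?]]; rewrite -[w]extendK.
    have l1 : y1 ≺ w None by ord.
    have l2 : w None ≺ y2 by ord.
    by have [] := h _ hw (w None) l1 l2.
have [|a' [b' [ab' s' [h|h]]]] := hP (fun x => interval_in (X1 True x)) _ _ _ a1b1.
- by rewrite /pdef /interval_in; udef; refine (UD_subo (X := fun _ => X1 True) (dX1 True) _ _) => *; udef.
- have [a2 [b2 [? ? hX]]] := fin True a' b' ab' s' h; exists a2, b2; split=> //.
  by left=> x /hX ->.
- have [|a2 [b2 [? ? hX]]] := fin False a' b' ab' s'; last first.
    by exists a2, b2; split=> //; right=> x /hX ->.
  move=> x hx; have [|q [aq bq hq]] := germ_right (D := fun y => X (extend x y)) _ (ab None).
    refine (UD_sub (X := fun _ => X) (t := fun _ v => extend x (v tt)) _ dX _) => [?|[i|]] /=; udef.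
    exact: tame_inh.
  case: hq => hq; last first.
    by exists (a None), q; split=> // y ay yq; split; [split=> //; ord|split=> // /(hq y ay yq)].
  by case: (h x hx); exists (a None), q; split=> // y ay yq; split; [split=> //; ord|split=> // _; apply: hq].
Qed.

(** [chain_cover1] finds, over each point, a member whose fibre contains an interval; [chain_cover]
    for [V] fixes the member, and [fiber_interval] the interval. *)
Lemma chain_cover_option (V : finType) :
  sub_constant V -> chain_cover V -> chain_cover (option V).
Proof.
move=> hP hQ W Z dZ cZ a b ab cov; have hS := fiber_intervalP hP hQ.
pose F t x y := (a None ≺ y /\ y ≺ b None) /\ Z t (extend x y).
have dF V0 t1 t2 t3 : (forall i, pUT (V := V0) (fun k v => t1 k v i)) ->
    (forall i, pUT (V := V0) (fun k v => t2 k v i)) ->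
    pUT (V := V0) t3 ->
    pUD (fun k v => F (t1 k v) (t2 k v) (t3 k v)).
  move=> h1 h2 h3.
  refine (UD_sub3 (W3 := unit) (X := fun _ t x y => F t x (y tt)) (t3 := fun k v _ => t3 k v) _ h1 h2 (fun=> h3)).
  rewrite /F; udef.
  refine (UD_sub2 (X := fun _ => Z) (t2 := fun k w => extend _ _) dZ _ _) => [i|[i|]] /=; udef.
have a1b1 : isbox (fun i => a (Some i)) (fun i => b (Some i)) by move=> i; apply: ab.
have [] := hQ W (fun t x => interval_in (F t x)) _ _ _ _ a1b1.
- by rewrite /pdef /interval_in; udef; apply: dF => *; udef.
- by move=> t t'; case: (cZ t t') => h; [left|right] => x [y1 [y2 [y12 hy]]];
    exists y1, y2; split=> // y l1 l2; have [? ?] := hy y l1 l2; split=> //; apply: h.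
- move=> x hx; apply: (@chain_cover1 W (fun t y => Z t (extend x y))) => //.
  + refine (UD_sub2 (X := fun _ => Z) (t2 := fun k w => extend _ _) dZ _ _) => [i|[i|]] /=; udef.
  + by move=> t t'; case: (cZ t t') => h; [left|right] => y; apply: h.
  + by move=> y ay yb; apply: cov; apply/vbox_extend.
move=> t [a1 [b1 [ab1 s1 h1]]]; exists t.
have [|a2 [b2 [y1 [y2 [ab2 s2 y12 h]]]]] := hS (F t) _ _ _ ab1 h1.
  by apply: dF => *; udef.
have [x hx] := box_inh ab2.
have [z1 [yz1 z1y]] := exists_between y12; have [z2 [z12 z2y]] := exists_between z1y.
have [[z1a _] _] := h x hx z1 yz1 z1y.
have [|[_ z2b] _] := h x hx z2 _ z2y; first by ord.
exists (extend a2 z1), (extend b2 z2); split.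
- by move=> [i|] //=; apply: ab2.
- move=> [i|] /=; first exact: (bsub_trans s1 s2).
  by split; ord.
- move=> w /vbox_extend[/= hw [? ?]]; rewrite -[w]extendK.
  have l1 : y1 ≺ w None by ord.
  have l2 : w None ≺ y2 by ord.
  by have [] := h _ hw (w None) l1 l2.
Qed.

Lemma cancel_comp V V' (f : V -> V') (g : V' -> V) (x : V' -> M) : cancel g f ->
  (fun i => x (f (g i))) = x.
Proof. by move=> gf; apply: funext => i; rewrite gf. Qed.

(* Both properties are proved together: in dimension [V] they imply
   [fiber_interval V], which gives them for [option V]. *)
Lemma generic_dichotomy (V : finType) : sub_constant V /\ chain_cover V.
Proof.
elim/finType_ind: V => [|V [hP hQ]|V V' f g fg gf [hP hQ]].
- split=> [X dX a b ab|W Z dZ cZ a b ab cov].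
    exists a, b; split=> //.
    have E (x : void -> M) : x = a by apply: funext => -[].
    by have [Xa|Xa] := pselect (X a); [left|right] => x _; rewrite (E x).
  have [t Zt] : exists t, Z t a by apply: cov => -[].
  exists t, a, b; split=> // x _.
  by have -> : x = a by apply: funext => -[].
- by split; [apply: sub_constant_option|apply: chain_cover_option].
have gfx x := cancel_comp x gf; have fgx x := cancel_comp x fg.
split=> [X dX a b ab|W Z dZ cZ a b ab cov].
  have [||a' [b' [ab' s' h]]] := hP (fun x => X (fun i => x (g i))) _ (fun i => a (f i)) (fun i => b (f i)).
  - by refine (UD_sub (X := fun _ => X) (t := fun _ v i => v (g i)) _ dX _) => *; udef; apply: tame_inh.
  - by move=> i; apply: ab.
  exists (fun i => a' (g i)), (fun i => b' (g i)); split.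
  - by move=> i; apply: ab'.
  - by move=> i; have := s' (g i); rewrite gf.
  - by case: h => h; [left|right] => x hx; have := h (fun i => x (f i)); rewrite gfx; apply=> i;
      have := hx (f i); rewrite fg.
have [] := hQ W (fun t x => Z t (fun i => x (g i))) _ _ (fun i => a (f i)) (fun i => b (f i)).
- by refine (UD_sub2 (X := fun _ => Z) (t2 := fun _ v i => v (inr (g i))) dZ _ _) => *; udef.
- by move=> t t'; case: (cZ t t') => h; [left|right] => x; apply: h.
- by move=> i; apply: ab.
- by move=> x hx; apply: cov => i; have := hx (g i); rewrite gf.
move=> t [a' [b' [ab' s' h]]].
exists t, (fun i => a' (g i)), (fun i => b' (g i)); split.
- by move=> i; apply: ab'.
- by move=> i; have := s' (g i); rewrite gf.
- by move=> x hx; have := h (fun i => x (f i)); rewrite gfx; apply=> i; have := hx (f i); rewrite fg.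
Qed.

(** The coordinates of [W] are treated one at a time by [fiber_interval]; those already treated are
    added to the base. *)
Lemma generic_box (V W : finType) : fiber_box V W.
Proof.
elim/finType_ind: W => [|W IH|W W' f g fg gf IH] F dF a b ab cov.
- exists a, b, (@of_void M), (@of_void M); split=> //; first exact: bsub_refl.
  move=> x /cov[u [v [_ h]]] y _; by apply: h => -[].
- pose F1 x w := interval_in (fun y => F x (extend w y)).
  have dF1 : pdef (V := V + W) (fun w => F1 (fun i => w (inl i)) (fun i => w (inr i))).
    rewrite /pdef /F1 /interval_in; udef.
    by refine (UD_sub2 (X := fun _ => F) (t2 := fun k w => extend _ _) dF _ _) => [i|[i|]] /=; udef.
  have [|a1 [b1 [u1 [v1 [ab1 s1 uv1 h1]]]]] := IH F1 dF1 a b ab.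
    move=> x /cov[u [v [uv h]]]; exists (fun i => u (Some i)), (fun i => v (Some i)).
    split=> [i|y hy]; first exact: uv.
    by exists (u None), (v None); split=> // z ? ?; apply: h; apply/vbox_extend.
  have [hP hQ] := generic_dichotomy (V + W)%type; have hS := fiber_intervalP hP hQ.
  have [|||a2 [b2 [y1 [y2 [ab2 s2 y12 h2]]]]] := hS (fun w y => F (fun i => w (inl i))
      (extend (fun i => w (inr i)) y)) _ (join_val a1 u1) (join_val b1 v1).
  + by refine (UD_sub2 (X := fun _ => F) (t2 := fun k w => extend _ _) dF _ _) => [i|[i|]] /=; udef.
  + by move=> [i|i] /=.
  + by move=> w hw; apply: h1 => i; [have := hw (inl i)|have := hw (inr i)].
  exists (fun i => a2 (inl i)), (fun i => b2 (inl i)),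
    (extend (fun i => a2 (inr i)) y1), (extend (fun i => b2 (inr i)) y2); split.
  + by move=> i; apply: ab2.
  + by apply: bsub_trans s1 _ => i; have := s2 (inl i).
  + by move=> [i|] /=; [apply: ab2|].
  + move=> x hx y /vbox_extend[/= hy [hy1 hy2]].
    have := h2 (join_val x (fun i => y (Some i))) _ (y None) hy1 hy2.
    by rewrite /= extendK; apply=> -[i|i].
- have [||a1 [b1 [u1 [v1 [ab1 s1 uv1 h1]]]]] := IH (fun x y => F x (fun i => y (g i))) _ a b ab.
  + by refine (UD_sub2 (X := fun _ => F) (t2 := fun _ v i => v (inr (g i))) dF _ _) => *; udef.
  + move=> x /cov[u [v [uv h]]]; exists (fun i => u (f i)), (fun i => v (f i)).
    split=> [i|y hy]; first exact: uv.
    by apply: h => i; have := hy (g i); rewrite gf.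
  exists a1, b1, (fun i => u1 (g i)), (fun i => v1 (g i)); split=> // x hx y hy.
  have := h1 x hx (fun i => y (f i)); rewrite (cancel_comp y gf); apply=> i.
  by have := hy (f i); rewrite fg.
Qed.

End Generic.

(** * Chains of closed sets without points in M *)

Section Hidden1.
Context {L : language} {M : structure (og_lang L)} {T : tame M}.
Notation cM := (completion M).
Notation pUD := (UD (K := unit) (St := fun=> M) (P := M) (fun=> id)).
Notation pUT := (UT (K := unit) (St := fun=> M) (P := M) (fun=> id)).

Definition meets (R : cM -> Prop) (u v : M) := exists r, [/\ R r, pt u ≪ r & r ≪ pt v].

Lemma meets_mono R u v u' v' : ~ u ≺ u' -> ~ v' ≺ v -> meets R u v -> meets R u' v'.
Proof.
move=> uu vv [r [Rr ur rv]]; exists r; split=> //.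
  by have ? : ~ pt u ≪ pt u' by [move/pt_lt]; ord.
by have ? : ~ pt v' ≪ pt v by [move/pt_lt]; ord.
Qed.

(** [s] is the infimum of the points of [R] above [y], obtained as the supremum of the [x] for which
    the interval from [y] to [x] misses [R]. *)
Lemma sup_avoid (R : cM -> Prop) (y b : M) (x0 : M) :
  pdef (V := bool) (fun w => meets R (w true) (w false)) ->
  ~ meets R y x0 -> meets R y b ->
  exists s, [/\ ~ s ≪ pt x0, forall x, pt x ≪ s -> ~ meets R y x
    & forall x, s ≪ pt x -> meets R y x].
Proof.
move=> dR nx0 hb.
have [|||s hs] := @cut_sup _ _ T (fun x => ~ meets R y x).
- rewrite /pdef; udef.
  by refine (UD_sub (X := fun _ w => meets R (w true) (w false))
     (t := fun _ v i => if i then y else v tt) _ dR _) => [?|[|]]; [exact: tame_inh|udef|udef].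
- by exists x0.
- exists b => x; apply: contra_notP => bx; apply: meets_mono hb => //; exact: lt_irr.
exists s; split.
- move=> /cut_dense[x [sx /pt_lt xx]].
  have : pt x ≪ s by apply/hs; exists x0.
  by move=> ?; ord.
- move=> x /hs[x' nx' xx']; apply: contra_not nx'; apply: meets_mono; first exact: lt_irr.
  by move=> ?; ord.
- move=> x /cut_dense[x' [sx' /pt_lt xx']]; apply: contrapT => nx.
  have : pt x' ≪ s by apply/hs; exists x.
  by move=> ?; ord.
Qed.

Definition nearer_above (R : cM -> Prop) (y : M) := exists s z,
  [/\ ozero ≺ s, sadd z s = y, meets R y (sadd y s) & ~ meets R z y].

Lemma pdef_nearer_above R : pdef (V := bool) (fun w => meets R (w true) (w false)) ->
  pdef (fun v : unit -> M => nearer_above R (v tt)).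
Proof.
move=> dR.
have dR' V t1 t2 : pUT (V := V) t1 -> pUT (V := V) t2 ->
    pUD (fun k v => meets R (t1 k v) (t2 k v)).
  move=> h1 h2; refine (UD_sub (X := fun _ w => meets R (w true) (w false))
     (t := fun k v i => if i then t1 k v else t2 k v) _ dR _) => [?|[|]] //.
  exact: tame_inh.
have : pUD (V := unit) (fun _ v => exists s z,
  ozero ≺ s /\ sadd z s = v tt /\ meets R (v tt) (sadd (v tt) s) /\ ~ meets R z (v tt)).
  by udef; apply: dR'; udef.
by apply: UD_ext => k v; split=> [[s [z [? [? [? ?]]]]]|[s [z [? ? ? ?]]]]; exists s, z.
Qed.

(* The two kinds of points are found close to the ends of a gap of [R]. *)
Lemma gap (R : cM -> Prop) (c1 c2 : cM) :
  pdef (V := bool) (fun w => meets R (w true) (w false)) ->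
  R c1 -> R c2 -> c1 ≪ c2 ->
  (forall y, c1 ≪ pt y -> pt y ≪ c2 -> exists y1 y2, [/\ y1 ≺ y, y ≺ y2 & ~ meets R y1 y2]) ->
  exists d1 d2, [/\ c1 ≪ pt d1 /\ pt d1 ≪ c2, c1 ≪ pt d2 /\ pt d2 ≪ c2,
    nearer_above R d1 & ~ nearer_above R d2].
Proof.
move=> dR Rc1 Rc2 c12 iso.
have [y [c1y yc2]] := cut_dense c12.
have [y1 [y2 [y1y yy2 ny]]] := iso y c1y yc2.
have [b c2b] := cut_upper c2.
have [||sp [lp hp1 hp2]] := @sup_avoid R y b y2 dR.
- by apply: contra_not ny; apply: meets_mono; [move=> ?; ord|exact: lt_irr].
- by exists c2.
have spc2 : ~ c2 ≪ sp.
  by move=> /cut_dense[x [c2x /hp1]]; apply; exists c2.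
(* [d1] is chosen within [e] below the upper end [sp] of the gap and at distance at least [e] above
   [y], so that no point of [R] is as near below it. *)
have [d1 [d1i Dd1]] : exists d1, (c1 ≪ pt d1 /\ pt d1 ≪ c2) /\ nearer_above R d1.
  have [y3 [yy3 y3y2]] := exists_between yy2; have [e E] := solve_right y y3.
  have e0 : ozero ≺ e by rewrite (lt_add y) E.
  have [a [b' [asp spb b'a]]] := cut_small sp e0.
  have [a' [aa' y3a' a'E]] := exists_max a y3.
  have a'sp : pt a' ≪ sp.
    case: a'E => -> //; have /pt_lt ? := y3y2; ord.
  have /pt_lt a'b : pt a' ≪ pt b' by ord.
  have [s Es] := solve_right a' b'; have [z Ez] := solve_left s a'.
  have s0 : ozero ≺ s by rewrite (lt_add a') Es.
  have ya' : y ≺ a' by ord.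
  have /pt_lt ya2 := ya'.
  exists a'; split; first by split; ord.
  have se : s ≺ e.
    rewrite -(addl_ltE a') Es; have ? : ~ sadd a' e ≺ sadd a e by rewrite addr_ltE.
    by ord.
  have yz : y ≺ z.
    rewrite -(addr_ltE s) Ez; have : sadd y s ≺ sadd y e by rewrite addl_ltE.
    by rewrite E => ?; ord.
  exists s, z; split=> //.
    rewrite Es; have [r [Rr yr rb]] := hp2 _ spb; exists r; split=> //.
    apply: contrapT => ra; have [x [a'x xsp]] := cut_dense a'sp.
    by apply: (hp1 x xsp); exists r; split=> //; ord.
  by apply: contra_not (hp1 _ a'sp); apply: meets_mono; [move=> ?; ord|exact: lt_irr].
(* [sm] is the lower end of the gap; [d2] is chosen close above it and at least [e] below [y]. *)
have [|||sm hs] := @cut_sup _ _ T (fun x => x ≺ y /\ meets R x y).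
- rewrite /pdef; udef.
  by refine (UD_sub (X := fun _ w => meets R (w true) (w false))
     (t := fun _ v i => if i then v tt else y) _ dR _) => [?|[|]]; [exact: tame_inh|udef|udef].
- have [a ac1] := cut_lower c1; exists a; split; last by exists c1.
  by apply/pt_lt; ord.
- by exists y => x [].
have hm1 x : pt x ≪ sm -> meets R x y.
  by move=> /hs[x' [_ hx'] xx']; apply: meets_mono hx'; [move=> ?; ord|exact: lt_irr].
have hm2 x : sm ≪ pt x -> x ≺ y -> ~ meets R x y.
  move=> /cut_dense[x' [smx' /pt_lt x'x]] xy hx.
  have : pt x' ≪ sm by apply/hs; exists x.
  by move=> ?; ord.
have smy1 : ~ pt y1 ≪ sm.
  by move=> /hm1; apply: contra_not ny; apply: meets_mono; [exact: lt_irr|move=> ?; ord].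
have c1sm : ~ sm ≪ c1.
  move=> /cut_dense[x [smx xc1]]; have xy : x ≺ y by apply/pt_lt; ord.
  by apply: (hm2 x smx xy); exists c1.
have [y4 [y1y4 y4y]] := exists_between y1y; have [e E] := solve_right y4 y.
have e0 : ozero ≺ e by rewrite (lt_add y4) E.
have [a [b' [asm smb b'a]]] := cut_small sm e0.
have [d2 [d2b d2y4 d2E]] := exists_min b' y4.
have smd2 : sm ≪ pt d2.
  by case: d2E => -> //; have /pt_lt ? := y1y4; ord.
have d2y : d2 ≺ y by ord.
have /pt_lt d2y' := d2y.
exists d1, d2; split=> //; first by split; ord.
move=> [s [z [s0 Ez [r [Rr d2r rs]]]]]; apply.
have yr : ~ r ≪ pt y by move=> ry; apply: (hm2 d2) => //; exists r.
have /pt_lt yds : pt y ≪ pt (sadd d2 s) by ord.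
have es : e ≺ s.
  rewrite -(addl_ltE y4) E; have ? : ~ sadd y4 s ≺ sadd d2 s by rewrite addr_ltE.
  by ord.
have /pt_lt za : z ≺ a.
  rewrite -(addr_ltE s) Ez; have ? : sadd a e ≺ sadd a s by rewrite addl_ltE.
  by ord.
have [x [ax xsm]] := cut_dense asm; have [r' [Rr' xr' r'y]] := hm1 x xsm.
exists r'; split=> //; first by ord.
apply: contrapT => dr; have [x' [smx' x'd2]] := cut_dense smd2.
apply: (hm2 x' smx'); first by apply/pt_lt; ord.
by exists r'; split=> //; ord.
Qed.

Hypothesis wom : weakly_o_minimal M.

(** If [R] accumulated at [p] from the right, [gap] would give, arbitrarily close to [p], points
    where [nearer_above R] holds and points where it fails, against weak o-minimality. *)
Lemma isolated_right (R : cM -> Prop) (p : cM) (q0 : M) :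
  pdef (V := bool) (fun w => meets R (w true) (w false)) -> p ≪ pt q0 ->
  (forall y, p ≪ pt y -> y ≺ q0 -> exists y1 y2, [/\ y1 ≺ y, y ≺ y2 & ~ meets R y1 y2]) ->
  exists q, p ≪ pt q /\ forall r, R r -> p ≪ r -> ~ r ≪ pt q.
Proof.
move=> dR pq0 iso; apply: contrapT => nq.
have acc q : p ≪ pt q -> exists r, [/\ R r, p ≪ r & r ≪ pt q].
  by move=> pq; apply: contrapT => h; apply: nq; exists q; split=> // r ? ? ?; apply: h; exists r.
have [q pq hq] := germ_down wom (pdef_nearer_above dR) (ex_intro (fun x => p ≪ pt x) q0 pq0).
have [q1 [l1 l2 q1E]] := exists_min q q0.
have pq1 : p ≪ pt q1 by case: q1E => ->.
have [r2 [Rr2 pr2 r2q]] := acc q1 pq1; have [x [px xr2]] := cut_dense pr2.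
have [r1 [Rr1 pr1 r1x]] := acc x px.
have [||d1 [d2 [[rd1 d1r] [rd2 d2r] D1 D2]]] := gap dR Rr1 Rr2; first by ord.
  move=> y r1y yr2; apply: iso; first by ord.
  have /pt_lt ? : pt y ≪ pt q1 by ord.
  by ord.
have /pt_lt ? : pt d1 ≪ pt q1 by ord.
have /pt_lt ? : pt d2 ≪ pt q1 by ord.
case: hq => hq; first by apply/D2/hq; ord.
by apply: (hq d1) D1; ord.
Qed.

Lemma isolated_left (R : cM -> Prop) (p : cM) (q0 : M) :
  pdef (V := bool) (fun w => meets R (w true) (w false)) -> pt q0 ≪ p ->
  (forall y, q0 ≺ y -> pt y ≪ p -> exists y1 y2, [/\ y1 ≺ y, y ≺ y2 & ~ meets R y1 y2]) ->
  exists q, pt q ≪ p /\ forall r, R r -> r ≪ p -> ~ pt q ≪ r.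
Proof.
move=> dR pq0 iso; apply: contrapT => nq.
have acc q : pt q ≪ p -> exists r, [/\ R r, r ≪ p & pt q ≪ r].
  by move=> pq; apply: contrapT => h; apply: nq; exists q; split=> // r ? ? ?; apply: h; exists r.
have [q pq hq] := germ_up wom (pdef_nearer_above dR) (ex_intro (fun x => pt x ≪ p) q0 pq0).
have [q1 [l1 l2 q1E]] := exists_max q q0.
have pq1 : pt q1 ≪ p by case: q1E => ->.
have [r2 [Rr2 pr2 r2q]] := acc q1 pq1; have [x [r2x xp]] := cut_dense pr2.
have [r1 [Rr1 pr1 r1x]] := acc x xp.
have [||d1 [d2 [[rd1 d1r] [rd2 d2r] D1 D2]]] := gap dR Rr2 Rr1; first by ord.
  move=> y r1y yr2; apply: iso; last by ord.
  have /pt_lt ? : pt q1 ≪ pt y by ord.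
  by ord.
have /pt_lt ? : pt q1 ≪ pt d1 by ord.
have /pt_lt ? : pt q1 ≪ pt d2 by ord.
case: hq => hq; first by apply/D2/hq; ord.
by apply: (hq d1) D1; ord.
Qed.

(* Otherwise the first points after [a] of the sets [Kt t] form a definable set
   [R] as in [gap], and [nearer_above R] contradicts weak o-minimality. *)
Lemma hidden_chain1 (W : finType) (Kt : (W -> M) -> cM -> Prop) (a b : M) :
  pdef (V := W + bool) (fun w => meets (Kt (fun i => w (inl i))) (w (inr true)) (w (inr false))) ->
  (forall t x, ~ Kt t x -> exists u v, [/\ pt u ≪ x, x ≪ pt v & ~ meets (Kt t) u v]) ->
  chain Kt -> a ≺ b -> (forall t x, a ≺ x -> x ≺ b -> ~ Kt t (pt x)) ->
  exists u v, [/\ ~ u ≺ a, u ≺ v, ~ b ≺ v & forall t, ~ meets (Kt t) u v].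
Proof.
move=> dK clK cK ab noV; apply: contrapT => nuv.
have dense u v : ~ u ≺ a -> u ≺ v -> ~ b ≺ v -> exists t, meets (Kt t) u v.
  move=> ? ? ?; apply: contrapT => h; apply: nuv; exists u, v; split=> // t ht.
  by apply: h; exists t.
have dK' V t1 t2 t3 : (forall i, pUT (V := V) (fun k v => t1 k v i)) ->
    pUT (V := V) t2 -> pUT (V := V) t3 ->
    pUD (fun k v => meets (Kt (t1 k v)) (t2 k v) (t3 k v)).
  move=> h1 h2 h3; refine (UD_sub2 (X := fun _ t (w : bool -> M) => meets (Kt t) (w true) (w false))
     (t2 := fun k v i => if i then t2 k v else t3 k v) dK h1 _) => -[] //.
(* [a0] is interior, so that [noV] applies to it as well. *)
have [a0 [aa0 a0b]] := exists_between ab.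
pose (R := fun r : cM => (pt a0 ≪ r /\ r ≪ pt b) /\
  exists t, Kt t r /\ forall r', Kt t r' -> pt a0 ≪ r' -> ~ r' ≪ r).
(* If the member [t] has no point between [a0] and [u'] but some between [u'] and [v'], the infimum
   of its points after [a0] lies in the latter interval: it belongs to the member by closedness and
   differs from [u'] by [noV]. *)
have Rmeets t u' v' : ~ u' ≺ a0 -> ~ b ≺ v' -> ~ meets (Kt t) a0 u' -> meets (Kt t) u' v' ->
    meets R u' v'.
  move=> a0u' v'b nu hu; have h0 : meets (Kt t) a0 v'.
    by apply: meets_mono hu => //; exact: lt_irr.
  have [s [su s1 s2]] : exists s, [/\ ~ s ≪ pt u', forall x, pt x ≪ s -> ~ meets (Kt t) a0 x
      & forall x, s ≪ pt x -> meets (Kt t) a0 x].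
    by apply: sup_avoid nu h0; rewrite /pdef; apply: (dK' _ (fun _ _ => t)) => *; udef.
  have Ks : Kt t s.
    apply: contrapT => /clK[u1 [v1 [u1s sv1]]]; apply.
    have [r [Kr ar rv]] := s2 v1 sv1; exists r; split=> //.
    apply: contrapT => u1r; have [x [u1x /s1]] := cut_dense u1s; apply.
    by exists r; split=> //; ord.
  have [r0 [Kr0 ur0 rv0]] := hu.
  have sr0 : ~ r0 ≪ s.
    move=> /cut_dense[x [rx /s1]]; apply; exists r0; split=> //.
    by have ? : ~ pt u' ≪ pt a0 by [move/pt_lt]; ord.
  have us : pt u' ≪ s.
    have [//|e|//] := lt_tot (pt u') s; case: (@noV t u'); [by ord| |by rewrite e].
    by apply/pt_lt; have ? : ~ pt b ≪ pt v' by [move/pt_lt]; ord.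
  have ? : ~ pt u' ≪ pt a0 by move/pt_lt.
  have ? : ~ pt b ≪ pt v' by move/pt_lt.
  exists s; split=> //; last by ord.
  split; first by split; ord.
  exists t; split=> // r' Kr' ar' /cut_dense[x [r'x /s1]]; apply.
  by exists r'.
have dR : pdef (V := bool) (fun w => meets R (w true) (w false)).
  have : pUD (V := bool) (fun _ w => exists t u' v', (~ u' ≺ w true /\ ~ u' ≺ a0) /\
     (~ w false ≺ v' /\ ~ b ≺ v') /\ ~ meets (Kt t) a0 u' /\ meets (Kt t) u' v').
    by udef; apply: dK' => *; udef.
  apply: UD_ext => _ w; split=> [[t [u' [v' [[uu au] [[vv bv] [n h]]]]]]|].
    by apply: meets_mono (Rmeets t u' v' au bv n h).
  move=> [r [[[ar rb] [t [Kr hr]]] ur rv]].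
  have [u' [? ? u'E]] := exists_max (w true) a0; have [v' [? ? v'E]] := exists_min (w false) b.
  have u'r : pt u' ≪ r by case: u'E => ->.
  exists t, u', v'; split=> //; split=> //; split.
    by move=> [r' [Kr' ar' r'u]]; apply: (hr r') => //; ord.
  by exists r; split=> //; case: v'E => ->.
(* Each [y] of M is away from [R]: some member [t0] has a point [r0] between [a0] and [y] and misses
   a neighbourhood of [y]. Smaller members miss it too, and the first point of a larger one is at
   most [r0]. *)
have [||q [/pt_lt aq hq]] := @isolated_right R (pt a0) b dR; first exact/pt_lt.
  move=> y /pt_lt a0y yb.
  have [||t0 [r0 [Kr0 ar0 r0y]]] := dense a0 y _ a0y; [by move=> ?; ord|by move=> ?; ord|].
  have [u1 [v1 [/pt_lt u1y /pt_lt yv1 n1]]] : exists u v, [/\ pt u ≪ pt y, pt y ≪ pt v & ~ meets (Kt t0) u v].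
    by apply: clK; apply: noV => //; ord.
  have [y' [r0y' /pt_lt y'y]] := cut_dense r0y.
  have [y1 [? ? y1E]] := exists_max u1 y'.
  exists y1, v1; split=> //; first by case: y1E => ->.
  move=> [r [[[ar rb] [t [Kr hr]]] y1r rv1]].
  have ? : ~ pt y1 ≪ pt y' by move/pt_lt.
  have ? : ~ pt y1 ≪ pt u1 by move/pt_lt.
  have [h|h] := cK t0 t; first by apply: (hr r0 (h _ Kr0) ar0); ord.
  by apply: n1; exists r; split=> //; [apply: h|ord].
have [q' [? ? q'E]] := exists_min q b.
have aq' : a0 ≺ q' by case: q'E => ->.
have [||t ht] := dense a0 q' _ aq'; [by move=> ?; ord|by []|].
have n0 : ~ meets (Kt t) a0 a0 by move=> [r [_ ? ?]]; ord.
have [r [Rr ar rq]] := Rmeets t a0 q' (@lt_irr _ _ _ a0) ltac:(by []) n0 ht.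
apply: (hq r Rr ar).
by have ? : ~ pt q ≪ pt q' by [move/pt_lt]; ord.
Qed.
End Hidden1.

Section Proj.
Context {L : language} {K : Type} {St : K -> structure (og_lang L)} {P : Type}.
Context {c : forall k, P -> St k} {T : forall k, tame (St k)}.

(** The added parameters bound the last coordinate: [Some None] is the lower bound, [None] the upper
    one. *)
Definition proj (W V : finType) (F : fam (St := St) W (option V)) :
    fam (St := St) (option (option W)) V :=
  fun k t x => exists y, [/\ F k (fun i => t (Some (Some i))) (extend x y),
    ~ y ≪ pt (t (Some None)) & ~ pt (t None) ≪ y].
Arguments proj [W V] F k t x.

Lemma coded_proj (W V : finType) (F : fam (St := St) W (option V)) :
  coded (c := c) F -> coded (c := c) (proj F).
Proof.
move=> cF.
(* [cyl] leaves a dummy last coordinate, which [f] fills with the lower bound. *)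
pose f (i : option V) : V + (W + (option V + option V)) :=
  if i is Some j then inl j else inr (inr (inl None)).
pose t k (z : option (option W) -> St k) (i : W + (option V + option V)) : St k :=
  match i with inl w => z (Some (Some w)) | inr (inl _) => z (Some None)
  | inr (inr _) => z None end.
have := coded_cyl (fun i : option V => i == None) cF => /(coded_subst f) h.
have {h} := coded_param (t := t) h _ => h.
apply: coded_ext (h _) => [k z x|]; last by move=> [w|[i|i]] /=; udef.
rewrite /cyl_subst /cyl /=; split=> [[y [Fy h1 h2]]|[y [Fy h1 h2]]].
  exists (y None); have [a b] := h1 None (eqxx _); split=> //.
  suff -> : extend x (y None) = y by [].
  by apply: funext => -[i|] //=; rewrite h2.
by exists (extend x y); split=> // [[i|] //|[i|] //].
Qed.
End Proj.
Arguments proj {L K St T} [W V] F k t x.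

Section Hidden.
Context {L : language} {M : structure (og_lang L)} {T : tame M}.
Notation pUD := (UD (K := unit) (St := fun=> M) (P := M) (fun=> id)).
Notation pUT := (UT (K := unit) (St := fun=> M) (P := M) (fun=> id)).
Notation cM := (completion M).
Definition mfam (W V : Type) := (W -> M) -> (V -> cM) -> Prop.
Definition mcoded (W V : finType) (F : mfam W V) :=
  coded (K := unit) (St := fun=> M) (P := M) (c := fun=> id) (fun=> F).
Hypothesis wom : weakly_o_minimal M.

Definition ptv V (x : V -> M) : V -> cM := fun i => pt (x i).

Lemma inbox_pt V (a b x : V -> M) : inbox a b (ptv x) <-> vbox a b x.
Proof. by split=> h i; have [/pt_lt ? /pt_lt ?] := h i. Qed.

Lemma hit_pt V (F : (V -> cM) -> Prop) (x : V -> M) : hit F x x <-> F (ptv x).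
Proof.
split=> [[y Fy hy]|Fx]; last by exists (ptv x) => // i; split; apply: lt_irr.
suff -> : ptv x = y by [].
by apply: funext => i; have [? ?] := hy i; apply: le_anti.
Qed.

Definition hidden_avoid (V : finType) := forall (W : finType) (F : mfam W V),
  mcoded F -> chain F -> forall a b, isbox a b ->
  (forall t x, vbox a b x -> ~ F t (ptv x)) ->
  exists a' b', [/\ isbox a' b', bsub a b a' b' & forall t, avoid (F t) a' b'].

(** Over each point of M the fibres form a chain as in [hidden_chain1], and [generic_box] makes the
    avoided interval uniform. Projection along a closed interval inside it gives a coded chain in
    one dimension less, again without points in M. *)
Lemma hidden_avoid_option (V : finType) : hidden_avoid V -> hidden_avoid (option V).
Proof.
move=> IH W F cF ch a b ab noV.
pose (Kt := fun (x : V -> M) t (r : cM) => F t (extend (ptv x) r)).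
have a1b1 : isbox (fun i => a (Some i)) (fun i => b (Some i)) by move=> i; apply: ab.
pose (Phi := fun (x : V -> M) (w : bool -> M) => (~ w true ≺ a None /\ ~ b None ≺ w false) /\
  w true ≺ w false /\ forall t, ~ hit (F t) (extend x (w true)) (extend x (w false))).
have [||a1 [b1 [u1 [v1 [ab1 s1 uv1 h1]]]]] := @generic_box _ _ T wom V bool Phi _
  (fun i => a (Some i)) (fun i => b (Some i)) a1b1.
- rewrite /pdef /Phi; udef.
  refine (UD_hit (t := fun _ v i => v (inr i)) (u := fun _ v => extend (fun i => v (inl (inl i))) (v (inl (inr true))))
     (v := fun _ v => extend (fun i => v (inl (inl i))) (v (inl (inr false)))) cF _ _ _) => [i|[i|]|[i|]] /=; udef.
- move=> x hx.
  have [] := @hidden_chain1 _ _ T wom W (Kt x) (a None) (b None).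
  + pose f (i : option V) : unit + (W + V) := if i is Some j then inr (inr j) else inl tt.
    have cF1 : mcoded (fun (t : W + V -> M) => F (fun i => t (inl i))).
      by apply: (coded_param (t := fun k (z : W + V -> M) i => z (inl i)) cF) => i; udef.
    pose t1 := fun (w : W + bool -> M) (i : W + V) => match i with inl j => w (inl j) | inr j => x j end.
    have d : pdef (V := W + bool) (fun w => ~ avoid (cyl_subst (St := fun _ : unit => M) f
        (fun _ (t : W + V -> M) => F (fun i => t (inl i))) tt (t1 w))
        (fun=> w (inr true)) (fun=> w (inr false))).
      refine (UD_not (UD_avoid (t := fun _ => t1) (coded_subst f cF1) _ _ _)) => [[i|i]|i|i]; udef.
    apply: UD_ext d => k w.
    split=> [/existsNP[y] /not_implyP[hy /contrapT]|[r [Fr ur rv]]].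
      rewrite /cyl_subst /= => Fy; exists (y tt); have [? ?] := hy tt; split=> //.
      rewrite /Kt; have <- // : (fun i => match f i with inl j => y j | inr w0 => pt (t1 w w0) end)
         = extend (ptv x) (y tt) by apply: funext => -[].
    move=> /(_ (fun=> r)) h; apply: h; first by split.
    rewrite /cyl_subst; have -> // : (fun i => match f i with inl j => r | inr w0 => pt (t1 w w0) end)
         = extend (ptv x) r by apply: funext => -[].
  + move=> t r nK; have [u [v [huv av]]] := coded_closed cF (k := tt) (t := t) (x := extend (ptv x) r) nK.
    exists (u None), (v None); have [? ?] := huv None; split=> //.
    move=> [r' [Fr' ur rv]]; apply: (av (extend (ptv x) r')) Fr' => -[i|] //=.
  + by move=> t t'; have [h|h] := ch t t'; [left|right] => r; apply: h.
  + exact: ab.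
  + move=> t y ay yb; have := noV t (extend x y); rewrite /Kt.
    have -> : ptv (extend x y) = extend (ptv x) (pt y) by apply: funext => -[].
    by apply; apply/vbox_extend.
  move=> u [v [au uv bv hK]]; have [m [um mv]] := exists_between uv.
  exists (fun i => if i then u else m), (fun i => if i then m else v); split; first by case.
  move=> w hw; have [/= ? ?] := hw true; have [/= ? ?] := hw false.
  split; first by split; ord.
  split; first by ord.
  move=> t [y Fy hy]; apply: (hK t); exists (y None).
  have [y1 y2] := hy None; rewrite /= in y1 y2.
  have /pt_lt ? : u ≺ w true by [].
  have /pt_lt ? : w false ≺ v by [].
  split; [rewrite /Kt|by ord|by ord].
  have -> // : extend (ptv x) (y None) = y.
  by apply: funext => -[i|] //=; have [? ?] := hy (Some i); apply: le_anti.
have [w hw] := box_inh uv1; pose w0 := w true; pose w1 := w false.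
have {}h1 x : vbox a1 b1 x -> Phi x w by move=> /h1; apply.
pose (F' := fun t => proj (St := fun _ : unit => M) (fun=> F) tt (extend (extend t w0) w1)).
have cF' : mcoded F'.
  refine (coded_param (t := fun k z => extend (extend z w0) w1) (coded_proj cF) _) => [[[i|]|]] /=; udef.
have [||a2 [b2 [ab2 s2 h2]]] := IH W F' cF' _ a1 b1 ab1.
- by move=> t t'; have [h|h] := ch t t'; [left|right] => x [y [? ? ?]]; exists y; split=> //; apply: h.
- move=> t x hx [y [Fy h h']]; have [_ [_ /(_ t)]] := h1 x hx; apply.
  exists (extend (ptv x) y) => // -[i|] //=.
  by split; apply: lt_irr.
have [x hx] := box_inh ab1; have [[aw wb] [w01 _]] := h1 x hx.
exists (extend a2 w0), (extend b2 w1); split.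
- by move=> [i|] //=; apply: ab2.
- move=> [i|] /=; first exact: (bsub_trans s1 s2).
  by split.
- move=> t y hy Fy; apply: (h2 t (fun i => y (Some i))); first by move=> i; apply: (hy (Some i)).
  have [y1 y2] := hy None; rewrite /= in y1 y2.
  by exists (y None); rewrite extendK; split=> //=; ord.
Qed.

Lemma hidden_avoidP (V : finType) : hidden_avoid V.
Proof.
elim/finType_ind: V => [|V IH|V V' f g fg gf IH] W F cF ch a b ab noV.
- exists a, b; split=> // t x _ Fx; apply: (noV t a); first by case.
  by have -> : ptv a = x by apply: funext => -[].
- exact: hidden_avoid_option.
have [|||a' [b' [ab' s' h]]] := IH W _ (coded_subst (fun i => inl (g i)) cF)  _
   (fun i => a (f i)) (fun i => b (f i)).
- by move=> t t'; have [h|h] := ch t t'; [left|right] => x; apply: h.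
- by move=> i; apply: ab.
- by move=> t x hx; apply: (noV t (fun i => x (g i))) => i; have := hx (g i); rewrite gf.
exists (fun i => a' (g i)), (fun i => b' (g i)); split.
- by move=> i; apply: ab'.
- by move=> i; have := s' (g i); rewrite gf.
- move=> t x hx Fx; apply: (h t (fun i => x (f i))).
    by move=> i; have := hx (f i); rewrite fg.
  rewrite /cyl_subst; suff -> : (fun i => x (f (g i))) = x by [].
  by apply: funext => i; rewrite gf.
Qed.

Definition nowhere_dense_in V a0 b0 (A : (V -> cM) -> Prop) := forall a b, isbox a b ->
  bsub a0 b0 a b -> exists a' b', [/\ isbox a' b', bsub a b a' b' & avoid A a' b'].

Lemma UD_visible (W V : finType) (F : mfam W V) V0 t u : mcoded F ->
  (forall i, pUT (V := V0) (fun k z => t k z i)) ->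
  (forall i, pUT (V := V0) (fun k z => u k z i)) ->
  pUD (fun k z => F (t k z) (ptv (u k z))).
Proof.
move=> cF ht hu; apply: UD_ext (UD_hit cF ht hu hu) => k v; exact: hit_pt.
Qed.

(** On a subbox either all points of M are covered or none is. In the first case [chain_cover] would
    put a box into one member; in the second [hidden_avoidP] applies. *)
Lemma nowhere_dense_chain (W V : finType) (F : mfam W V) a0 b0 : mcoded F -> chain F ->
  (forall t a b, isbox a b -> bsub a0 b0 a b -> ~ forall x, vbox a b x -> F t (ptv x)) ->
  nowhere_dense_in a0 b0 (fun x => exists t, F t x).
Proof.
move=> cF ch noI a b ab s0; have [hP hQ] := generic_dichotomy wom V.
have [|a1 [b1 [ab1 s1 [h|h]]]] := hP (fun x => exists t, F t (ptv x)) _ a b ab.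
- by rewrite /pdef; udef; refine (UD_visible cF _ _) => i; udef.
- have [||t [a2 [b2 [ab2 s2 h2]]]] := hQ W (fun t x => F t (ptv x)) _ _ _ _ ab1 h.
  + by refine (UD_visible cF _ _) => i; udef.
  + by move=> t t'; have [h'|h'] := ch t t'; [left|right] => x; apply: h'.
  by case: (noI t a2 b2 ab2 (bsub_trans s0 (bsub_trans s1 s2))).
have [|a2 [b2 [ab2 s2 h2]]] := hidden_avoidP cF ch ab1.
  by move=> t x hx Fx; apply: (h x hx); exists t.
exists a2, b2; split=> //; first exact: bsub_trans s1 s2.
by move=> x hx [t]; apply: h2.
Qed.

Lemma avoid_box V (A : (V -> cM) -> Prop) a b : avoid A a b ->
  forall a' b', isbox a' b' -> bsub a b a' b' -> ~ forall x, vbox a' b' x -> A (ptv x).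
Proof.
move=> av a' b' ab' s h; have [x hx] := box_inh ab'.
by apply: (avoid_bsub s av) (h x hx); apply/inbox_pt.
Qed.

(** The closures of the unions over the second parameter are nowhere dense and form a chain in the
    first parameter, so the one-parameter case applies twice. *)
Lemma nowhere_dense_chain2 (W W' V : finType) (F : mfam (W + W') V) a0 b0 : mcoded F ->
  (forall t, chain (fun t' => F (join_val t t'))) ->
  (forall t1 t2, (forall t' x, F (join_val t1 t') x -> F (join_val t2 t') x) \/
    (forall t' x, F (join_val t2 t') x -> F (join_val t1 t') x)) ->
  (forall t a b, isbox a b -> bsub a0 b0 a b -> ~ forall x, vbox a b x -> F t (ptv x)) ->
  nowhere_dense_in a0 b0 (fun x => exists t, F t x).
Proof.
move=> cF ch1 ch2 noI.
have joinE (w : W + W' -> M) : w = join_val (fun i => w (inl i)) (fun i => w (inr i)).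
  by apply: funext => -[].
have cU := coded_union_closure cF.
have h : nowhere_dense_in a0 b0 (fun x => exists t, union_closure (fun=> F) tt t x).
  apply: nowhere_dense_chain => // [t1 t2|t a b ab s].
    have [h|h] := ch2 t1 t2; [left|right] => x hx u v huv hav; apply: (hx u v huv) => t' y hy Fy;
      by apply: (hav t' y hy); apply: h.
  have cFt : mcoded (fun (t' : W' -> M) => F (join_val t t')).
    by refine (coded_param (t := fun k t' => join_val t t') cF _) => -[i|i] /=; udef.
  have [//|a' [b' [ab' s' h']]] := nowhere_dense_chain (a0 := a0) (b0 := b0) cFt (ch1 t) _ ab s.
    by move=> t' a1 b1; apply: noI.
  have av : avoid (union_closure (fun=> F) tt t) a' b'.
    by apply/avoid_union_closure => t' x hx Fx; apply: (h' x hx); exists t'.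
  move=> hx; apply: (avoid_box av ab' (bsub_refl _ _)) => x hx'.
  exact/hx/(vbox_bsub s' hx').
move=> a b ab s; have [a' [b' [ab' s' hav]]] := h a b ab s.
exists a', b'; split=> // x hx [t Ft].
apply: (hav x hx); exists (fun i => t (inl i)) => u v huv /(_ (fun i => t (inr i)) x huv).
by rewrite -joinE.
Qed.
End Hidden.

(** * Dimension *)

Section Dimension.
Context {L : language} {M : structure (og_lang L)} {T : tame M}.
Notation cM := (completion M).
Notation pUD := (UD (K := unit) (St := fun=> M) (P := M) (fun=> id)).
Notation pUT := (UT (K := unit) (St := fun=> M) (P := M) (fun=> id)).
Hypothesis wom : weakly_o_minimal M.

Definition cbox V (u v : V -> M) (e : V -> cM) :=
  forall i, ~ e i ≪ pt (u i) /\ ~ pt (v i) ≪ e i.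

(* The properties that dimension theory needs, common to the coded closed sets
   and to the closures of definable sets inside M. *)
Definition good (V : finType) (F : (V -> cM) -> Prop) :=
  pdef (V := V + V) (fun w => hit F (fun i => w (inl i)) (fun i => w (inr i))) /\
  forall u v j q1 q2 y,
    (forall e, F e -> cbox u v e -> forall z, q1 ≺ z -> z ≺ q2 -> e j <> pt z) ->
    q1 ≺ y -> y ≺ q2 -> exists y1 y2, [/\ y1 ≺ y, y ≺ y2 &
      forall e, F e -> cbox u v e -> ~ (pt y1 ≪ e j /\ e j ≪ pt y2)].

Definition upd (V : eqType) S (j : V) (z : S) (u : V -> S) (i : V) := if i == j then z else u i.

Lemma cbox_upd (V : eqType) (u v : V -> M) j y e : cbox (upd j y u) (upd j y v) e <->
  e j = pt y /\ forall i, i != j -> ~ e i ≪ pt (u i) /\ ~ pt (v i) ≪ e i.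
Proof.
split=> [h|[h h'] i]; last first.
  rewrite /upd; case: eqP => [->|/eqP ij]; last exact: h'.
  by rewrite h; split; apply: lt_irr.
split; last by move=> i /negPf ij; have := h i; rewrite /upd ij.
by have := h j; rewrite /upd eqxx => -[? ?]; apply: le_anti.
Qed.

(** The second property is the tube lemma at the slice where coordinate [j] equals [y], which
    contains no point of [F] in the closed box. *)
Lemma good_coded (W V : finType) (F : mfam W V) t : mcoded F -> good (F t).
Proof.
move=> cF; split.
  by refine (UD_hit (t := fun _ _ => t) cF _ _ _) => i; udef.
move=> u v j q1 q2 y noz q1y yq2.
have [y0 y0y] := exists_lt y; have [y3 yy3] := exists_gt y.
have [yu|uy] := pselect (y ≺ u j).
  exists y0, (u j); split=> // e _ he [_ ?].
  by have [? _] := he j; ord.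
have [vy|yv] := pselect (v j ≺ y).
  exists (v j), y3; split=> // e _ he [? _].
  by have [_ ?] := he j; ord.
have [uv|uv] := pselect (forall i, ~ v i ≺ u i); last first.
  exists y0, y3; split=> // e _ he _; apply: uv => i /pt_lt ?.
  by have [? ?] := he i; ord.
have [||p [q [h1 _ av]]] := closed_box_hit (u := upd j y u) (v := upd j y v)
    (coded_pdef (k := tt) t cF) (coded_closed cF (k := tt) (t := t)) (J := predT) (x := ptv u).
- move=> i _; rewrite /upd; case: eqP => // _; exact: lt_irr.
- move=> e he _ Fe; have /cbox_upd[ej hi] : cbox (upd j y u) (upd j y v) e.
    by move=> i; apply: he.
  apply: (noz e Fe _ y q1y yq2 ej) => i.
  have [->|ij] := eqVneq i j; last exact: hi.
  by rewrite ej; split; move/pt_lt.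
exists (p j), (q j); have [|pj qj] := h1 j; first by [].
rewrite /upd eqxx in pj qj; split=> // e Fe he [pe eq].
apply: (av e) Fe => i; have [->|ij] := eqVneq i j; first by [].
have [//|] := h1 i; rewrite /upd (negPf ij) => /pt_lt ? /pt_lt ?.
by have [? ?] := he i; split; ord.
Qed.

Lemma good_visible (V : finType) (X : (V -> M) -> Prop) : pdef X ->
  good (fun e => exists2 x, X x & e = ptv x).
Proof.
move=> dX; split.
  have : pUD (V := V + V) (fun _ w => exists x, X x /\ forall i, ~ x i ≺ w (inl i) /\ ~ w (inr i) ≺ x i).
    by udef; refine (UD_sub (X := fun _ => X) _ dX _) => *; [exact: tame_inh|udef].
  apply: UD_ext => _ w; split=> [[x [Xx hx]]|[_ [x Xx ->] hx]].
    exists (ptv x); first by exists x.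
    by move=> i; have [? ?] := hx i; split; move/pt_lt.
  by exists x; split=> // i; have [h1 h2] := hx i; split=> /pt_lt.
move=> u v j q1 q2 y noz q1y yq2; exists q1, q2; split=> // _ [x Xx ->] he [/pt_lt ? /pt_lt ?].
by apply: (noz (ptv x) _ he (x j)) => //; exists x.
Qed.

Definition projects (V : finType) (I : {set V}) (F : (V -> cM) -> Prop) (x : V -> M) :=
  exists e, F e /\ forall i, i \in I -> e i = pt (x i).

Definition full_on (V : finType) (I : {set V}) (F : (V -> cM) -> Prop) :=
  exists a b, isbox a b /\ forall x, vbox a b x -> projects I F x.

Lemma UD_hit2 (V : finType) (F : (V -> cM) -> Prop) V0 u v : good F ->
  (forall i, pUT (V := V0) (fun k w => u k w i)) ->
  (forall i, pUT (V := V0) (fun k w => v k w i)) ->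
  pUD (fun k w => hit F (u k w) (v k w)).
Proof. by move=> [dF _]; apply: (UD_sub2 (X := fun _ => hit F)). Qed.

(** A box degenerate in the coordinates of [I] turns the quantifier over points of the completion
    into [hit], which is definable. *)
Lemma projectsE (V : finType) (I : {set V}) (F : (V -> cM) -> Prop) x :
  projects I F x <-> exists u v, (forall i, i \in I -> u i = x i /\ v i = x i) /\ hit F u v.
Proof.
split=> [[e [Fe he]]|[u [v [uv [e Fe he]]]]].
  have [u [v huv]] := exists_inbox e.
  exists (fun i => if i \in I then x i else u i), (fun i => if i \in I then x i else v i).
  split=> [i ->//|]; exists e => // i; case: ifP => [iI|_].
    by rewrite he //; split; apply: lt_irr.
  by have [? ?] := huv i; split; ord.
exists e; split=> // i iI; have [] := he i; have [-> ->] := uv i iI.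
by move=> *; apply: le_anti.
Qed.

Lemma UD_projects (V : finType) (I : {set V}) (F : (V -> cM) -> Prop) V0 x : good F ->
  (forall i, pUT (V := V0) (fun k w => x k w i)) ->
  pUD (fun k w => projects I F (x k w)).
Proof.
move=> gF hx.
have dP : pdef (V := V) (fun w => projects I F w).
  have : pUD (V := V) (fun _ w => exists u v, (forall i, i \in I -> u i = w i /\ v i = w i) /\ hit F u v).
    by udef; apply: UD_hit2 => // i; udef.
  by apply: UD_ext => _ w; rewrite projectsE.
by refine (UD_sub (X := fun _ => projects I F) _ dP hx) => _; exact: tame_inh.
Qed.

Lemma full_extend (V : finType) (I : {set V}) (j : V) (F : (V -> cM) -> Prop) a b : j \notin I ->
  good F -> isbox a b ->
  (forall x, vbox a b x -> interval_in (fun y => projects (j |: I) F (upd j y x))) ->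
  full_on (j |: I) F.
Proof.
move=> jI gF ab h; have [hP hQ] := generic_dichotomy wom V.
have [|a1 [b1 [y1 [y2 [ab1 s1 y12 h1]]]]] := fiber_intervalP hP hQ
  (F := fun x y => projects (j |: I) F (upd j y x)) _ ab h.
  by refine (UD_projects (x := fun _ w => upd j (w None) (fun i => w (Some i))) _ gF _) => i;
    rewrite /upd; case: (i == j); udef.
exists (upd j y1 a1), (upd j y2 b1); split=> [i|x hx].
  by rewrite /upd; case: eqP.
have [m [am mb]] := exists_between (ab1 j).
have := h1 (upd j m x) _ (x j); have := hx j; rewrite /upd eqxx => -[xj1 xj2].
have -> : (fun i => if i == j then x j else if i == j then m else x i) = x.
  by apply: funext => i; case: eqP => // ->.
apply=> // i; have := hx i; rewrite /upd; case: eqP => [->|//].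
by [].
Qed.

(** Intervals in all fibres over a subbox would make [F] full on [j |: I] by [full_extend];
    [sub_constant] then excludes them on a smaller box, for one [j] at a time. *)
Lemma no_fiber_interval (V : finType) (I : {set V}) (F : (V -> cM) -> Prop) (s : seq V) a b :
  good F -> (forall j, j \notin I -> ~ full_on (j |: I) F) -> isbox a b ->
  exists a' b', [/\ isbox a' b', bsub a b a' b' & forall x, vbox a' b' x -> forall j, j \in s ->
    j \notin I -> ~ interval_in (fun y => projects (j |: I) F (upd j y x))].
Proof.
move=> gF nf; elim: s a b => [|j s IH] a b ab.
  by exists a, b; split=> //; exact: bsub_refl.
have [a1 [b1 [ab1 s1 h1]]] := IH a b ab.
have [jI|jI] := boolP (j \in I).
  exists a1, b1; split=> // x hx i; rewrite inE => /orP[/eqP->|/(h1 x hx i)//].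
  by rewrite jI.
have [hP _] := generic_dichotomy wom V.
have [|a2 [b2 [ab2 s2 [h2|h2]]]] := hP (fun x => interval_in (fun y => projects (j |: I) F (upd j y x))) _ a1 b1 ab1.
- rewrite /pdef /interval_in; udef.
  by refine (UD_projects (x := fun _ w => upd j (w None) (fun i => w (Some (Some (Some i))))) _ gF _) => i;
    rewrite /upd; case: (i == j); udef.
- by case: (nf j jI); apply: full_extend ab2 h2.
exists a2, b2; split=> //; first exact: bsub_trans s1 s2.
move=> x hx i; rewrite inE => /orP[/eqP->//|is_]; first by move=> _; apply: h2.
exact: h1 (vbox_bsub s2 hx) i is_.
Qed.

(** The values [R] of coordinate [j] fill no interval of M, so by weak o-minimality none of them is
    in M close to [e j] on either side. By [good] the points of M close to [e j] are then isolated
    from [R], and [isolated_right] and [isolated_left] keep [R] away from [e j]. *)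
Lemma isolate_coordinate (V : finType) (I : {set V}) (F : (V -> cM) -> Prop) x u0 v0 e j :
  good F -> j \notin I -> F e ->
  (forall i, i \in I -> u0 i = x i /\ v0 i = x i) ->
  ~ interval_in (fun y => projects (j |: I) F (upd j y x)) ->
  cbox u0 v0 e -> pt (u0 j) ≪ e j -> e j ≪ pt (v0 j) ->
  exists u v, [/\ ~ u ≺ u0 j, ~ v0 j ≺ v, pt u ≪ e j, e j ≪ pt v &
    forall e', F e' -> cbox u0 v0 e' -> ~ e' j ≪ pt u -> ~ pt v ≪ e' j -> e' j = e j].
Proof.
move=> gF jI Fe uvI noint he ue ev.
pose (R := fun r : cM => exists e', [/\ F e', cbox u0 v0 e' & e' j = r]).
have dR : pdef (V := bool) (fun w => meets R (w true) (w false)).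
  have : pUD (V := bool) (fun _ w => exists u v, (forall i, ~ u i ≺ u0 i /\ ~ v0 i ≺ v i) /\
      w true ≺ u j /\ v j ≺ w false /\ hit F u v).
    by udef; apply: UD_hit2 => // i; udef.
  apply: UD_ext => _ w; split=> [[u [v [uv [/pt_lt wu [/pt_lt vw [e' Fe' he']]]]]]|].
    have [? ?] := he' j; exists (e' j); split; [exists e'; split=> // i| ord|ord].
    have [? ?] := uv i; have [? ?] := he' i.
    have ? : ~ pt (u i) ≪ pt (u0 i) by move/pt_lt.
    have ? : ~ pt (v0 i) ≪ pt (v i) by move/pt_lt.
    by split; ord.
  move=> [_ [[e' [Fe' he' <-]] we ew]].
  have [w1 [/pt_lt ww1 w1e]] := cut_dense we; have [w2 [ew2 /pt_lt w2w]] := cut_dense ew.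
  have [u [? ? uE]] := exists_max w1 (u0 j); have [v [? ? vE]] := exists_min w2 (v0 j).
  exists (upd j u u0), (upd j v v0); split; last split; last split.
  - by move=> i; rewrite /upd; case: eqP => [->|_]; split=> //; apply: lt_irr.
  - by rewrite /upd eqxx; ord.
  - by rewrite /upd eqxx; ord.
  exists e' => // i; rewrite /upd; case: eqP => [->|_]; last exact: he'.
  by have [? ?] := he' j; split; [case: uE => ->|case: vE => ->] => //; ord.
pose (D := fun y => R (pt y)).
have dD : pdef (fun w : unit -> M => D (w tt)).
  have : pUD (V := unit) (fun _ w => (~ w tt ≺ u0 j /\ ~ v0 j ≺ w tt) /\
     hit F (upd j (w tt) u0) (upd j (w tt) v0)).
    by udef; apply: UD_hit2 => // i; rewrite /upd; case: (i == j); udef.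
  apply: UD_ext => _ w; split=> [[[? ?] [e' Fe' /cbox_upd[e'j hi]]]|[e' [Fe' he' e'j]]].
    exists e'; split=> // i; have [->|ij] := eqVneq i j; last exact: hi.
    by rewrite e'j; split; move/pt_lt.
  split; first by have := he' j; rewrite e'j => -[h1 h2]; split=> /pt_lt.
  by exists e' => //; apply/cbox_upd; split.
have Dint y1 y2 : y1 ≺ y2 -> ~ forall y, y1 ≺ y -> y ≺ y2 -> D y.
  move=> y12 h; apply: noint; exists y1, y2; split=> // y l1 l2.
  have [e' [Fe' he' e'j]] := h y l1 l2; exists e'; split=> // i.
  rewrite /upd !inE; case: eqP => [->//|_ /= iI].
  by have := he' i; have [-> ->] := uvI i iI => -[? ?]; apply: le_anti.
have local q1 q2 y : (forall z, q1 ≺ z -> z ≺ q2 -> ~ D z) -> q1 ≺ y -> y ≺ q2 ->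
    exists y1 y2, [/\ y1 ≺ y, y ≺ y2 & ~ meets R y1 y2].
  move=> nD q1y yq2; have [_ /(_ u0 v0 j q1 q2 y)] := gF; case=> //.
    by move=> e' Fe' he' z z1 z2 e'z; apply: (nD z z1 z2); exists e'.
  move=> y1 [y2 [? ? h]]; exists y1, y2; split=> // -[_ [[e' [Fe' he' <-]] ? ?]].
  exact: (h e' Fe' he').
have [v [ev' hv]] : exists q, e j ≪ pt q /\ forall r, R r -> e j ≪ r -> ~ r ≪ pt q.
  have [q eq hq] := germ_down wom dD (ex_intro (fun y => e j ≪ pt y) (v0 j) ev).
  case: hq => hq.
    have [y1 [ey1 /pt_lt y1q]] := cut_dense eq.
    case: (Dint y1 q y1q) => y /pt_lt y1y yq; apply: hq; ord.
  apply: (isolated_right wom dR eq) => y ey yq.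
  have [q1 [eq1 /pt_lt q1y]] := cut_dense ey.
  apply: (@local q1 q) => // z /pt_lt z1 z2; apply: hq; ord.
have [u [ue' hu]] : exists q, pt q ≪ e j /\ forall r, R r -> r ≪ e j -> ~ pt q ≪ r.
  have [q eq hq] := germ_up wom dD (ex_intro (fun y => pt y ≪ e j) (u0 j) ue).
  case: hq => hq.
    have [y1 [/pt_lt qy1 y1e]] := cut_dense eq.
    case: (Dint q y1 qy1) => y qy /pt_lt yy1; apply: hq; ord.
  apply: (isolated_left wom dR eq) => y qy ye.
  have [q1 [/pt_lt yq1 q1e]] := cut_dense ye.
  apply: (@local q q1) => // z z2 /pt_lt z1; apply: hq; ord.
have [u1 [uu1 u1e]] := cut_dense ue'; have [v1 [ev1 v1v]] := cut_dense ev'.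
have [u2 [? ? u2E]] := exists_max u1 (u0 j); have [v2 [? ? v2E]] := exists_min v1 (v0 j).
have ? : ~ pt u2 ≪ pt u1 by move/pt_lt.
have ? : ~ pt v1 ≪ pt v2 by move/pt_lt.
exists u2, v2; split=> //; first by case: u2E => ->.
  by case: v2E => ->.
move=> e' Fe' he' ue2 ve2; have Re' : R (e' j) by exists e'.
have [h|//|h] := lt_tot (e' j) (e j); first by case: (hu _ Re' h); ord.
by case: (hv _ Re' h); ord.
Qed.

(** Over the box, the part of [F] between [u] and [v] is the graph of a function of the coordinates
    in [I], and this graph lies in [F']. *)
Definition isolated_sheet (V : finType) (I : {set V}) (F F' : (V -> cM) -> Prop) a b u v :=
  isbox a b /\ forall x, vbox a b x -> exists e, [/\ F' e, forall i, i \in I -> e i = pt (x i),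
    forall j, j \notin I -> pt (u j) ≪ e j /\ e j ≪ pt (v j) &
    forall e', F e' -> (forall i, i \in I -> e' i = pt (x i)) ->
      (forall j, j \notin I -> ~ e' j ≪ pt (u j) /\ ~ pt (v j) ≪ e' j) -> e' = e].

(** Since [F] is full on no larger set [j |: I], a point of [F'] over a generic [x] is isolated in
    each remaining coordinate; [generic_box] makes the isolating bounds independent of [x]. *)
Lemma isolated_sheetP (V : finType) (I : {set V}) (F F' : (V -> cM) -> Prop) :
  good F -> good F' -> (forall e, F' e -> F e) ->
  (forall j, j \notin I -> ~ full_on (j |: I) F) -> full_on I F' ->
  exists a b u v, isolated_sheet I F F' a b u v.
Proof.
move=> gF gF' F'F nf [a [b [ab hF']]].
have [a1 [b1 [ab1 s1 h1]]] := no_fiber_interval (enum V) gF nf ab.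
pose (inI := fun x (u u' : V -> M) => (forall i, i \in I -> u i = x i /\ u' i = x i)).
(* [Psi] says, in terms of boxes, that some point of [F'] over [x] lies strictly between the bounds
   [w], and that no two points of [F] over [x] between them differ in a coordinate outside [I]. *)
pose (Psi := fun (x : V -> M) (w : V + V -> M) =>
  (exists u v, inI x u v /\ (forall j, j \notin I -> w (inl j) ≺ u j /\ v j ≺ w (inr j)) /\ hit F' u v) /\
  ~ exists u v u' v', inI x u v /\ inI x u' v' /\
    (forall j, j \notin I -> (~ u j ≺ w (inl j) /\ ~ w (inr j) ≺ v j) /\
       (~ u' j ≺ w (inl j) /\ ~ w (inr j) ≺ v' j)) /\
    hit F u v /\ hit F u' v' /\ exists j, j \notin I /\ v j ≺ u' j).
have [||a2 [b2 [uu [vv [ab2 s2 uv2 h2]]]]] := @generic_box _ _ T wom V (V + V)%type Psi _ a1 b1 ab1.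
- rewrite /pdef /Psi /inI; udef; apply: UD_hit2 => // i; udef.
- move=> x hx; have [e [F'e eI]] := hF' x (vbox_bsub s1 hx).
  have Fe := F'F _ F'e.
  have [ul [vl huv]] := exists_inbox e.
  pose u0 := fun i => if i \in I then x i else ul i.
  pose v0 := fun i => if i \in I then x i else vl i.
  have uvI i : i \in I -> u0 i = x i /\ v0 i = x i by rewrite /u0 /v0 => ->.
  have he : cbox u0 v0 e.
    move=> i; rewrite /u0 /v0; case: ifP => iI; first by rewrite eI //; split; apply: lt_irr.
    by have [? ?] := huv i; split; ord.
  (* Two pairs of bounds for each coordinate: the outer pair isolates, the inner one still surrounds
     [e j], and bounds chosen between the two pairs are admissible. *)
  have /choice[f hf] : forall j, exists p : (M * M) * (M * M), j \notin I ->
    [/\ ~ p.1.1 ≺ u0 j /\ ~ v0 j ≺ p.1.2, p.1.1 ≺ p.2.1 /\ p.2.2 ≺ p.1.2,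
        pt p.2.1 ≪ e j /\ e j ≪ pt p.2.2 &
    forall e', F e' -> cbox u0 v0 e' -> ~ e' j ≪ pt p.1.1 -> ~ pt p.1.2 ≪ e' j -> e' j = e j].
    move=> j; have [jI|jI] := boolP (j \in I); first by exists ((x j, x j), (x j, x j)).
    have [|||u [v [? ? ue ev hj]]] := isolate_coordinate gF jI Fe uvI _ he.
    - by apply: h1 => //; rewrite mem_enum.
    - by rewrite /u0 (negPf jI); have [] := huv j.
    - by rewrite /v0 (negPf jI); have [] := huv j.
    have [u' [/pt_lt uu' u'e]] := cut_dense ue; have [v' [ev' /pt_lt v'v]] := cut_dense ev.
    by exists ((u, v), (u', v')).
  exists (fun w => match w with
     | inl j => if j \in I then a1 j else (f j).1.1
     | inr j => if j \in I then a1 j else (f j).2.2 end),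
   (fun w => match w with
     | inl j => if j \in I then b1 j else (f j).2.1
     | inr j => if j \in I then b1 j else (f j).1.2 end).
  split; first by move=> [j|j]; case: ifP => [_|/negbT/hf[_ [? ?] [? ?] _]].
  move=> w hw; have hwl j : j \notin I -> [/\ (f j).1.1 ≺ w (inl j), w (inl j) ≺ (f j).2.1,
      (f j).2.2 ≺ w (inr j) & w (inr j) ≺ (f j).1.2].
    by move=> /negPf jI; have := hw (inl j); have := hw (inr j); rewrite jI => -[? ?] [? ?].
  split.
    exists (fun j => if j \in I then x j else (f j).2.1), (fun j => if j \in I then x j else (f j).2.2).
    split; first by move=> i ->.
    split; first by move=> j jI; rewrite (negPf jI); have [] := hwl j jI.
    exists e => // j; case: ifP => jI; first by rewrite eI //; split; apply: lt_irr.
    by have [_ _ [? ?] _] := hf j (negbT jI); split; ord.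
  move=> [u [v [u' [v' [xuv [xuv' [hw' [[e1 Fe1 he1] [[e2 Fe2 he2] [j [jI /pt_lt vu]]]]]]]]]]].
  have key e' p q : F e' -> cbox p q e' -> inI x p q ->
      (forall j, j \notin I -> ~ p j ≺ w (inl j) /\ ~ w (inr j) ≺ q j) -> e' j = e j.
    move=> Fe' he' xpq hpq.
    have loc i : i \notin I -> ~ e' i ≪ pt (w (inl i)) /\ ~ pt (w (inr i)) ≪ e' i.
      move=> iI; have [? ?] := hpq i iI; have [? ?] := he' i.
      have ? : ~ pt (p i) ≪ pt (w (inl i)) by move/pt_lt.
      have ? : ~ pt (w (inr i)) ≪ pt (q i) by move/pt_lt.
      by split; ord.
    have [_ _ _ hj] := hf j jI; apply: hj => //.
    - move=> i; have [iI|iI] := boolP (i \in I).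
        by have := he' i; have [-> ->] := xpq i iI; have [-> ->] := uvI i iI.
      have [? ?] := loc i iI; have [/pt_lt ? _ _ /pt_lt ?] := hwl i iI.
      have [[? ?] _ _ _] := hf i iI.
      have ? : ~ pt (f i).1.1 ≪ pt (u0 i) by move/pt_lt.
      have ? : ~ pt (v0 i) ≪ pt (f i).1.2 by move/pt_lt.
      by split; ord.
    - by have [? ?] := loc j jI; have [/pt_lt ? _ _ /pt_lt ?] := hwl j jI; ord.
    - by have [? ?] := loc j jI; have [/pt_lt ? _ _ /pt_lt ?] := hwl j jI; ord.
  have E1 : e1 j = e j by apply: (key e1 u v) => // i /hw'[].
  have E2 : e2 j = e j by apply: (key e2 u' v') => // i /hw'[].
  have := he1 j; have := he2 j; rewrite E1 E2 => -[? _] [_ ?].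
  by ord.
have [w hw] := box_inh uv2.
exists a2, b2, (fun j => w (inl j)), (fun j => w (inr j)); split=> // x hx.
have [[u [v [xuv [huv [e F'e he]]]]] nE] := h2 x hx w hw.
have eI i : i \in I -> e i = pt (x i).
  by move=> iI; have := he i; have [-> ->] := xuv i iI => -[? ?]; apply: le_anti.
have ein j : j \notin I -> pt (w (inl j)) ≪ e j /\ e j ≪ pt (w (inr j)).
  by move=> jI; have [/pt_lt ? /pt_lt ?] := huv j jI; have [? ?] := he j; split; ord.
exists e; split=> // e' Fe' e'I e'J.
have sep e1 e2 j : F e1 -> F e2 -> (forall i, i \in I -> e1 i = pt (x i)) ->
    (forall i, i \in I -> e2 i = pt (x i)) ->
    (forall j, j \notin I -> ~ e1 j ≪ pt (w (inl j)) /\ ~ pt (w (inr j)) ≪ e1 j) ->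
    (forall j, j \notin I -> ~ e2 j ≪ pt (w (inl j)) /\ ~ pt (w (inr j)) ≪ e2 j) ->
    ~ e1 j ≪ e2 j.
  move=> F1 F2 I1 I2 J1 J2 e12.
  have jI : j \notin I by apply/negP => jI; move: e12; rewrite I1 // I2 // => ?; ord.
  have [z1 [ez1 z1e]] := cut_dense e12; have [z2 [/pt_lt z12 z2e]] := cut_dense z1e.
  pose lo := fun i => if i \in I then x i else w (inl i).
  pose hi := fun i => if i \in I then x i else w (inr i).
  have [? ?] := J1 j jI; have [? ?] := J2 j jI.
  have ? : ~ w (inr j) ≺ z1 by move=> /pt_lt ?; ord.
  have ? : ~ z2 ≺ w (inl j) by move=> /pt_lt ?; move: z12 => /pt_lt ?; ord.
  have loI i : i \in I -> lo i = x i by rewrite /lo => ->.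
  have hiI i : i \in I -> hi i = x i by rewrite /hi => ->.
  have updI i z r : i \in I -> upd j z r i = r i.
    by move=> iI; rewrite /upd; case: eqP => // ij; rewrite -ij iI in jI.
  apply: nE; exists lo, (upd j z1 hi), (upd j z2 lo), hi; split; [|split; [|split; [|split; [|split]]]].
  - by move=> i iI; rewrite updI ?loI ?hiI.
  - by move=> i iI; rewrite updI ?loI ?hiI.
  - move=> i iI; rewrite /upd /lo /hi (negPf iI).
    by case: eqP => [->|_]; split; split=> //; apply: lt_irr.
  - exists e1 => // i; rewrite /upd /lo /hi; have [->|ij] := eqVneq i j.
      by rewrite (negPf jI); split=> //; ord.
    case: ifP => [iI|/negbT/J1//]; rewrite I1 //; split; apply: lt_irr.
  - exists e2 => // i; rewrite /upd /lo /hi; have [->|ij] := eqVneq i j.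
      by rewrite (negPf jI); split=> //; ord.
    case: ifP => [iI|/negbT/J2//]; rewrite I2 //; split; apply: lt_irr.
  - by exists j; split=> //; rewrite /upd !eqxx.
have einJ j : j \notin I -> ~ e j ≪ pt (w (inl j)) /\ ~ pt (w (inr j)) ≪ e j.
  by move=> /ein[? ?]; split; ord.
by apply: funext => j; apply: le_anti; apply: sep => //; apply: F'F.
Qed.

(* The dimension of [F] is the largest size of a set of coordinates on which the
   projection of [F] contains a box of M. *)
Definition dim_lt (V : finType) n (F : (V -> cM) -> Prop) :=
  forall I : {set V}, n <= #|I| -> ~ full_on I F.

Lemma dim_lt_card (V : finType) (F : (V -> cM) -> Prop) : dim_lt (#|V|).+1 F.
Proof. by move=> I; rewrite ltnNge max_card. Qed.

(** Being full on the empty set of coordinates just means being nonempty. *)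
Lemma dim_lt0 (V : finType) (F : (V -> cM) -> Prop) e : dim_lt 0 F -> ~ F e.
Proof.
move=> h Fe; apply: (h finset.set0) => //.
have [u [v huv]] := exists_inbox e; exists u, v; split; first exact: inbox_lt huv.
by move=> x _; exists e; split=> // i; rewrite inE.
Qed.

(** A coordinate set of size [n] on which [F'] is full cannot be enlarged for [F], so
    [isolated_sheetP] would give a sheet. *)
Lemma dim_drop (V : finType) n (F F' : (V -> cM) -> Prop) :
  good F -> good F' -> (forall e, F' e -> F e) ->
  (forall I a b u v, ~ isolated_sheet I F F' a b u v) ->
  dim_lt n.+1 F -> dim_lt n F'.
Proof.
move=> gF gF' F'F ns dF I; rewrite leq_eqVlt => /orP[/eqP nI|nI]; last first.
  by move=> [a [b [ab h]]]; apply: (dF I nI); exists a, b; split=> // x /h[e [/F'F ? ?]]; exists e.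
move=> fI; have [|a [b [u [v]]]] := isolated_sheetP gF gF' F'F _ fI; last exact: ns.
by move=> j jI; apply: dF; rewrite cardsU1 jI -nI.
Qed.
End Dimension.

(** * Iterated frontiers of definable sets *)

Definition vclosure L (M : structure (og_lang L)) V (X : (V -> M) -> Prop) (x : V -> M) :=
  forall u v, vbox u v x -> exists y, X y /\ vbox u v y.

Definition vfrontier L (M : structure (og_lang L)) V (X : (V -> M) -> Prop) (x : V -> M) :=
  vclosure X x /\ ~ X x.

Lemma UD_vbox L K (St : K -> structure (og_lang L)) P (c : forall k, P -> St k) V (W : finType) u v x :
  (forall i : W, UT c (V := V) (fun k w => u k w i)) ->
  (forall i : W, UT c (V := V) (fun k w => v k w i)) ->
  (forall i : W, UT c (V := V) (fun k w => x k w i)) ->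
  UD c (fun k w => vbox (u k w) (v k w) (x k w)).
Proof. by move=> hu hv hx; apply: UD_conj => i; udef. Qed.

Lemma UD_vclosure L K (St : K -> structure (og_lang L)) P (c : forall k, P -> St k)
  {T : forall k, tame (St k)} (V : finType) (X : forall k, (V -> St k) -> Prop) :
  UD c X -> UD c (fun k => vclosure (X k)).
Proof.
move=> dX; rewrite /vclosure; udef.
- by refine (UD_vbox _ _ _) => i; udef.
- by refine (UD_sub (X := X) _ dX _) => *; [exact: tame_inh|udef].
- by refine (UD_vbox _ _ _) => i; udef.
Qed.

Lemma UD_iter_frontier L K (St : K -> structure (og_lang L)) P (c : forall k, P -> St k)
  {T : forall k, tame (St k)} (V : finType) (X : forall k, (V -> St k) -> Prop) n :
  UD c X -> UD c (fun k => iter n (@vfrontier L (St k) V) (X k)).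
Proof.
move=> dX; elim: n => [//|n IH] /=.
by apply: UD_and; [apply: (UD_vclosure IH)|apply: UD_not].
Qed.

Section Frontier.
Context {L : language} {M : structure (og_lang L)} {T : tame M}.
Notation cM := (completion M).
Hypothesis wom : weakly_o_minimal M.

Lemma vclosure_incl V (X : (V -> M) -> Prop) x : X x -> vclosure X x.
Proof. by move=> Xx u v h; exists x. Qed.

Lemma vclosure_idem V (X : (V -> M) -> Prop) x : vclosure (vclosure X) x -> vclosure X x.
Proof. by move=> h u v /h[y [hy /hy]]. Qed.

Definition visible V (X : (V -> M) -> Prop) (e : V -> cM) := exists2 x, X x & e = ptv x.

Lemma ptv_inj V : injective (@ptv _ _ T V).
Proof. by move=> x y e; apply: funext => i; apply: (@pt_inj _ _ T); have := f_equal (@^~ i) e. Qed.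

(** On a subbox, the sheet over [x] always carries a point of [X] or never does. In the first case a
    frontier point on the sheet would, by uniqueness, belong to [X]; in the second the sheet would
    not be in the closure of [X]. *)
Lemma visible_sheet (V : finType) (I : {set V}) (X : (V -> M) -> Prop) : pdef X ->
  forall a b u v, ~ isolated_sheet I (visible (vclosure X)) (visible (vclosure (vfrontier X))) a b u v.
Proof.
move=> dX a b u v [ab sheet].
have [hP _] := generic_dichotomy wom V.
pose Q x := exists y, X y /\ forall i, (i \in I -> y i = x i) /\ (i \notin I -> u i ≺ y i /\ y i ≺ v i).
have [|a1 [b1 [ab1 s1 h1]]] := hP Q _ a b ab.
  by rewrite /pdef /Q; udef; refine (UD_sub (X := fun _ => X) _ dX _) => *; [exact: tame_inh|udef].
have [x hx] := box_inh ab1.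
have [_ [[p hp ->] pI pJ _]] := sheet x (vbox_bsub s1 hx).
pose A i := if i \in I then a1 i else u i; pose B i := if i \in I then b1 i else v i.
have hpB : vbox A B p.
  move=> i; rewrite /A /B; case: ifP => [iI|/negbT/pJ[/pt_lt ? /pt_lt ?]//].
  have -> : p i = x i by apply: (@pt_inj _ _ T); apply: pI.
  exact: hx.
have slice z : vbox A B z -> let x' := fun i => if i \in I then z i else x i in
    [/\ vbox a1 b1 x', forall i, i \in I -> z i = x' i & forall i, i \notin I -> u i ≺ z i /\ z i ≺ v i].
  move=> hz; split=> [i|i -> //|i iI]; last by have := hz i; rewrite /A /B (negPf iI).
  by have := hz i; rewrite /A /B; case: ifP => // _; apply: hx.
have uniq x' z : vbox a1 b1 x' -> vclosure X z -> (forall i, i \in I -> z i = x' i) ->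
    (forall i, i \notin I -> u i ≺ z i /\ z i ≺ v i) ->
    forall y, vclosure X y -> (forall i, i \in I -> y i = x' i) ->
    (forall i, i \notin I -> u i ≺ y i /\ y i ≺ v i) -> y = z.
  move=> hx' hz zI zJ y hy yI yJ.
  have [e [_ _ _ eu]] := sheet x' (vbox_bsub s1 hx').
  have key w : vclosure X w -> (forall i, i \in I -> w i = x' i) ->
      (forall i, i \notin I -> u i ≺ w i /\ w i ≺ v i) -> ptv w = e.
    move=> hw wI wJ; apply: eu; first by exists w.
      by move=> i iI; rewrite /ptv wI.
    by move=> j /wJ[? ?]; split; move/pt_lt => ?; ord.
  by apply: (@ptv_inj V); rewrite (key y) // (key z).
case: h1 => h1.
  have [z [[hz nz] hzB]] := hp A B hpB; have [hx' zI zJ] := slice z hzB.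
  have [y [Xy hy]] := h1 _ hx'.
  have yz : y = z.
    apply: (uniq _ _ hx' hz zI zJ); first exact: vclosure_incl.
      by move=> i iI; rewrite (proj1 (hy i)).
    by move=> i iI; exact: (proj2 (hy i)).
  by apply: nz; rewrite -yz.
have hp' : vclosure X p.
  by apply: vclosure_idem => u' v' /hp[y [[? _] ?]]; exists y.
have [z [Xz hzB]] := hp' A B hpB; have [hx' zI zJ] := slice z hzB.
by apply: (h1 _ hx'); exists z; split=> // i; split; [apply: zI|apply: zJ].
Qed.

Lemma pdef_iter_frontier (V : finType) (X : (V -> M) -> Prop) n : pdef X ->
  pdef (iter n (@vfrontier _ M V) X).
Proof. exact: (@UD_iter_frontier _ _ (fun _ : unit => M) _ (fun=> id) (fun=> T) V (fun=> X) n). Qed.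

(** Each step lowers the dimension, which at the start is at most the number of coordinates; one
    more step empties the set. *)
Lemma iter_frontier_empty (V : finType) (X : (V -> M) -> Prop) : pdef X ->
  forall x, ~ iter (#|V|).+1 (@vfrontier _ M V) X x.
Proof.
move=> dX.
have h n : n <= (#|V|).+1 -> dim_lt ((#|V|).+1 - n) (visible (vclosure (iter n (@vfrontier _ M V) X))).
  elim: n => [_|n IH nV]; first by rewrite subn0; apply: dim_lt_card.
  have dn := pdef_iter_frontier n dX.
  have gd (Y : (V -> M) -> Prop) : pdef Y -> good (visible (vclosure Y)).
    by move=> dY; apply: good_visible; exact: (@UD_vclosure _ _ (fun _ : unit => M) _ (fun=> id) (fun=> T) V (fun=> Y) dY).
  rewrite subSS; apply: (dim_drop wom (gd _ dn) (gd _ (pdef_iter_frontier n.+1 dX))).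
  - move=> e [x hx ->]; exists x => //.
    by apply: vclosure_idem => u v /hx[y [[? _] ?]]; exists y.
  - by move=> I a b u v; apply: visible_sheet.
  - by rewrite -subSn //; apply: IH; apply: ltnW.
move=> x Xx; have := h _ (leqnn _); rewrite subnn => /dim_lt0; apply.
by exists x; first exact: vclosure_incl.
Qed.
End Frontier.

(** * Projections of constructible sets *)

Section SheetDrop.
Context {L : language} {M : structure (og_lang L)} {T : tame M}.
Notation pUD := (UD (K := unit) (St := fun=> M) (P := M) (fun=> id)).
Notation pUT := (UT (K := unit) (St := fun=> M) (P := M) (fun=> id)).
Notation cM := (completion M).
Notation mfam := (mfam (M := M)).
Hypothesis wom : weakly_o_minimal M.

(** On a subbox of points of M, the sheet is always in the union of the members of [A] or never. In
    the first case [chain_cover] makes the member uniform. The results on chains extend each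
    alternative to the points of the completion, where it contradicts the hypothesis on [F']. *)
Lemma coded_sheet (W W' V : finType) (F : (V -> cM) -> Prop) (A : mfam (W + W') V)
    (F' : (V -> cM) -> Prop) (I : {set V}) :
  mcoded (fun _ : void -> M => F) -> mcoded A ->
  (forall t, chain (fun t' => A (join_val t t'))) ->
  (forall t1 t2, (forall t' x, A (join_val t1 t') x -> A (join_val t2 t') x) \/
    (forall t' x, A (join_val t2 t') x -> A (join_val t1 t') x)) ->
  (forall e u v, F' e -> inbox u v e ->
     ~ (exists t, forall y, inbox u v y -> F y -> A t y) /\
     ~ (forall y, inbox u v y -> F y -> forall t, ~ A t y)) ->
  forall a b u v, ~ isolated_sheet I F F' a b u v.
Proof.
move=> cF cA ch1 ch2 hF' a b u v [ab sheet].
have joinE (w : W + W' -> M) : w = join_val (fun i => w (inl i)) (fun i => w (inr i)).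
  by apply: funext => -[].
have [hP hQ] := generic_dichotomy wom V.
have cF2 (W0 : finType) : mcoded (fun _ : W0 -> M => F).
  by refine (coded_param (t := fun k z => @of_void M) cF _) => -[].
pose (onsheet := fun (x : V -> M) (e : V -> cM) => [/\ F e, forall i, i \in I -> e i = pt (x i) &
   forall j, j \notin I -> ~ e j ≪ pt (u j) /\ ~ pt (v j) ≪ e j]).
have uniq x e e' : vbox a b x -> onsheet x e -> onsheet x e' -> e = e'.
  move=> /sheet[e0 [_ _ _ h]] [Fe eI eJ] [Fe' eI' eJ'].
  by rewrite (h e) // (h e').
have sheetP x : vbox a b x -> exists e, [/\ F' e, onsheet x e &
    forall j, j \notin I -> pt (u j) ≪ e j /\ e j ≪ pt (v j)].
  move=> hx; have [e [F'e eI eJ h]] := sheet x hx; exists e; split=> //.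
  (* A point of [F'] outside the closed set [F] would have a neighbourhood in which [F] is empty,
     hence disjoint from all members. *)
  have Fe : F e.
    apply: contrapT => nF; have [p [q hpq]] := exists_inbox e.
    have [p' [q' [hpq' av]]] := coded_closed cF (k := tt) (t := @of_void M) nF.
    have [_ []] := hF' e p' q' F'e hpq'.
    by move=> y hy Fy; case: (av y hy).
  by split=> // j /eJ[? ?]; split; ord.
pose mixl (x : V -> M) i := if i \in I then x i else u i.
pose mixr (x : V -> M) i := if i \in I then x i else v i.
have mixP x e : F e /\ (forall i, ~ e i ≪ pt (mixl x i) /\ ~ pt (mixr x i) ≪ e i) <-> onsheet x e.
  split=> [[Fe h]|[Fe eI eJ]]; last first.
    split=> // i; rewrite /mixl /mixr; case: ifP => [iI|/negbT/eJ//].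
    by rewrite eI //; split; apply: lt_irr.
  split=> // [i iI|j /negPf jI].
    by have := h i; rewrite /mixl /mixr iI => -[? ?]; apply: le_anti.
  by have := h j; rewrite /mixl /mixr jI.
have UDmix V0 (x : unit -> (V0 -> M) -> V -> M) : (forall i, pUT (V := V0) (fun k w => x k w i)) ->
    (forall i, pUT (V := V0) (fun k w => mixl (x k w) i)) /\
    (forall i, pUT (V := V0) (fun k w => mixr (x k w) i)).
  by move=> hx; split=> i; rewrite /mixl /mixr; case: (i \in I) => //; udef.
pose (Q := fun t x => hit (fun e => F e /\ A t e) (mixl x) (mixr x)).
have QP t x : Q t x <-> exists2 e, onsheet x e & A t e.
  split=> [[e [Fe Ae] he]|[e he Ae]]; first by exists e => //; apply/mixP.
  by have [? ?] := proj2 (mixP x e) he; exists e.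
have cFA : mcoded (fun t e => F e /\ A t e) by apply: coded_and; [exact: cF2|].
have dQ V0 (t : unit -> (V0 -> M) -> W + W' -> M) x :
   (forall i, pUT (V := V0) (fun k w => t k w i)) ->
   (forall i, pUT (V := V0) (fun k w => x k w i)) ->
   pUD (V := V0) (fun k w => Q (t k w) (x k w)).
  by move=> ht hx; have [h1 h2] := UDmix _ _ hx; exact: (UD_hit cFA ht h1 h2).
pose lo (a' : V -> M) i := if i \in I then a' i else u i.
pose hi (b' : V -> M) i := if i \in I then b' i else v i.
have slice a' b' e : isbox a' b' -> bsub a b a' b' -> inbox (lo a') (hi b') e -> F e ->
    exists2 c : V -> cM, inbox a' b' c & forall i, i \in I -> e i = c i.
  move=> ab' s he Fe; have [m hm] := box_inh ab'.
  exists (fun i => if i \in I then e i else pt (m i)) => [i|i ->//].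
  have := he i; rewrite /lo /hi; case: ifP => // _ _.
  by have [/pt_lt ? /pt_lt ?] := hm i.
have inB a' b' x e : vbox a' b' x -> onsheet x e ->
   (forall j, j \notin I -> pt (u j) ≪ e j /\ e j ≪ pt (v j)) -> inbox (lo a') (hi b') e.
  move=> hx [_ eI _] eJ i; rewrite /lo /hi; case: ifP => [iI|/negbT/eJ//].
  by rewrite eI //; have [/pt_lt ? /pt_lt ?] := hx i.
have [|a1 [b1 [ab1 s1 [h1|h1]]]] := hP (fun x => exists t, Q t x) _ a b ab.
- by rewrite /pdef; udef; apply: dQ => i; udef.
- have [|||t1 [a2 [b2 [ab2 s2 h2]]]] := hQ W (fun t x => exists t', Q (join_val t t') x) _ _ a1 b1 ab1.
  + by rewrite /pdef; udef; apply: dQ => [[i|i]|i] /=; udef.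
  + by move=> t t'; have [h|h] := ch2 t t'; [left|right] => x [t2 /QP[e he Ae]]; exists t2;
      apply/QP; exists e => //; apply: h.
  + by move=> x /h1[t]; rewrite (joinE t) => h; exists (fun i => t (inl i)), (fun i => t (inr i)).
  have [||t2 [a3 [b3 [ab3 s3 h3]]]] := hQ W' (fun t' x => Q (join_val t1 t') x) _ _ a2 b2 ab2 h2.
  + by apply: dQ => [[i|i]|i] /=; udef.
  + by move=> t t'; have [h|h] := ch1 t1 t t'; [left|right] => x /QP[e he Ae];
      apply/QP; exists e => //; apply: h.
  set t := join_val t1 t2 in h3.
  have s03 : bsub a b a3 b3 by exact: bsub_trans s1 (bsub_trans s2 s3).
  have onA x e : vbox a3 b3 x -> onsheet x e -> A t e.
    move=> hx he; have /QP[e' he' Ae'] := h3 x hx.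
    by rewrite (uniq x e e' (vbox_bsub s03 hx) he he').
  (* The part of [F] outside the member [t] is exhausted by the closed sets [S]. Their projections
     [H] form a chain without points in M over the box, since there the sheet lies in the member. *)
  pose (S := fun (w : option (W + W') -> M) e => F e /\ shrink (St := fun _ : unit => M) (fun=> A) tt w e).
  have cS' : mcoded S by apply: coded_and; [exact: cF2|exact: (coded_shrink cA)].
  pose (H := fun (w : unit -> M) => cyl (St := fun _ : unit => M) [pred i | i \notin I] (fun=> S) tt
     (join_val (extend t (w tt)) (join_val u v))).
  have cH : mcoded H.
    refine (coded_param (t := fun k w => join_val (extend t (w tt)) (join_val u v))
      (coded_cyl _ cS') _) => [[[i|]|[i|i]]] /=; udef.
  have [||a4 [b4 [ab4 s4 h4]]] := hidden_avoidP wom cH _ ab3.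
  + move=> w w'; have [e0|e0] := pselect (ozero ≺ w tt); last by left=> x [e [[_ [? _]]]].
    have [e0'|e0'] := pselect (ozero ≺ w' tt); last by right=> x [e [[_ [? _]]]].
    have [le|le] := pselect (w tt ≺ w' tt); [right|left] => x [e [[Fe he] eJ eI]];
      exists e; split=> //; split=> //; apply: shrink_mono he => //; ord.
  + move=> w x hx [e [[Fe he] eJ eI]]; apply: (shrink_disj he).
    have he' : onsheet x e.
      by split=> [//|i iI|j jI]; [rewrite eI // inE iI|exact: (eJ j jI)].
    exact: onA hx he'.
  have [x hx] := box_inh ab4.
  have [e [F'e he eJ]] := sheetP x (vbox_bsub (bsub_trans s03 s4) hx).
  have [nB _] := hF' e (lo a4) (hi b4) F'e (inB _ _ _ _ hx he eJ).
  apply: nB; exists t => y hy Fy; apply: contrapT => nA.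
  have [eps heps] := shrink_cover (k := tt) cA nA.
  have [c hc yc] := slice a4 b4 y ab4 (bsub_trans s03 s4) hy Fy.
  apply: (h4 (fun=> eps) c hc); exists y; split=> // i; rewrite inE.
    by move=> /negPf iI; have := hy i; rewrite /lo /hi iI /= => -[? ?]; split; ord.
  by rewrite negbK; apply: yc.
(* In the second case the parts of the sheet in the members have projections without points in M
   over the subbox. *)
pose (H := fun (w : W + W' -> M) => cyl (St := fun _ : unit => M) [pred i | i \notin I]
   (fun _ t e => F e /\ A t e) tt (join_val w (join_val u v))).
have cH : mcoded H.
  refine (coded_param (t := fun k w => join_val w (join_val u v))
    (coded_cyl _ cFA) _) => [[[i|i]|[i|i]]] /=; udef.
have [|||a2 [b2 [ab2 s2 h2]]] := nowhere_dense_chain2 wom (a0 := a1) (b0 := b1) cH _ _ _ ab1 (bsub_refl _ _).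
- move=> w t t'; have [h|h] := ch1 w t t'; [left|right] => x [e [[Fe Ae] eJ eI]];
    by exists e; split=> //; split=> //; apply: h.
- move=> t t'; have [h|h] := ch2 t t'; [left|right] => w x [e [[Fe Ae] eJ eI]];
    by exists e; split=> //; split=> //; apply: h.
- move=> t a' b' ab' s' h; have [x hx] := box_inh ab'.
  have [e [[Fe Ae] eJ eI]] := h x hx; apply: (h1 x (vbox_bsub s' hx)).
  exists t; apply/QP; exists e => //.
  by split=> [//|i iI|j jI]; [rewrite eI // inE iI|exact: (eJ j jI)].
have s02 : bsub a b a2 b2 by exact: bsub_trans s1 s2.
have [x hx] := box_inh ab2.
have [e [F'e he eJ]] := sheetP x (vbox_bsub s02 hx).
have [_ nB] := hF' e (lo a2) (hi b2) F'e (inB _ _ _ _ hx he eJ).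
apply: nB => y hy Fy t Ay.
have [c hc yc] := slice a2 b2 y ab2 s02 hy Fy.
apply: (h2 c hc); exists t, y; split=> // i; rewrite inE.
  by move=> /negPf iI; have := hy i; rewrite /lo /hi iI /= => -[? ?]; split; ord.
by rewrite negbK; apply: yc.
Qed.
End SheetDrop.

Lemma void_fun T (t t' : void -> T) : t = t'.
Proof. by apply: funext; case. Qed.

(** * Stratification of the union of an increasing family *)

Section Stratification.
Context {L : language} {K : Type} {St : K -> structure (og_lang L)} {P : Type}.
Context {c : forall k, P -> St k} {T : forall k, tame (St k)}.
Notation UD := (UD c).
Notation UT := (UT c).
Notation coded := (coded (c := c)).
Notation fam := (fam (St := St)).
Variable k0 : K.
Hypothesis wom : weakly_o_minimal (St k0).
Hypothesis transfer : forall X : forall k, (void -> St k) -> Prop, UD X ->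
  X k0 (@of_void _) -> forall k, X k (@of_void _).

Lemma coded_at (W V : finType) (F : fam W V) k : coded F -> mcoded (F k).
Proof.
move=> [dF cF]; split; last by move=> _; apply: cF.
exact: (UD_pdef k dF).
Qed.

Variables (W W' V : finType) (A : fam (W + W') V).
Arguments A : clear implicits.
Hypothesis cA : coded A.
Hypothesis chain1 : forall k t, chain (fun t' => A k (join_val t t')).
Hypothesis chain2 : forall k t1 t2,
  (forall t' x, A k (join_val t1 t') x -> A k (join_val t2 t') x) \/
  (forall t' x, A k (join_val t2 t') x -> A k (join_val t1 t') x).

(** Inclusion of [F] in the closed set [A k s] on the box, expressed by avoiding boxes so as to be
    definable. *)
Definition inside k (F : (V -> completion (St k)) -> Prop) u v :=
  exists s, forall u' v', bsub u v u' v' -> avoid (A k s) u' v' -> avoid F u' v'.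

Definition outside k (F : (V -> completion (St k)) -> Prop) u v :=
  forall s, avoid (fun x => F x /\ A k s x) u v.

Lemma insideP k (F : (V -> completion (St k)) -> Prop) u v :
  inside F u v <-> exists s, forall x, inbox u v x -> F x -> A k s x.
Proof.
split=> -[s h]; exists s.
  move=> x hx Fx; apply: contrapT => /(coded_closed cA)[p [q [hpq av]]].
  have [a [b [hab s1 s2]]] := inboxI hx hpq.
  by apply: (h a b s1 _ x hab Fx); apply: avoid_bsub av.
by move=> u' v' b av x /[dup] hx /(inbox_bsub b) hx' Fx; apply: (av x hx); apply: h.
Qed.

(* Locally outside [leftover F], the union of the sets [A k s] is a difference of
   two closed sets; the dimension of [leftover F] is smaller than that of [F]. *)
Definition leftover (F : fam void V) : fam void V := fun k t x =>
  F k t x /\ forall u v, inbox u v x -> ~ (inside (F k t) u v \/ outside (F k t) u v).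

(** [F] minus [outer F] is the part near which [F] lies in a member of the family. *)
Definition outer (F : fam void V) : fam void V := fun k t x =>
  F k t x /\ forall u v, inbox u v x -> ~ inside (F k t) u v.

Arguments leftover : clear implicits.
Arguments outer : clear implicits.

Lemma UD_inside (F : fam void V) : coded F -> UD (V := void + (V + V))
  (fun k w => inside (F k (fun i => w (inl i))) (fun i => w (inr (inl i))) (fun i => w (inr (inr i)))).
Proof.
move=> cF; rewrite /inside; udef; last by refine (UD_avoid cF _ _ _) => i; udef.
by refine (UD_avoid cA _ _ _) => i; udef.
Qed.

Lemma coded_outer F : coded F -> coded (outer F).
Proof. by move=> cF; apply: coded_and => //; apply: coded_code; apply: UD_inside. Qed.

Lemma coded_leftover F : coded F -> coded (leftover F).
Proof.
move=> cF; apply: coded_and => //; apply: coded_code; apply: UD_or; first exact: UD_inside.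
have cFA : coded (fun k (t : void + (W + W') -> St k) x =>
    F k (fun i => t (inl i)) x /\ A k (fun i => t (inr i)) x).
  by apply: coded_and; apply: coded_param => // i; udef.
rewrite /outside; udef.
refine (UD_avoid (t := fun k (z : (void + (V + V)) + (W + W') -> St k) =>
  join_val (fun i => z (inl (inl i))) (fun i => z (inr i))) cFA _ _ _) => [[i|i]|i|i] //=; udef.
Qed.

Fixpoint strata n : fam void V :=
  if n is n'.+1 then leftover (strata n') else fun _ _ _ => True.

Arguments strata : clear implicits.

Lemma coded_strata n : coded (strata n).
Proof. by elim: n => [|n IH] /=; [apply/coded_cond/UD_const|apply: coded_leftover]. Qed.

(** [coded_sheet] excludes isolated sheets of a stratum inside the next one. *)
Lemma strata_dim n t : n <= (#|V|).+1 -> dim_lt ((#|V|).+1 - n) (strata n k0 t).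
Proof.
elim: n => [|n IH] nV; first by rewrite subn0; apply: dim_lt_card.
have cn m := coded_at k0 (coded_strata m).
apply: (dim_drop wom (good_coded t (cn n)) (good_coded t (cn n.+1))) => [e [] //||].
  move=> I a b u v; apply: (coded_sheet (T := T k0) wom (A := A k0) _ (coded_at k0 cA)) => //.
    have -> : (fun _ : void -> St k0 => strata n k0 t) = strata n k0 by
      apply: funext => t'; rewrite (void_fun t' t).
    exact: cn.
  move=> e p q [_ he] hpq; split=> [[s h]|h]; apply: (he p q hpq); [left|right].
    by apply/insideP; exists s.
  by move=> s x hx [Fx]; apply: h.
by rewrite -subSn // subSS; apply: IH; apply: ltnW.
Qed.

(** Weak o-minimality is assumed at [k0], where the last stratum is empty for reasons of dimension.
    This emptiness is a sentence and reaches the other structures by [transfer]. *)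
Lemma strata_empty k t x : ~ strata (#|V|).+1 k t x.
Proof.
have h : forall u v, avoid (strata (#|V|).+1 k (@of_void _)) u v.
  pose (X := fun k (t : void -> St k) => forall u v, avoid (T := T k) (strata (#|V|).+1 k t) u v).
  refine (transfer (X := X) _ _ k); rewrite /X.
    udef.
    by refine (UD_avoid (coded_strata (#|V|).+1) _ _ _) => i; udef.
  move=> u v y _; apply: dim_lt0.
  by have := @strata_dim (#|V|).+1 (@of_void _) (leqnn _); rewrite subnn.
have [u [v huv]] := exists_inbox x.
by rewrite (void_fun t (@of_void _)); apply: h huv.
Qed.

(** A point of [A k s] leaves the strata at some step. Near it the last stratum containing it is
    inside a member or disjoint from all of them, and the point itself rules out the latter. *)
Lemma union_strata k t x :
  (exists s, A k s x) <-> exists i : 'I_(#|V|).+1, strata i k t x /\ ~ outer (strata i) k t x.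
Proof.
split=> [[s As]|[i [Fx]]]; last first.
  move=> /not_andP[//|/existsNP[u /existsNP[v]]] /not_implyP[hx /contrapT/insideP[s h]].
  by exists s; apply: h.
have [n nV [Fx nFx]] : exists2 n, n < (#|V|).+1 & strata n k t x /\ ~ strata n.+1 k t x.
  apply: contrapT => h; apply: (@strata_empty k t x).
  have : forall n, n <= (#|V|).+1 -> strata n k t x; last by apply.
  elim=> // n IH nV; apply: contrapT => nF; apply: h.
  by exists n => //; split=> //; apply: IH; apply: ltnW.
exists (Ordinal nV); split=> //= -[_ ho]; apply: nFx; split=> // u v hx [|].
  exact: ho.
by move=> /(_ s x hx); apply.
Qed.
End Stratification.

(** * Constructible sets *)

Section Constructible.
Context {L : language} {K : Type} {St : K -> structure (og_lang L)} {P : Type}.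
Context {c : forall k, P -> St k} {T : forall k, tame (St k)}.
Notation UD := (UD c).
Notation UT := (UT c).
Notation coded := (coded (c := c)).
Notation fam := (fam (St := St)).

(* The dummy parameters in [void] allow the use of the operations on families. *)
Inductive constructible (V : finType) : fam void V -> Prop :=
| constructible0 : constructible (fun _ _ _ => False)
| constructibleU (F F' X : fam void V) : coded F -> coded F' -> constructible X ->
    constructible (fun k t x => (F k t x /\ ~ F' k t x) \/ X k t x).

Lemma constructible_ext (V : finType) (X Y : fam void V) :
  (forall k t x, X k t x <-> Y k t x) -> constructible X -> constructible Y.
Proof.
move=> E cX; suff <- : X = Y by [].
by apply: functional_extensionality_dep => k; apply: funext => t; apply: funext => x;
  apply: propext; rewrite E.
Qed.

Lemma coded_True (V : finType) : coded (fun _ (_ : void -> _) (_ : V -> _) => True).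
Proof. by apply: (coded_cond V (Q := fun _ _ => True)); apply: UD_const. Qed.

Lemma coded_False (V : finType) : coded (fun _ (_ : void -> _) (_ : V -> _) => False).
Proof. by apply: (coded_cond V (Q := fun _ _ => False)); apply: UD_const. Qed.

Lemma constructible_diff (V : finType) (F F' : fam void V) : coded F -> coded F' ->
  constructible (fun k t x => F k t x /\ ~ F' k t x).
Proof.
move=> cF cF'; apply: constructible_ext (constructibleU cF cF' (constructible0 V)).
by move=> k t x; split=> [[//|[]]|]; left.
Qed.

Lemma constructible_coded (V : finType) (F : fam void V) : coded F -> constructible F.
Proof.
move=> cF; apply: constructible_ext (constructible_diff cF (coded_False V)).
by move=> k t x; tauto.
Qed.

Lemma constructible_or (V : finType) (X Y : fam void V) :
  constructible X -> constructible Y -> constructible (fun k t x => X k t x \/ Y k t x).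
Proof.
move=> cX cY; elim: cX => [|F F' X' cF cF' _ IH].
  by apply: constructible_ext cY => k t x; split=> [|[]//]; right.
by apply: constructible_ext (constructibleU cF cF' IH) => k t x; tauto.
Qed.

Lemma constructible_and (V : finType) (X Y : fam void V) :
  constructible X -> constructible Y -> constructible (fun k t x => X k t x /\ Y k t x).
Proof.
move=> cX cY; elim: cX => [|F F' X' cF cF' _ IH].
  by apply: constructible_ext (constructible0 V) => k t x; tauto.
have h : constructible (fun k t x => (F k t x /\ ~ F' k t x) /\ Y k t x).
  elim: cY => [|G G' Y' cG cG' _ IH'].
    by apply: constructible_ext (constructible0 V) => k t x; tauto.
  apply: constructible_ext (constructibleU (coded_and cF cG) (coded_or cF' cG') IH').
  by move=> k t x; tauto.
by apply: constructible_ext (constructible_or h IH) => k t x; tauto.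
Qed.

Lemma constructible_not (V : finType) (X : fam void V) :
  constructible X -> constructible (fun k t x => ~ X k t x).
Proof.
elim=> [|F F' X' cF cF' _ IH].
  by apply: constructible_ext (constructible_coded (coded_True V)) => k t x; tauto.
have h := constructible_or (constructible_diff (coded_True V) cF) (constructible_coded cF').
apply: constructible_ext (constructible_and h IH) => k t x.
by have [] := pselect (F' k t x); tauto.
Qed.

Lemma constructible_ren (V V' : finType) (f : V -> V') (X : fam void V) :
  constructible X -> constructible (fun k t x => X k t (x \o f)).
Proof.
have cf (F : fam void V) : coded F -> coded (fun k t x => F k t (x \o f)).
  by move=> /(coded_subst (fun i => inl (f i))); apply: coded_ext.
elim=> [|F F' X' /cf cF /cf cF' _ IH]; first exact: constructible0.
exact: constructibleU.
Qed.

Lemma constructible_big (V : finType) n (X : 'I_n -> fam void V) :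
  (forall i, constructible (X i)) -> constructible (fun k t x => exists i, X i k t x).
Proof.
elim: n X => [|n IH] X cX.
  by apply: constructible_ext (constructible0 V) => k t x; split=> // -[[]].
apply: constructible_ext (constructible_or (cX ord0) (IH (fun i => X (lift ord0 i)) _)) => //.
move=> k t x; split=> [[h|[i h]]|[i]]; [by exists ord0|by exists (lift ord0 i)|].
by case: (unliftP ord0 i) => [j ->|->]; [right; exists j|left].
Qed.

Variable k0 : K.
Hypothesis wom : weakly_o_minimal (St k0).
Hypothesis transfer : forall X : forall k, (void -> St k) -> Prop, UD X ->
  X k0 (@of_void _) -> forall k, X k (@of_void _).

(* The interval [l, u] over which we project is indexed by both of its end points,
   with l + u = 0 so that these intervals form a chain. *)
Definition bounded_proj (V : finType) (F F' : fam void (option V)) :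
    fam (bool + unit) V :=
  fun k s x => let l := s (inl false) in let u := s (inl true) in
    sadd (sadd l u) (sadd l u) = sadd l u /\
    exists y, [/\ F k (@of_void _) (extend x y) /\
      shrink F' k (extend (@of_void _) (s (inr tt))) (extend x y),
      ~ y ≪ pt l & ~ pt u ≪ y].

Arguments bounded_proj : clear implicits.

Lemma coded_bounded_proj (V : finType) (F F' : fam void (option V)) :
  coded F -> coded F' -> coded (bounded_proj V F F').
Proof.
move=> cF cF'; apply: coded_and.
  apply: (coded_cond V (Q := fun k (s : bool + unit -> St k) =>
    sadd (sadd (s (inl false)) (s (inl true))) (sadd (s (inl false)) (s (inl true))) =
    sadd (s (inl false)) (s (inl true)))).
  by udef.
have cS : coded (fun k (t : option void -> St k) x => F k (fun i => t (Some i)) x /\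
    shrink F' k t x).
  by apply: coded_and; [apply: coded_param => //|apply: coded_shrink].
have := coded_param (t := fun k (s : bool + unit -> St k) (i : option (option (option void))) =>
   match i with None => s (inl true) | Some None => s (inl false)
   | Some (Some None) => s (inr tt) | Some (Some (Some w)) => of_void (St k) w end) (coded_proj cS) _.
move=> h; have {}h := h (fun i => ltac:(case: i => [[[[]|]|]|]; udef)).
apply: coded_ext h => k s x; rewrite /proj.
have -> : (fun i : option void => if i is Some w then of_void (St k) w else s (inr tt)) =
   extend (@of_void _) (s (inr tt)) by apply: funext => -[[]|].
have -> : (fun i : void => extend (@of_void _) (s (inr tt)) (Some i)) = @of_void _.
  exact: void_fun.
by [].
Qed.

Lemma bounded_proj_chain1 (V : finType) (F F' : fam void (option V)) k t :
  chain (fun t' => bounded_proj V F F' k (join_val t t')).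
Proof.
move=> t1 t2; have [e1|e1] := pselect (ozero ≺ t1 tt); last first.
  by left=> x [_ [y [[_ []]]]].
have [e2|e2] := pselect (ozero ≺ t2 tt); last by right=> x [_ [y [[_ []]]]].
have [le|le] := pselect (t1 tt ≺ t2 tt); [right|left] => x [h0 [y [[Fy sy] h1 h2]]];
  split=> //; exists y; split=> //; split=> //; apply: shrink_mono sy => //=; rewrite /join_val; ord.
Qed.

Lemma bounded_proj_chain2 (V : finType) (F F' : fam void (option V)) k t1 t2 :
  (forall t' x, bounded_proj V F F' k (join_val t1 t') x ->
     bounded_proj V F F' k (join_val t2 t') x) \/
  (forall t' x, bounded_proj V F F' k (join_val t2 t') x ->
     bounded_proj V F F' k (join_val t1 t') x).
Proof.
(* An idempotent of a group is zero: the equation in [bounded_proj] expresses that the sum of the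
   end points vanishes, without a constant for zero. *)
have dbl (x : St k) : sadd x x = x -> x = ozero.
  by rewrite -[X in _ = X -> _](addr0 x); apply: add_inj.
have key (s s' : bool -> St k) t' x : sadd (s' false) (s' true) = ozero -> ~ s' true ≺ s true ->
    bounded_proj V F F' k (join_val s t') x -> bounded_proj V F F' k (join_val s' t') x.
  move=> z' le [/= /dbl z [y [Fy h1 h2]]]; split=> /=; first by rewrite z' add0.
  have le' : ~ s false ≺ s' false.
    move=> lt; have : sadd (s false) (s true) ≺ sadd (s' false) (s true) by rewrite addr_ltE.
    have : ~ sadd (s' false) (s' true) ≺ sadd (s' false) (s true) by rewrite addl_ltE.
    by rewrite z z' => ? ?; ord.
  exists y; split=> //.
    have ? : ~ pt (s false) ≪ pt (s' false) by move/pt_lt.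
    by ord.
  have ? : ~ pt (s' true) ≪ pt (s true) by move/pt_lt.
  by ord.
have [z1|z1] := pselect (sadd (t1 false) (t1 true) = ozero); last first.
  by left=> t' x [/dbl].
have [z2|z2] := pselect (sadd (t2 false) (t2 true) = ozero); last first.
  by right=> t' x [/dbl].
have [le|le] := pselect (t2 true ≺ t1 true); [right|left] => t' x; apply: key => //; ord.
Qed.

Lemma bounded_projP (V : finType) (F F' : fam void (option V)) k x : coded F' ->
  (exists s, bounded_proj V F F' k s x) <->
  exists y, F k (@of_void _) (extend x y) /\ ~ F' k (@of_void _) (extend x y).
Proof.
move=> cF'; split=> [[s [_ [y [[Fy sy] _ _]]]]|[y [Fy nF']]].
  exists y; split=> // Fy'; apply: (shrink_disj sy).
  by rewrite (void_fun (fun i => _) (@of_void _)).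
have [e se] := shrink_cover cF' nF'.
have [a ay] := cut_lower y; have [b yb] := cut_upper y.
(* The interval is made symmetric: [u] is at least [b] and at least the opposite [a'] of [a], so its
   opposite [l] is at most [a]. *)
have [a' za] := solve_right a ozero.
have [u [bu au _]] := exists_max b a'.
have [l zl] := solve_left u ozero.
exists (join_val (fun i : bool => if i then u else l) (fun=> e)).
split; first by rewrite /= zl add0.
exists y; split=> //=.
  have ? : ~ a ≺ l.
    move=> al; have : ~ sadd a u ≺ sadd a a' by rewrite addl_ltE.
    have : sadd a u ≺ sadd l u by rewrite addr_ltE.
    by rewrite za zl => ? ?; ord.
  have ? : ~ pt a ≪ pt l by move/pt_lt.
  by ord.
have ? : ~ pt u ≪ pt b by move/pt_lt.
by ord.
Qed.

(** The difference of [F] and [F'] is exhausted by coded sets by means of [shrink], and the line by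
    bounded intervals. The projection is thus the union of a two-parameter increasing family of
    coded sets, to which the stratification applies. *)
Lemma constructible_ex (V : finType) (X : fam void (option V)) :
  constructible X -> constructible (fun k t x => exists y, X k t (extend x y)).
Proof.
elim=> [|F F' X' cF cF' _ IH].
  by apply: constructible_ext (constructible0 V) => k t x; split=> // -[].
have cA := coded_bounded_proj cF cF'.
have h : constructible (fun k t x => exists y, F k t (extend x y) /\ ~ F' k t (extend x y)).
  have cs i := coded_strata cA i.
  have := constructible_big (fun i : 'I_(#|V|).+1 => constructible_diff (cs i) (coded_outer cA (cs i))).
  apply: constructible_ext => k t x.
  rewrite -(union_strata wom transfer cA); last 2 first.
  - exact: bounded_proj_chain1.
  - exact: bounded_proj_chain2.
  by rewrite (bounded_projP _ _ cF') (void_fun t (@of_void _)).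
apply: constructible_ext (constructible_or h IH) => k t x; split.
  by move=> [[y [? ?]]|[y ?]]; exists y; [left|right].
by move=> [y [[? ?]|?]]; [left|right]; exists y.
Qed.
End Constructible.

(** * Elementary equivalence of the completions *)

Section Closure.
Context {L : language} {M : structure (og_lang L)} {T : tame M}.
Notation cM := (completion M).

(** The product topology is the coarsest one with continuous coordinates, so both directions are
    checked on coordinates; corners in M suffice by density. *)
Lemma nbhs_ptws n (c : 'I_n -> cM) (A : set ('I_n -> cM)) :
  nbhs (c : {ptws 'I_n -> otop (@cut_lt L M)}) A <->
  exists u v, inbox u v c /\ forall y, inbox u v y -> A y.
Proof.
have nomin (x : cM) : exists y, y ≪ x by have [a ?] := cut_lower x; exists (pt a).
have nomax (x : cM) : exists y, x ≪ y by have [a ?] := cut_upper x; exists (pt a).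
pose (F := [set B : set {ptws 'I_n -> otop (@cut_lt L M)} |
   exists u v, inbox u v c /\ forall y, inbox u v y -> B y]).
split; last first.
  move=> [u [v [huv h]]].
  have near_i i : nbhs (c : {ptws 'I_n -> otop (@cut_lt L M)})
      [set y | pt (u i) ≪ (y i : cM) /\ (y i : cM) ≪ pt (v i)].
    have /(_ c) := @proj_continuous _ (fun _ : 'I_n => otop (@cut_lt L M)) i.
    move=> /(_ [set z | pt (u i) ≪ z /\ z ≪ pt (v i)]); apply; apply/(nbhs_otop nomin nomax).
    by exists (pt (u i)), (pt (v i)); have [? ?] := huv i; split.
  have hn := @filter_forall _ _ _ (nbhs (c : {ptws 'I_n -> otop (@cut_lt L M)})) _ near_i.
  by refine (@filterS _ _ (nbhs_filter _) _ _ _ (hn (nbhs_filter _))) => y; apply: h.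
have FF : Filter F.
  split.
  - by have [u [v ?]] := exists_inbox c; exists u, v.
  - move=> A1 A2 [u [v [h1 g1]]] [u' [v' [h2 g2]]].
    have [a [b [h s1 s2]]] := inboxI h1 h2; exists a, b; split=> // y hy.
    by split; [apply/g1/(inbox_bsub s1)|apply/g2/(inbox_bsub s2)].
  - by move=> A1 A2 A12 [u [v [h1 g1]]]; exists u, v; split=> // y /g1/A12.
suff : cvg_to F (nbhs (c : {ptws 'I_n -> otop (@cut_lt L M)})) by apply.
apply/cvg_sup => i B; rewrite nbhsE => -[_ [[C oC <-] Cc] sub].
have : nbhs (c i : otop (@cut_lt L M)) C by apply: open_nbhs_nbhs.
move=> /(nbhs_otop nomin nomax)[a [b [ac cb h]]].
have [a' [aa' a'c]] := cut_dense ac; have [b' [cb' b'b]] := cut_dense cb.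
have [u [v huv]] := exists_inbox c.
exists (upd i a' u), (upd i b' v); split.
  by move=> j; rewrite /upd; case: eqP => [->|].
move=> y /(_ i); rewrite /upd eqxx => -[? ?]; apply: sub; apply: h; ord.
Qed.

Lemma cl_completionP n (X : set ('I_n -> M)) c : cl_completion X c <->
  forall u v, inbox u v c -> exists y, X y /\ vbox u v y.
Proof.
split=> [h u v huv|h B /nbhs_ptws[u [v [huv sub]]]].
  have /h[d [[y Xy dy] hd]] : nbhs (c : {ptws 'I_n -> otop (@cut_lt L M)}) (inbox u v).
    by apply/nbhs_ptws; exists u, v.
  exists y; split=> //; apply/inbox_pt; suff <- : @eq ('I_n -> cM) d (ptv (T := T) y) by [].
  by apply: funext => i; apply: cut_eq => z; rewrite dy.
have [y [Xy hy]] := h u v huv; exists (ptv y); split; last by apply: sub; apply/inbox_pt.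
by exists y.
Qed.
End Closure.

(** * Elimination of quantifiers in the completion *)

Section StarSat.
Context {L : language} {K : Type} {St : K -> structure (og_lang L)}.
Context {T : forall k, tame (St k)}.
Notation c := (fun k => @of_void (St k)).
Notation coded := (coded (c := c)).
Notation constructible := (constructible (c := c)).
Variable k0 : K.
Hypothesis wom : weakly_o_minimal (St k0).
Hypothesis transfer : forall X : forall k, (void -> St k) -> Prop, UD c X ->
  X k0 (@of_void _) -> forall k, X k (@of_void _).

Lemma coded_le (V : finType) (i j : V) :
  coded (fun k (_ : void -> St k) (x : V -> completion (St k)) => ~ x i ≪ x j).
Proof.
apply: coded_ext (coded_code (G := fun k t u v => ~ u j ≺ v i) _); last by udef.
move=> k t x; split=> [h|ij u v huv]; last first.
  apply; apply/pt_lt; have [_ ?] := huv i; have [? _] := huv j; ord.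
move=> /[dup] ij /cut_dense[a [ia aj]]; have [u [v huv]] := exists_inbox x.
(* The point [a] of M strictly between the two coordinates is the upper end for [i] and the lower
   end for [j]. *)
apply: (h (upd j a u) (upd i a v)) => [l|].
  by have [? ?] := huv l; rewrite /upd; split; case: eqP => [->|].
by rewrite /upd !eqxx; apply: lt_irr.
Qed.

Lemma coded_cl n (phi : formula (og_lang L) ('I_n + void)) :
  coded (fun k (_ : void -> St k) x => cl_completion (solutions (@of_void (St k)) phi) x).
Proof.
apply: coded_ext (coded_code (G := fun k t u v => forall y, vbox u v y ->
  ~ solutions (@of_void (St k)) phi y) _).
  move=> k t x; rewrite cl_completionP; split=> h u v huv.
    apply: contrapT => /forallNP h'; apply: (h u v huv) => y hy Xy.
    by apply: (h' y).
  by have [y [Xy hy]] := h u v huv => /(_ y hy).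
rewrite /vbox; udef.
apply: (UD_ren (fun i => inr i) (X := fun k y => solutions (@of_void (St k)) phi y)).
by exists phi.
Qed.

(** Induction on the formula, with [constructible_ex] for the quantifier. [f] brings the variables
    into a finite type, and one constructible description serves for all [k]. *)
Lemma sat_constructible V0 (phi : formula (star_lang L void) V0) (V : finType) (f : V0 -> V) :
  constructible (fun k (_ : void -> St k) x => sat (M := star_empty (St k)) phi (x \o f)).
Proof.
have cle (W : finType) (i j : W) := constructible_coded (coded_le i j).
elim: phi V f => {V0} [V0|V0 s t|V0 r a|V0 p IHp q IHq|V0 p IHp] V f.
- exact: constructible0.
- case: s t => [i|[]] [j|[]] /=.
  apply: constructible_ext (constructible_and (cle V (f i) (f j)) (cle V (f j) (f i))).
  by move=> k t x; split=> [[h h']|->]; [exact: le_anti|split; apply: lt_irr].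
- have /choice[g ag] : forall i, exists j, a i = TVar _ j by move=> i; case: (a i) => [j|[]]; exists j.
  have -> : a = fun i => TVar _ (g i) by apply: funext.
  case: r a g ag => [|n phi] a g _ /=.
    apply: constructible_ext (constructible_not (cle V (f (g ord0)) (f (g ord_max)))) => k t x.
    by split=> [/contrapT|h]; [|apply].
  exact: (constructible_ren (f \o g) (constructible_coded (coded_cl phi))).
- apply: constructible_ext (constructible_or (constructible_not (IHp V f)) (IHq V f)) => k t x /=.
  have [h|h] := pselect (sat (M := star_empty (St k)) p (x \o f)); tauto.
- have := constructible_not (constructible_ex wom transfer (constructible_not (IHp _ (omap f)))).
  apply: constructible_ext => k t x /=; split=> [/forallNP h y|h [y]]; last first.
    by rewrite extend_omap; apply.
  by have /contrapT := h y; rewrite extend_omap.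
Qed.

(** Without coordinates there is a single point and a single box, so membership is the failure of
    [avoid], which is a condition on the structure itself. *)
Lemma UD_constructible (X : forall k, (void -> St k) -> (void -> completion (St k)) -> Prop) :
  constructible X -> UD c (V := void) (fun k t => X k t (@of_void _)).
Proof.
have h (F : fam (St := St) void void) : coded F -> UD c (V := void) (fun k t => F k t (@of_void _)).
  move=> cF.
  have d : UD c (V := void) (fun k t => ~ avoid (F k t) (@of_void _) (@of_void _)).
    by apply: UD_not; refine (UD_avoid cF _ _ _) => [[]|[]|[]].
  apply: UD_ext d => k t; split=> [|Ft /(_ (@of_void _))]; last by apply=> // -[].
  by move=> nav; apply: contrapT => nF; apply: nav => x _; rewrite (void_fun x (@of_void _)).
elim=> [|F F' X' /h dF /h dF' _ IH]; first exact: UD_const.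
by udef.
Qed.

Lemma star_transfer (phi : sentence (star_lang L void)) k :
  sat (M := star_empty (St k0)) phi (@of_void _) <-> sat (M := star_empty (St k)) phi (@of_void _).
Proof.
have cX := sat_constructible phi (@of_void void).
have e k' : (@of_void (star_empty (St k'))) \o (@of_void void) = @of_void _ by exact: void_fun.
have h (X : fam (St := St) void void) : constructible X ->
    X k0 (@of_void _) (@of_void _) -> X k (@of_void _) (@of_void _).
  by move=> /UD_constructible/transfer h /h; apply.
split; first by have := h _ cX; rewrite !e.
have := h _ (constructible_not cX); rewrite !e => {}h s.
by apply: contrapT => /h.
Qed.
End StarSat.

(** * Transfer between elementarily equivalent structures *)

Section Equivalent.
Context {L : language} {M N : structure (og_lang L)}.
Hypothesis MN : elementarily_equivalent M N.

Definition either (b : bool) : structure (og_lang L) := if b then M else N.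
Notation c := (fun k : bool => @of_void (either k)).

Lemma either_transfer (X : forall k, (void -> either k) -> Prop) : UD c X ->
  X true (@of_void _) -> forall k, X k (@of_void _).
Proof.
move=> [phi h] Xt [//|].
have e k : join_val (@of_void (either k)) (@of_void (either k)) =
    (@of_void (either k)) \o (fun i : void + void => match i with inl j | inr j => j end).
  by apply: funext => -[[]|[]].
have h' k : X k (@of_void _) <->
    sat (fren phi (fun i : void + void => match i with inl j | inr j => j end)) (@of_void (either k)).
  by rewrite sat_fren -e h.
by apply/h'/(MN _)/(h' true).
Qed.

Lemma ordered_group_transfer : is_ordered_group M -> is_ordered_group N.
Proof.
pose (X k (_ : void -> either k) := (forall x : either k, ~ x ≺ x) /\
   ((forall x y z : either k, x ≺ y -> y ≺ z -> x ≺ z) /\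
   ((forall x y : either k, x ≺ y \/ (x = y \/ y ≺ x)) /\
   ((forall x y z : either k, sadd x (sadd y z) = sadd (sadd x y) z) /\
   ((exists e : either k, is_zero e) /\
   ((forall x : either k, exists y, is_zero (sadd x y) /\ is_zero (sadd y x)) /\
   ((forall x y z : either k, x ≺ y -> sadd z x ≺ sadd z y) /\
   (forall x y z : either k, x ≺ y -> sadd x z ≺ sadd y z)))))))).
have dX : UD c X by rewrite /X /is_zero; udef.
move=> [h1 h2 h3 h4 h5 h6 h7 h8].
have : X true (@of_void _).
  have h3' (x y : M) : x ≺ y \/ (x = y \/ y ≺ x) by have [] := h3 x y; tauto.
  by rewrite /X; tauto.
move=> /(either_transfer dX)/(_ false)[g1 [g2 [g3 [g4 [g5 [g6 [g7 g8]]]]]]].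
by split=> // x y; have [?|[?|?]] := g3 x y; [apply: Or31|apply: Or32|apply: Or33].
Qed.

(** A definable set of [N] comes with a formula and finitely many parameters; quantifying
    universally over these gives a sentence that holds in [M]. *)
Lemma tame_transfer : tame M -> tame N.
Proof.
move=> [gM eM dM nM]; have gN := ordered_group_transfer gM.
have inh k : inhabited (either k).
  by case: k; [have [e _] := og_zero gM|have [e _] := og_zero gN]; exists.
split=> //.
- have dX : UD c (V := void) (fun k _ => exists x y : either k, x ≺ y) by udef.
  exact: (either_transfer dX eM false).
- have dX : UD c (V := void) (fun k _ => forall x y : either k, x ≺ y -> exists z, x ≺ z /\ z ≺ y) by udef.
  move=> x y xy; have [|z []] := either_transfer dX _ false x y xy; last by exists z.
  by move=> x' y' /dM[z ? ?]; exists z.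
move=> C [phi Cphi].
have [W [psi H]] := param_support phi.
have [y hy] := H N id (inh false).
pose (D k (t : option W -> either k) := sat psi (join_val (fun=> t None) (fun w => t (Some w)))).
have CD x : C x <-> D false (extend y x).
  rewrite /D /= -hy; have := f_equal (fun Y : set ('I_1 -> N) => Y (fun=> x)) Cphi.
  by rewrite /solutions /= => ->.
have dD V t1 t2 : (forall i, UT c (V := V) (fun k v => t1 k v i)) -> UT c t2 ->
    UD c (fun k v => D k (extend (t1 k v) (t2 k v))).
  move=> u1 u2; apply: (UD_sub (c := c) (X := D) (t := fun k v => extend (t1 k v) (t2 k v))) => //.
    exists (fren psi (fun i => match i with inl _ => inl None | inr w => inl (Some w) end)).
    move=> k v; rewrite sat_fren /D; set a := join_val _ _; set b := _ \o _.
    by have -> : a = b by apply: funext => -[|].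
  by case.
pose (X k (_ : void -> either k) := forall y : W -> either k,
   (exists x, D k (extend y x)) -> (exists x, ~ D k (extend y x)) ->
   (forall x x', D k (extend y x) -> x' ≺ x -> D k (extend y x')) ->
   forall z e, is_zero z -> z ≺ e -> exists x x',
     D k (extend y x) /\ (~ D k (extend y x') /\ x' ≺ sadd x e)).
have dX : UD c X.
  rewrite /X /is_zero; apply: UD_allV => //; udef.
  all: try (apply: dD => [i|]; udef).
move=> eC nC Cd z e z0 ze.
have XM : X true (@of_void _).
  move=> t h1 h2 h3 z' e' hz hze.
  have dC : definable1 (fun x => D true (extend t x)).
    exists (fren psi (fun i => match i with inl j => inl j | inr w => inr (t w) end)).
    have ev (v : 'I_1 -> M) : join_val (fun _ : 'I_1 => v ord0) t = join_val v id \o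
        (fun i => match i with inl j => inl j | inr w => inr (t w) end).
      by apply: funext => -[j|//] /=; rewrite ord1.
    by apply/seteqP; split=> v; rewrite /solutions /= sat_fren -ev.
  by have [x [x' [? ? ?]]] := nM _ dC h1 h2 h3 _ _ hz hze; exists x, x'.
have [|||x [x' [Dx [Dx' ?]]]] := either_transfer dX XM false y _ _ _ z e z0 ze.
- by have [x /CD] := eC; exists x.
- by have [x nx] := nC; exists x => /CD.
- by move=> x x' /CD Cx lt; apply/CD; apply: Cd lt.
by exists x, x'; split=> //; [apply/CD|move/CD].
Qed.
End Equivalent.

Lemma star_equiv_nontrivial L (M N : structure (og_lang L)) :
  non_valuational M -> (exists x y : M, x ≺ y) -> elementarily_equivalent M N ->
  elementarily_equivalent (star_empty M) (star_empty N).
Proof.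
move=> hM nt MN; have TM := non_valuational_tame hM nt.
have TN := tame_transfer MN TM.
have T k : tame (either (M := M) (N := N) k) by case: k.
have [_ wom _] := hM.
by move=> phi; apply: (star_transfer (k0 := true) wom (either_transfer MN) phi false).
Qed.

(** * The one-element group *)

Lemma definable_subsingleton L (S : structure L) n (X : set ('I_n -> S)) :
  (forall x y : S, x = y) -> definable X.
Proof.
move=> sub; have [[x Xx]|nX] := pselect (exists x, X x).
  exists (FImp (FFalse _ _) (FFalse _ _)); apply/seteqP; split=> y _; first by [].
  by have -> : y = x by apply: funext => i; apply: sub.
exists (FFalse _ _); apply/seteqP; split=> y //= Xy.
by case: nX; exists y.
Qed.

Section TrivialGroup.
Context {L : language} {M : structure (og_lang L)}.
Hypothesis og : is_ordered_group M.
Hypothesis triv : ~ exists x y : M, x ≺ y.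

Lemma trivial_eq (x y : M) : x = y.
Proof. by have [h|//|h] := og_total og x y; case: triv; [exists x, y|exists y, x]. Qed.

Lemma trivial_completion_eq (c d : completion M) : c = d.
Proof.
have cT (e : completion M) : proj1_sig e = setT.
  case: e => C [_ _ [x Cx] _ _] /=; apply/seteqP; split=> // y _.
  by rewrite (trivial_eq y x).
case: c (cT c) => C hC /= e; case: d (cT d) => D hD /= e'; subst.
by congr exist; apply: Prop_irrelevance.
Qed.

Lemma trivial_completion_inh : completion M.
Proof.
have [z _] := cid (og_zero og); exists setT; split=> //.
- by exists (FImp (FFalse _ _) (FFalse _ _)); apply/seteqP; split=> x _.
- exact: openT.
- by exists z.
- by exists z => x _; right; apply: trivial_eq.
Qed.

(** In the one-element group the ray below a point is empty and is not a cut. No point of the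
    completion comes from M, and the image of [X] is empty unless there are no coordinates. *)
Lemma trivial_cl n (X : set ('I_n -> M)) c :
  cl_completion X c <-> n = 0 /\ exists x, X x.
Proof.
split=> [h|[n0 [x Xx]] B Bc].
  have [d [[x Xx hx] _]] := h setT filterT.
  case: n X c h d x Xx hx => [|n] X c h d x Xx hx; first by split=> //; exists x.
  have [_ _ [y dy] _ _] := proj2_sig (d ord0).
  by move: dy; rewrite hx /= => dy; case: triv; exists y, (x ord0).
subst; exists c; split; first by exists x => // -[].
exact: nbhs_singleton Bc.
Qed.
End TrivialGroup.

Lemma star_equiv_trivial L (M N : structure (og_lang L)) :
  is_ordered_group M -> (~ exists x y : M, x ≺ y) -> elementarily_equivalent M N ->
  elementarily_equivalent (star_empty M) (star_empty N).
Proof.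
move=> ogM tM MN; have ogN := ordered_group_transfer MN ogM.
have tN : ~ exists x y : N, x ≺ y.
  have dX : UD (fun k => @of_void (either (M := M) (N := N) k)) (V := void)
      (fun k _ => ~ exists x y : either (M := M) (N := N) k, x ≺ y) by udef.
  exact: (either_transfer MN dX tM false).
suff h V (phi : formula (star_lang L void) V) (v : V -> star_empty M) (v' : V -> star_empty N) :
    sat phi v <-> sat phi v' by move=> phi; apply: h.
have eM := trivial_completion_eq ogM tM; have eN := trivial_completion_eq ogN tN.
elim: phi v v' => {V} /= [V|V s t|V r a|V p IHp q IHq|V p IHp] v v' //.
- case: r a => [|n phi] a /=.
    have iM (x y : completion M) : ~ x ≪ y by move=> [_]; rewrite (eM x y); apply.
    have iN (x y : completion N) : ~ x ≪ y by move=> [_]; rewrite (eN x y); apply.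
    by split=> [/iM|/iN].
  rewrite (trivial_cl tM) (trivial_cl tN).
  (* Without coordinates the formula amounts to a sentence, on which both structures agree. *)
  have e0 : n = 0 -> exists psi : sentence (og_lang L), forall S : structure (og_lang L),
      (exists x, solutions (@of_void S) phi x) <-> sat psi (@of_void S).
    move=> n0; subst; have [f] : inhabited ('I_0 -> void) by constructor; case.
    exists (fren phi (fun i => match i with inl j => f j | inr w => w end)) => S; rewrite sat_fren.
    have e x : join_val x (@of_void S) =
        @of_void S \o (fun i => match i with inl j => f j | inr w => w end).
      by apply: funext => -[[]|[]].
    by split=> [[x]|h]; [|exists (@of_void S \o f)]; rewrite /solutions /= e.
  by split=> -[/[dup] n0 /e0[psi hpsi] h]; split=> //; apply/hpsi/MN/hpsi.
- by rewrite (IHp v v') (IHq v v').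
split=> h x; first by apply/(IHp (extend v (trivial_completion_inh ogM tM))).
by apply/(IHp _ (extend v' (trivial_completion_inh ogN tN))).
Qed.

(** * Closures of sets defined with parameters *)

Section Trace.
Context {L : language} {M : structure (og_lang L)} {T : tame M}.
Notation cM := (completion M).
Hypothesis wom : weakly_o_minimal M.

Definition ccl V (X : (V -> M) -> Prop) (c : V -> cM) :=
  forall u v, inbox u v c -> exists y, X y /\ vbox u v y.

(* A set with trace [X] on M, provided that [iter n vfrontier X] is empty. *)
Fixpoint hat V n (X : (V -> M) -> Prop) (c : V -> cM) : Prop :=
  if n is n'.+1 then ccl X c /\ ~ hat n' (vfrontier X) c else False.

(** On M, [ccl X] is the closure of [X], and removing the frontier from it leaves [X]; the recursion
    ends because the iterated frontier is empty. *)
Lemma hat_ptv V n (X : (V -> M) -> Prop) x :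
  (forall y, ~ iter n (@vfrontier _ M V) X y) -> hat n X (ptv x) <-> X x.
Proof.
elim: n X => [|n IH] X h /=; first by split=> // /h.
rewrite IH; last by move=> y; rewrite -iterSr; apply: h.
have e : ccl X (ptv x) <-> vclosure X x.
  by split=> hx u v huv; apply: hx; apply/inbox_pt.
split=> [[/e cx nX]|Xx]; first by apply: contrapT => ?; apply: nX.
split; last by case.
by apply/e; apply: vclosure_incl.
Qed.

Definition decides V (a b : V -> M) (S : (V -> cM) -> Prop) :=
  (forall c, inbox a b c -> S c) \/ (forall c, inbox a b c -> ~ S c).

(** [sub_constant] decides the closure at the points of M. If they all belong to it, so do the
    points of the completion, by closedness; if none does, [hidden_avoidP] excludes the others on a
    smaller box. *)
Lemma box_decides (U W : finType) (X : (U + W -> M) -> Prop) n (t : W -> M) a b :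
  pdef X -> isbox a b -> exists a' b', [/\ isbox a' b', bsub a b a' b' &
    decides a' b' (fun c : U -> cM => hat n X (join_val c (ptv t)))].
Proof.
elim: n X a b => [|n IH] X a b dX ab; first by exists a, b; split; [|exact: bsub_refl|right=> c _ []].
have dF : pdef (vfrontier X) by exact: (pdef_iter_frontier 1 dX).
have [a1 [b1 [ab1 s1 h1]]] := IH _ a b dF ab.
pose (F := fun (s : W -> M) (c : U -> cM) => ccl X (join_val c (ptv s))).
have cF : mcoded F.
  have cX : mcoded (fun (_ : void -> M) => ccl X).
    apply: coded_ext (coded_code (K := unit) (St := fun=> M) (c := fun=> id)
      (G := fun k _ u v => forall y, vbox u v y -> ~ X y) _).
      move=> k s x; split=> h u v huv.
        by apply: contrapT => /forallNP h'; apply: (h u v huv) => y hy Xy; apply: (h' y).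
      by have [y [Xy hy]] := h u v huv => /(_ y hy).
    rewrite /vbox; udef.
    by apply: (UD_ren (fun i => inr i) (X := fun _ => X)).
  have cX' : mcoded (fun (_ : W -> M) => ccl X).
    by refine (coded_param (t := fun k z => @of_void M) cX _) => -[].
  by apply: coded_ext (coded_subst id cX').
have [hP _] := generic_dichotomy wom U.
have [|a2 [b2 [ab2 s2 h2]]] := hP (fun x => F t (ptv x)) _ a1 b1 ab1.
  apply: UD_ext (UD_hit (t := fun _ _ => t) (u := fun _ x => x) (v := fun _ x => x) cF _ _ _) => [_ x||i|i].
  - exact: hit_pt.
  - by move=> i; udef.
  - by udef.
  - by udef.
have s02 : bsub a b a2 b2 by exact: bsub_trans s1 s2.
have sub c : inbox a2 b2 c -> inbox a1 b1 c by apply: inbox_bsub.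
case: h2 => h2.
  have h3 c : inbox a2 b2 c -> ccl X (join_val c (ptv t)).
    move=> hc; apply: contrapT => nF.
    have [u [v [huv av]]] := coded_closed cF (k := tt) (t := t) nF.
    have [p [q [hpq s3 s4]]] := inboxI hc huv.
    have [m hm] := box_inh (inbox_lt hpq).
    apply: (av (ptv m)); first by apply/inbox_pt/(vbox_bsub s4).
    by apply/h2/(vbox_bsub s3).
  exists a2, b2; split=> //; case: h1 => h1.
    by right=> c hc [_]; apply; apply/h1/sub.
  by left=> c hc; split; [apply: h3|apply/h1/sub].
have [|||a3 [b3 [ab3 s3 h3]]] := hidden_avoidP wom (coded_param (K := unit) (St := fun=> M)
    (t := fun k (z : void -> M) => t) cF _) _ ab2.
- by move=> i; udef.
- by move=> ? ?; left.
- by move=> _; apply: h2.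
exists a3, b3; split=> //; first exact: bsub_trans s3.
by right=> c hc [Fc _]; apply: (h3 (@of_void _) c hc).
Qed.

(* A closure in the completion with parameters, in terms of the closures of
   parameter-free sets: [c] is in the closure of [X] iff every box around [c]
   contains an open family of boxes meeting [X]. *)
Definition meets_near (V W : finType) (H : (V + V + W -> cM) -> Prop) (t : W -> cM) (c : V -> cM) :=
  forall u0 v0 : V -> cM, (forall i, u0 i ≪ c i /\ c i ≪ v0 i) ->
  exists p q r s : V -> cM, (forall i, (~ p i ≪ u0 i /\ p i ≪ q i) /\ (r i ≪ s i /\ ~ v0 i ≪ s i)) /\
    forall u v, (forall i, (p i ≪ u i /\ u i ≪ q i) /\ (r i ≪ v i /\ v i ≪ s i)) ->
      H (join_val (join_val u v) t).

(** [hat] describes the boxes meeting the fibre at [t] correctly only for corners in M. By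
    [box_decides] its value is constant on some box of corners around [c], also at corners in the
    completion, and a pair of corners in M shows that this value is the right one. The number of
    iterations is that of [iter_frontier_empty]. *)
Lemma ccl_param (V W : finType) (X : (V + W -> M) -> Prop) (t : W -> M) c : pdef X ->
  ccl (fun x => X (join_val x t)) c <->
  meets_near (hat (#|((V + V + W)%type : finType)|).+1 (fun w => exists x, X (join_val x (fun i => w (inr i))) /\
    vbox (fun i => w (inl (inl i))) (fun i => w (inl (inr i))) x)) (ptv t) c.
Proof.
move=> dX; set Y := fun w : V + V + W -> M => exists x, _.
have dY : pdef Y.
  rewrite /pdef /Y /vbox; udef.
  refine (UD_sub (X := fun _ => X) (t := fun _ w => join_val (fun i => w (inr i)) (fun i => w (inl (inr i)))) _ dX _).
    by move=> _; apply: tame_inh.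
  by move=> [i|i]; udef.
have tr w : hat (#|((V + V + W)%type : finType)|).+1 Y (ptv w) <-> Y w.
  by apply: hat_ptv; apply: iter_frontier_empty.
have joinE u v : @join_val cM _ _ (join_val (ptv u) (ptv v)) (ptv t) = ptv (join_val (join_val u v) t).
  by apply: funext => -[[i|i]|i].
split=> [h u0 v0 huv|h u0 v0 huv].
  have [/choice[p hp] /choice[q hq]] : (forall i, exists a, u0 i ≪ pt a /\ pt a ≪ c i) /\
     (forall i, exists a, c i ≪ pt a /\ pt a ≪ v0 i).
    by split=> i; apply: cut_dense; have [] := huv i.
  have /choice[p' hp'] : forall i, exists a, pt (p i) ≪ pt a /\ pt a ≪ c i.
    by move=> i; apply: cut_dense; have [] := hp i.
  have /choice[q' hq'] : forall i, exists a, c i ≪ pt a /\ pt a ≪ pt (q i).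
    by move=> i; apply: cut_dense; have [] := hq i.
  (* Lower corners range between [p] and [p'], below [c], and upper corners between [q'] and [q],
     above [c]. *)
  have ab : isbox (join_val p q') (join_val p' q).
    by move=> [i|i] /=; [have [/pt_lt] := hp' i|have [_ /pt_lt] := hq' i].
  have [a [b [ab' s dec]]] := box_decides (#|((V + V + W)%type : finType)|).+1 t dY ab.
  case: dec => dec.
    exists (fun i => pt (a (inl i))), (fun i => pt (b (inl i))), (fun i => pt (a (inr i))), (fun i => pt (b (inr i))).
    split=> [i|u v uv].
      have /pt_lt ? := ab' (inl i); have /pt_lt ? := ab' (inr i).
      have [/= s1 _] := s (inl i); have [/= _ s2] := s (inr i).
      have ? : ~ pt (a (inl i)) ≪ pt (p i) by move/pt_lt.
      have ? : ~ pt (q i) ≪ pt (b (inr i)) by move/pt_lt.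
      have [? ?] := hp i; have [? ?] := hq i.
      by split; split=> //; ord.
    by apply: dec => -[i|i] /=; have [] := uv i.
  have [m hm] := box_inh ab'.
  case: (dec (ptv m)); first exact/inbox_pt.
  pose u i := m (inl i); pose v i := m (inr i).
  have -> : ptv m = join_val (ptv u) (ptv v) by apply: funext => -[].
  rewrite joinE; apply/tr; apply: h => i.
  have [/pt_lt ? /pt_lt ?] := vbox_bsub s hm (inl i); have [/pt_lt ? /pt_lt ?] := vbox_bsub s hm (inr i).
  have [? ?] := hp' i; have [? ?] := hq' i; rewrite /u /v; split; ord.
have [|p [q [r [s [pq]]]]] := h (ptv u0) (ptv v0).
  by move=> i; apply: huv.
have /choice[u hu] : forall i, exists a, p i ≪ pt a /\ pt a ≪ q i.
  by move=> i; apply: cut_dense; have [[]] := pq i.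
have /choice[v hv] : forall i, exists a, r i ≪ pt a /\ pt a ≪ s i.
  by move=> i; apply: cut_dense; have [_ []] := pq i.
move=> /(_ (ptv u) (ptv v)); rewrite joinE tr => -[//|x [Xx hx]].
exists x; split; first by move: Xx; congr X; apply: funext => -[].
move=> i; have [/pt_lt ? /pt_lt ?] := hx i; have [[? ?] [? ?]] := pq i.
by have [? ?] := hu i; have [? ?] := hv i; rewrite /ptv in pq *; split; apply/pt_lt; ord.
Qed.
End Trace.

(** * Comparison of the completions with and without named parameters *)

Section StarDefinable.
Context {L : language} {M : structure (og_lang L)} {T : tame M}.
Notation cM := (completion M).
Notation S0 := (star_empty M).
Notation sUD := (UD (K := unit) (St := fun=> S0) (P := S0) (fun=> id)).
Notation sUT := (UT (K := unit) (St := fun=> S0) (P := S0) (fun=> id)).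
Notation eUD := (UD (K := unit) (St := fun=> M) (fun=> @of_void M)).
Hypothesis wom : weakly_o_minimal M.

Lemma star_inh : inhabited S0.
Proof. exact: (inhabits (pt ozero)). Qed.

Lemma UD_cut_lt V (t1 t2 : unit -> (V -> S0) -> S0) : sUT t1 -> sUT t2 ->
  sUD (fun k v => cut_lt (t1 k v) (t2 k v)).
Proof.
move=> h1 h2.
apply: (@UD_rel _ _ (fun _ : unit => S0) _ (fun=> id) V (StarLt L void)
  (fun k i v => pair2 (t1 k v) (t2 k v) i)).
by move=> i; rewrite /pair2; case: (val i == 0).
Qed.

(** The predicates of the language take coordinates in ordinals, hence the renumbering of [V]. *)
Lemma UD_ccl (V : finType) (X : (V -> M) -> Prop) :
  eUD (fun _ => X) -> sUD (V := V) (fun _ c => ccl X c).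
Proof.
move=> [phi hphi].
pose (psi := fren phi (fun i => match i with inl j => inl (enum_rank j) | inr w => inr w end)).
have hpsi (x : 'I_#|V| -> M) : solutions (@of_void M) psi x <-> X (x \o enum_rank).
  rewrite /solutions /= sat_fren (hphi tt).
  suff -> : join_val x (@of_void M) \o (fun i => match i with inl j => inl (enum_rank j) | inr w => inr w end)
    = join_val (x \o enum_rank) (@of_void M) by [].
  by apply: funext => -[].
have := @UD_rel _ _ (fun _ : unit => S0) _ (fun=> id) V (StarCl psi) (fun k i v => v (enum_val i))
  (fun i => UT_var _).
apply: UD_ext => _ c; rewrite /= cl_completionP; split=> h u v huv.
  have [|y [/hpsi Xy hy]] := h (fun i => u (enum_val i)) (fun i => v (enum_val i)).
    by move=> i; apply: huv.
  exists (y \o enum_rank); split=> // i /=.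
  by have := hy (enum_rank i); rewrite enum_rankK.
have [|y [Xy hy]] := h (fun i => u (enum_rank i)) (fun i => v (enum_rank i)).
  by move=> i; have := huv (enum_rank i); rewrite enum_rankK.
exists (fun i => y (enum_val i)); split; last first.
  by move=> i; have := hy (enum_val i); rewrite enum_valK.
apply/hpsi; suff -> : (fun i => y (enum_val i)) \o enum_rank = y by [].
by apply: funext => i /=; rewrite enum_rankK.
Qed.

Lemma UD_hat (V : finType) n (X : (V -> M) -> Prop) :
  eUD (fun _ => X) -> sUD (V := V) (fun _ c => hat n X c).
Proof.
elim: n X => [|n IH] X dX /=; first exact: UD_const.
apply: UD_and; first exact: UD_ccl.
apply: UD_not; apply: IH.
exact: (@UD_iter_frontier _ _ (fun _ : unit => M) _ (fun=> @of_void M) (fun=> T) V (fun=> X) 1).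
Qed.

Ltac sdef := repeat (cbv beta; first
  [ apply: UD_cut_lt | apply: UD_and | apply: UD_not | apply: UT_var
  | apply: UD_exV; first by move=> ?; apply: star_inh
  | apply: UD_allV; first by move=> ?; apply: star_inh
  | apply: UD_conj; intro | apply: UD_imp ]).

Lemma UD_meets_near (V W : finType) (H : (V + V + W -> S0) -> Prop) (t : W -> S0) :
  sUD (fun _ => H) -> sUD (V := V) (fun _ c => meets_near H t c).
Proof.
move=> dH; rewrite /meets_near; sdef.
refine (UD_sub (X := fun _ => H) _ dH _); first by move=> _; apply: star_inh.
move=> [[i|i]|i] /=; [apply: UT_var..|apply: UT_paramM].
Qed.

(** The parameters of [phi] turn into the points [ptv t] of the completion, which serve as
    parameters there. *)
Lemma UD_cl n (phi : formula (og_lang L) ('I_n + M)) :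
  sUD (V := 'I_n) (fun _ c => cl_completion (solutions id phi) c).
Proof.
have [W [psi hW]] := param_support phi.
have [t ht] := hW M id (tame_inh (T := T)).
pose (X := fun v : 'I_n + W -> M => sat psi v).
have eX : eUD (fun _ => X).
  exists (fren psi inl) => _ v; rewrite sat_fren /X.
  by have -> : join_val v (@of_void M) \o inl = v by apply: funext.
have dX : pdef X.
  exists (fren psi inl) => _ v; rewrite sat_fren /X.
  by have -> : join_val v id \o inl = v by apply: funext.
pose (Y := fun w : 'I_n + 'I_n + W -> M => exists x, X (join_val x (fun i => w (inr i))) /\
  vbox (fun i => w (inl (inl i))) (fun i => w (inl (inr i))) x).
have eY : eUD (fun _ => Y).
  rewrite /Y /vbox; udef.
  refine (UD_sub (X := fun _ => X) (t := fun _ w => join_val (fun i => w (inr i)) (fun i => w (inl (inr i)))) _ eX _).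
    by move=> _; apply: tame_inh.
  by move=> [i|i]; udef.
have := UD_meets_near (ptv (T := T) t) (UD_hat (#|(('I_n + 'I_n + W)%type : finType)|).+1 eY).
move=> d; refine (UD_ext _ d) => _ c; rewrite cl_completionP.
rewrite -(ccl_param wom t c dX); split=> h u v huv; have [y [Xy hy]] := h u v huv;
  exists y; split=> //; exact/ht.
Qed.

Lemma star_full_UD V (phi : formula (star_lang L M) V) :
  sUD (V := V) (fun _ v => sat (M := star_full M) phi v).
Proof.
elim: phi => {V} [V|V s t|V r a|V p IHp q IHq|V p IHp].
- exact: UD_const.
- by case: s t => [i|[]] [j|[]] /=; apply: UD_eq; apply: UT_var.
- have /choice[g ag] : forall i, exists j, a i = TVar _ j by move=> i; case: (a i) => [j|[]]; exists j.
  have -> : a = fun i => TVar _ (g i) by apply: funext.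
  case: r a g ag => [|n phi] a g _ /=; first by apply: UD_cut_lt; apply: UT_var.
  exact: (UD_ren g (UD_cl phi)).
- exact: UD_imp.
- apply: UD_all; apply: UD_ext IHp => _ v.
  by rewrite extendK.
Qed.

Lemma star_empty_full n (X : set ('I_n -> cM)) :
  @definable _ (star_empty M) n X <-> @definable _ (star_full M) n X.
Proof.
split=> -[phi ->].
  have h V (psi : formula (star_lang L void) V) : exists psi' : formula (star_lang L M) V,
      forall v : V -> cM, sat (M := star_empty M) psi v <-> sat (M := star_full M) psi' v.
    elim: psi => {V} [V|V s t|V r a|V p [p' hp] q [q' hq]|V p [p' hp]].
    - by exists (FFalse _ _).
    - by case: s t => [i|[]] [j|[]]; exists (FEq (TVar _ i) (TVar _ j)).
    - have /choice[g ag] : forall i, exists j, a i = TVar _ j by move=> i; case: (a i) => [j|[]]; exists j.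
      have -> : a = fun i => TVar _ (g i) by apply: funext.
      case: r a g ag => [|m psi] a g _ /=.
        by exists (@FRel (star_lang L M) V (StarLt L M) (fun i => TVar (star_lang L M) (g i))).
      pose (psi' := fren psi (fun i => match i with inl j => inl j | inr w => of_void ('I_m + M) w end)).
      exists (@FRel (star_lang L M) V (StarCl psi') (fun i => TVar (star_lang L M) (g i))) => v /=.
      suff -> : solutions id psi' = solutions (@of_void M) psi by [].
      apply: funext => x; apply: propext; rewrite /solutions /= sat_fren.
      suff -> : join_val x id \o (fun i => match i with inl j => inl j | inr w => of_void ('I_m + M) w end)
        = join_val x (@of_void M) by [].
      by apply: funext => -[|[]].
    - by exists (FImp p' q') => v /=; rewrite hp hq.
    - by exists (FAll p') => v /=; split=> hv x; apply/hp.
  have [psi hpsi] := h _ phi; exists psi.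
  by apply/seteqP; split=> x; rewrite /solutions /= => /hpsi.
have [psi hpsi] := star_full_UD phi.
exists (fren psi (fun i => match i with inl j => j | inr p => inr p end)).
apply: funext => x; apply: propext; rewrite /solutions /= sat_fren.
suff -> : join_val x id \o (fun i => match i with inl j => j | inr p => inr p end)
  = join_val (join_val x id) id by exact: (hpsi tt).
by apply: funext => -[].
Qed.
End StarDefinable.

Theorem theorem1 (L : language) (M : structure (og_lang L))
    (hM : non_valuational M) :
  (forall (n : nat) (X : set ('I_n -> completion M)),
     @definable _ (star_empty M) n X <-> @definable _ (star_full M) n X) /\
  (forall N : structure (og_lang L),
     elementarily_equivalent M N ->
     elementarily_equivalent (star_empty M) (star_empty N)).
Proof.
have [og wom _] := hM.
(* In the one-element group the completion is a single point, and both claims are checked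
   directly. *)
have [nt|triv] := pselect (exists x y : M, x ≺ y).
  split; last by move=> N; apply: star_equiv_nontrivial.
  by have T := non_valuational_tame hM nt => n X; apply: star_empty_full.
split; last by move=> N; apply: star_equiv_trivial.
by move=> n X; split=> _; apply: definable_subsingleton; apply: trivial_completion_eq.
Qed.
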